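(* Assume the setting below, with the fixed embedding $K\hookrightarrow B_{p,L}$, $\alpha\mapsto[\alpha,0]$. Then the isomorphism classes of superspecial orders of $B_{p,L}$ containing $\mathcal{O}_K$ (two such orders being isomorphic when one is conjugate to the other by an element of $K^\times$, equivalently by an automorphism of $B_{p,L}$ fixing $K$ pointwise) are in bijection with the ideal class group of $K$ via $[\mathfrak{a}]\mapsto R(\mathfrak{a},\lambda_{\mathfrak{a}})$, $\mathfrak{a}$ an integral ideal representing the class.
   Context: Setting: $L$ totally real of degree $g$, strict class number $1$; $K$ a primitive CM field with $K^+=L$; $\mathcal{O}_K=\mathcal{O}_L[t]$, $t^2+at+b=0$, $d=a^2-4b$ totally negative, $\mathcal{D}=(\sqrt{d})$ the relative different, $(d,2)=1$; $p$ an odd prime unramified in $K$, $(d,p)=1$, every prime of $L$ above $p$ of even residue degree splits in $K$ and every one of odd residue degree is inert in $K$. $B_{p,L}=B_{p,\infty}\otimes_{\mathbb{Q}}L$, $B_{p,\infty}$ the rational quaternion algebra ramified exactly at $p,\infty$. A superspecial order is an $\mathcal{O}_L$-order of $B_{p,L}$ of (reduced) discriminant $p\mathcal{O}_L$. $\alpha_0\in\mathcal{O}_L$ is a totally negative prime element with $(\alpha_0,2pd)=1$, $\alpha_0\equiv p$ mod each prime $\mathfrak{q}\mid d$, $\alpha_0\equiv1\pmod p$, $B_{p,L}\cong\left(\frac{d,\alpha_0p}{L}\right)$, $\alpha_0\mathcal{O}_K=\mathcal{A}\bar{\mathcal{A}}$; $B_{p,L}$ is identified with $\{[\alpha,\beta]=\begin{pmatrix}\alpha&\beta\\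 \alpha_0p\bar\beta&\bar\alpha\end{pmatrix}:\alpha,\beta\in K\}$. For each prime $\mathfrak{q}\mid d$ of $\mathcal{O}_L$ fix $\lambda_{\mathfrak{q}}$ with $\lambda_{\mathfrak{q}}^2\equiv\alpha_0p\pmod{\mathfrak{q}}$, and let $\mathfrak{q}\mathcal{O}_K=\tilde{\mathfrak{q}}^2$. For an integral ideal $\mathfrak{a}$ of $\mathcal{O}_K$, $\lambda_{\mathfrak{a}}\in L$ is any element with $(\lambda_{\mathfrak{a}},d)=1$, $\lambda_{\mathfrak{a}}\equiv(-1)^{\mathrm{val}_{\tilde{\mathfrak{q}}}(\mathfrak{a})}\lambda_{\mathfrak{q}}\pmod{\mathfrak{q}}$ for all $\mathfrak{q}\mid d$, and $\lambda_{\mathfrak{a}}\mathcal{A}^{-1}\mathfrak{a}^{-1}\bar{\mathfrak{a}}$ integral; $R(\mathfrak{a},\lambda_{\mathfrak{a}})=\{[\alpha,\beta]:\alpha\in\mathcal{D}^{-1},\ \beta\in\mathcal{D}^{-1}\mathcal{A}^{-1}\mathfrak{a}^{-1}\bar{\mathfrak{a}},\ \alpha\equiv\lambda_{\mathfrak{a}}\beta\pmod{\mathcal{O}_K}\}$, a superspecial order containing $\mathcal{O}_K$, independent of the choice of $\lambda_{\mathfrak{a}}$. *)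

(* Defs.v *)
From HB Require Import structures.
From mathcomp Require Import all_boot all_order all_algebra all_field.
From mathcomp Require Import boolp classical_sets functions reals.

Set Implicit Arguments.
Unset Strict Implicit.
Unset Printing Implicit Defensive.

Import Order.TTheory GRing.Theory Num.Theory.

Local Open Scope classical_set_scope.
Local Open Scope ring_scope.

(* A number field is a [fieldExtType rat], or a [fieldExtType L] over a number
   field [L]; [L] is then seen in [K] through [x |-> x%:A].  Rings of integers
   and ideals only use the underlying field, and are sets of field elements. *)

Section Ideals.
Variable F : fieldType.

Definition ring_int : set F :=
  [set x | integralOver (intr : int -> F) x].

Definition frac_ideal (I : set F) : Prop :=
  [/\ I 0,
      forall x y, I x -> I y -> I (x + y),
      forall c x, ring_int c -> I x -> I (c * x),
      (exists2 x, I x & x != 0) &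
      exists2 c, c != 0 & forall x, I x -> ring_int (c * x)].

Definition integral_ideal (I : set F) : Prop :=
  frac_ideal I /\ I `<=` ring_int.

Definition prime_ideal (P : set F) : Prop :=
  [/\ integral_ideal P, P <> ring_int &
      forall x y, ring_int x -> ring_int y -> P (x * y) -> P x \/ P y].

Definition ideal_span (S : set F) : set F :=
  [set y | exists n (c v : 'I_n -> F),
     [/\ forall i, ring_int (c i), forall i, S (v i)
       & y = \sum_(i < n) c i * v i]].

Definition principal (x : F) : set F := ideal_span [set x].

Definition ideal_mul (I J : set F) : set F :=
  ideal_span [set x * y | x in I & y in J].

Definition ideal_inv (I : set F) : set F :=
  [set x | forall y, I y -> ring_int (x * y)].

Definition ideal_exp (I : set F) (n : nat) : set F :=
  iter n (ideal_mul I) ring_int.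

Definition ideal_val (P I : set F) : nat :=
  xget 0%N [set n | I `<=` ideal_exp P n /\ ~ (I `<=` ideal_exp P n.+1)].

(* The ideal (x, y) is the unit ideal.  When it is applied to field elements
   this forces both of them to be integral. *)
Definition coprime_elts (x y : F) : Prop :=
  ideal_span [set x; y] = ring_int.

(* [I] and [J] are in the same ideal class; [ideal_class I] is the class
   of [I], as a set of fractional ideals. *)
Definition ideal_equiv (I J : set F) : Prop :=
  exists2 x, x != 0 & J = [set x * y | y in I].

Definition ideal_class (I : set F) : set (set F) :=
  [set J | frac_ideal J /\ ideal_equiv I J].

Definition class_group : set (set (set F)) :=
  [set ideal_class I | I in frac_ideal].

Definition totally_real : Prop :=
  forall (s : {rmorphism F -> algC}) (x : F), s x \is Num.real.

Definition totally_imaginary : Prop :=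
  forall s : {rmorphism F -> algC}, exists x : F, s x \isn't Num.real.

Definition totally_positive (x : F) : Prop :=
  forall s : {rmorphism F -> algC}, 0 < s x.

Definition totally_negative (x : F) : Prop :=
  forall s : {rmorphism F -> algC}, s x < 0.

Definition strict_class_number_one : Prop :=
  forall I, frac_ideal I -> exists2 x, totally_positive x & I = principal x.

(* The images of [e] form a basis over Z/p of the residue field of [P], a
   prime above [p]. *)
Definition residue_basis (p : nat) (P : set F) (f : nat) (e : 'I_f -> F) :=
  (forall i, ring_int (e i)) /\
  forall x, ring_int x -> exists! c : {ffun 'I_f -> 'I_p},
    P (x - \sum_(i < f) (val (c i))%:R * e i).

Definition residue_degree (p : nat) (P : set F) (f : nat) : Prop :=
  exists e : 'I_f -> F, residue_basis p P e.

Definition unramified (p : nat) : Prop :=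
  forall P : set F, prime_ideal P -> P p%:R ->
    ideal_val P (principal p%:R) = 1%N.

End Ideals.

Arguments ring_int F : clear implicits.
Arguments class_group F : clear implicits.
Arguments totally_real F : clear implicits.
Arguments totally_imaginary F : clear implicits.
Arguments strict_class_number_one F : clear implicits.
Arguments unramified F p : clear implicits.

Definition CM_field (M : fieldExtType rat) : Prop :=
  totally_imaginary M /\
  exists E : {subfield M},
    totally_real (subvs_of E) /\ \dim {:M} = (2 * \dim E)%N.

(* A CM field all of whose CM types are primitive, i.e. one with no proper CM
   subfield. *)
Definition primitive_CM_field (M : fieldExtType rat) : Prop :=
  CM_field M /\
  forall E : {subfield M}, CM_field (subvs_of E) -> (E : {vspace M}) = fullv.

Section Extension.
Variables (L : fieldExtType rat) (K : fieldExtType L).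

Definition ideal_ext (q : set L) : set K := ideal_span [set x%:A | x in q].

Definition splits (q : set L) : Prop :=
  exists P P' : set K,
    [/\ prime_ideal P, prime_ideal P', P <> P' & ideal_ext q = ideal_mul P P'].

Definition inert (q : set L) : Prop := prime_ideal (ideal_ext q).

(* O_L[t] *)
Definition adjoin_int (t : K) : set K :=
  [set x | exists2 q : {poly L},
     (forall i, ring_int L q`_i) & x = (map_poly (in_alg K) q).[t]].

(* [bar] is the nontrivial automorphism of the quadratic extension K/L, so
   [x + bar x] is the relative trace. *)
Definition codifferent (bar : K -> K) : set K :=
  [set x | forall y, ring_int K y ->
     exists2 l : L, ring_int L l & x * y + bar (x * y) = l%:A].

Definition different (bar : K -> K) : set K := ideal_inv (codifferent bar).

End Extension.

Arguments ideal_ext {L} K q.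

(* The algebra (a, b / F); the definition is used in characteristic 0 only. *)
Definition quaternion_symbol (F : fieldType) (a b : F) (A : falgType F) :=
  [/\ a != 0, b != 0 &
      exists i j : A,
        [/\ i * i = a%:A, j * j = b%:A, j * i = - (i * j)
          & basis_of fullv [:: 1; i; j; i * j]]].

Definition quaternion_algebra (F : fieldType) (A : falgType F) : Prop :=
  exists a b : F, quaternion_symbol a b A.

Definition division_algebra (F : fieldType) (A : falgType F) : Prop :=
  forall x : A, x != 0 -> x \is a GRing.unit.

(* [B], with the map [iota : A -> B], is the E-algebra A (x)_F E: an F-basis of
   [A] is sent to an E-basis of [B]. *)
Definition base_change (F E : fieldType) (f : F -> E)
    (A : falgType F) (B : falgType E) (iota : {rmorphism A -> B}) : Prop :=
  (forall c x, iota (c *: x) = f c *: iota x) /\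
  basis_of fullv (map iota (vbasis {:A})).

Definition padic_abs (l : nat) (q : rat) : rat :=
  if q == 0 then 0
  else l%:R ^+ logn l `|denq q|%N / l%:R ^+ logn l `|numq q|%N.

(* [F], with the absolute value [nu], is the field of l-adic numbers, that is
   the completion of Q for [padic_abs l].  Its value group is that of Q, hence
   [nu] is rational valued. *)
Definition padic_field (l : nat) (F : fieldType)
    (f : {rmorphism rat -> F}) (nu : F -> rat) : Prop :=
  (forall q, nu (f q) = padic_abs l q) /\
  (forall x, (nu x == 0) = (x == 0)) /\
  (forall x y, nu (x * y) = nu x * nu y) /\
  (forall x y, nu (x + y) <= Num.max (nu x) (nu y)) /\
  (forall x (e : rat), 0 < e -> exists q, nu (x - f q) < e) /\
  (forall u : nat -> F,
     (forall e : rat, 0 < e -> exists N, forall m n,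
        (N <= m)%N -> (N <= n)%N -> nu (u m - u n) < e) ->
     exists x, forall e : rat, 0 < e -> exists N, forall n,
        (N <= n)%N -> nu (u n - x) < e).

Definition ramified_at (B : falgType rat) (l : nat) : Prop :=
  forall (F : fieldType) (f : {rmorphism rat -> F}) (nu : F -> rat),
    padic_field l f nu ->
  forall (A : falgType F) (iota : {rmorphism B -> A}),
    base_change f iota -> division_algebra A.

Definition ramified_at_infinity (B : falgType rat) : Prop :=
  forall (F : realType) (A : falgType F) (iota : {rmorphism B -> A}),
    base_change (ratr : rat -> F) iota -> division_algebra A.

(* [B] is the rational quaternion algebra B_{p,oo}. *)
Definition ramified_exactly_p_infinity (B : falgType rat) (p : nat) : Prop :=
  [/\ quaternion_algebra B, ramified_at_infinity B &
      forall l, prime l -> (ramified_at B l <-> l = p)].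

(* The matrix [alpha, beta], with c = alpha_0 p. *)
Definition qmx (K : nzRingType) (bar : K -> K) (c alpha beta : K) : 'M[K]_2 :=
  \matrix_(i < 2, j < 2)
    if i == 0 then (if j == 0 then alpha else beta)
    else (if j == 0 then c * bar beta else bar alpha).

Section Orders.
Variables (L : fieldExtType rat) (K : fieldExtType L) (B : falgType L).

(* [theta] identifies the L-algebra [B] with the algebra of all
   [alpha, beta]. *)
Definition matrix_identification (bar : K -> K) (c : K)
    (theta : {rmorphism B -> 'M[K]_2}) : Prop :=
  [/\ forall (l : L) (x : B), theta (l *: x) = l%:A *: theta x,
      injective theta &
      range theta = [set M | exists alpha beta, M = qmx bar c alpha beta]].

Definition OL_order (R : set B) : Prop :=
  [/\ R 1,
      forall x y, R x -> R y -> R (x * y) &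
      exists s : seq B, <<s>>%VS = fullv /\
        R = [set y | exists2 c : 'I_(size s) -> L,
               forall i, ring_int L (c i)
               & y = \sum_(i < size s) c i *: s`_i]].

Variable theta : {rmorphism B -> 'M[K]_2}.

(* [B] is split by [K] through [theta], so the reduced trace is the trace of
   the matrix. *)
Definition reduced_trace (x : B) : K := \tr (theta x).

Definition discriminant (R : set B) : set L :=
  ideal_span [set l : L | exists2 x : 'I_4 -> B, forall i, R (x i)
    & l%:A = \det (\matrix_(i < 4, j < 4) reduced_trace (x i * x j))].

(* The reduced discriminant is the ideal whose square is the discriminant. *)
Definition has_reduced_discriminant (R : set B) (I : set L) : Prop :=
  integral_ideal I /\ discriminant R = ideal_mul I I.

Definition superspecial (p : nat) (R : set B) : Prop :=
  OL_order R /\ has_reduced_discriminant R (principal p%:R).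

Variables (bar : K -> K) (c : K).

(* [x] is the image of [alpha] under the embedding alpha |-> [alpha, 0] *)
Definition embeds (alpha : K) (x : B) : Prop := theta x = qmx bar c alpha 0.

Definition contains_OK (R : set B) : Prop :=
  forall alpha x, ring_int K alpha -> embeds alpha x -> R x.

Definition superspecial_over_OK (p : nat) : set (set B) :=
  [set R | superspecial p R /\ contains_OK R].

Definition K_conjugate (R R' : set B) : Prop :=
  exists mu x, [/\ mu != 0, embeds mu x & R' = [set x * y * x^-1 | y in R]].

Definition K_automorphic (R R' : set B) : Prop :=
  exists sigma : {lrmorphism B -> B},
    [/\ bijective sigma,
        forall alpha x, embeds alpha x -> sigma x = x
      & R' = [set sigma y | y in R]].

Definition order_class (p : nat) (R : set B) : set (set B) :=
  [set R' | superspecial_over_OK p R' /\ K_conjugate R R'].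

Definition order_classes (p : nat) : set (set (set B)) :=
  [set order_class p R | R in superspecial_over_OK p].

End Orders.

Section DormanOrders.
Variables (L : fieldExtType rat) (K : fieldExtType L) (bar : K -> K).
Variable calA : set K.

(* A^-1 a^-1 \bar a *)
Definition twist (a : set K) : set K :=
  ideal_mul (ideal_inv calA) (ideal_mul (ideal_inv a) [set bar x | x in a]).

(* [lambda] is a possible value of lambda_a; [lamq q] is lambda_q, and [tq q]
   is the prime of [K] above the ramified prime [q]. *)
Definition admissible (d : L) (lamq : set L -> L) (tq : set L -> set K)
    (a : set K) (lambda : L) : Prop :=
  [/\ coprime_elts lambda d,
      forall q, prime_ideal q -> q d ->
        q (lambda - (-1) ^+ ideal_val (tq q) a * lamq q) &
      forall y, twist a y -> ring_int K (lambda%:A * y)].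

Variables (B : falgType L) (theta : {rmorphism B -> 'M[K]_2}) (c : K).

(* R(a, lambda), with D = (sqrt d). *)
Definition dorman_order (sqrtd : K) (a : set K) (lambda : L) : set B :=
  let Dinv := ideal_inv (principal sqrtd) in
  [set x | exists alpha beta,
     [/\ theta x = qmx bar c alpha beta, Dinv alpha,
         ideal_mul Dinv (twist a) beta
       & ring_int K (alpha - lambda%:A * beta)]].

End DormanOrders.

(* Main.v *)
Require Import Defs.
From HB Require Import structures.
From mathcomp Require Import all_boot all_order all_algebra all_field.
From mathcomp Require Import ring.
From mathcomp Require Import boolp classical_sets functions reals.
Import Order.TTheory GRing.Theory Num.Theory.
Local Open Scope classical_set_scope.
Local Open Scope ring_scope.

(** An order [R] containing [O_K] has [R :&: K = O_K], so it is determined by the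
    lattice [s^-1 M] of its second components ([s = sqrt d]) and by an
    [O_K]-linear gluing map [s^-1 M -> s^-1 O_K / O_K], necessarily
    multiplication by some [lam] in [O_L].  The reduced discriminant of [R] is
    [p O_L] iff [M] has relative norm [alpha0^-1], and [R] is then closed under
    product iff [lam ^ 2 = alpha0 p] mod [d].  Hilbert 90 for ideals (for N of
    norm 1, the ideal a = O_K + bar N satisfies bar a = N a) gives
    M = A^-1 a^-1 \bar a, and multiplying a by ramified primes
    adjusts the signs in [lam = +- lambda_q] mod q.  Conjugation by [mu]
    multiplies [M] by [mu / bar mu], which at a ramified prime is congruent to
    -1 to the power of the valuation of [mu].  Hence if the orders of a and a'
    are conjugate by [mu], the ideal mu a' a^-1 is equal to its conjugate and has
    even valuation at the ramified primes; it comes from [L], whose class number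
    is one, so a and a' are equivalent.

    Since [O_L] is principal, ideal theory in [O_K] reduces to the identity
    I (bar I) = (n) with [n] in [L]; the parity of the valuation of I at a ramified
    prime over [pi] is that of the [pi]-adic valuation of [n]. *)

(** The delicate point is to work modulo [s] with elements of [L] only. Since [2] is prime to [d],
    every integer of [K] is congruent modulo [s] to an integer of [L]; this is why a gluing map can
    be multiplication by some [lam] in [O_L]. A lattice [M] of norm [alpha0^-1] contains an element
    [lam0 / alpha0] of [L] that generates it modulo [d M], so a gluing map is determined by one
    value, and two gluing maps are compared on that element alone. The same [lam0] controls the
    primes above [alpha0]: it generates the [l] in [L] with [l M] integral, and [lam0 ^ 2] is
    divisible by [alpha0]. Hence [lam ^ 2 = alpha0 p] modulo [d] already gives the congruence modulo
    [d alpha0] that closure under product requires. Hilbert 90 leaves the ideal free up to ideals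
    equal to their conjugates; the ideals [(y, s)] with [y] dividing [d] are of this kind and
    provide every pattern of signs. The signs are visible because [2 lambda_q] is a unit modulo
    q. *)

Set Implicit Arguments.
Unset Strict Implicit.

(** * Ideals of a number field *)

Section Submodules.
Variable F : fieldType.
Implicit Types (I J M : set F) (x y z : F).
Local Notation O := (ring_int F).

Lemma ringint0 : O 0. Proof. exact: integral0. Qed.
Lemma ringint1 : O 1. Proof. exact: integral1. Qed.
Lemma ringintD x y : O x -> O y -> O (x + y).
Proof. exact: integral_add. Qed.
Lemma ringintB x y : O x -> O y -> O (x - y).
Proof. exact: integral_sub. Qed.
Lemma ringintN x : O x -> O (- x).
Proof. exact: integral_opp. Qed.
Lemma ringintM x y : O x -> O y -> O (x * y).
Proof. exact: integral_mul. Qed.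
Lemma ringint_nat n : O n%:R. Proof. exact: integral_nat. Qed.
Lemma ringintX x n : O x -> O (x ^+ n).
Proof.
by move=> Ox; elim: n => [|n IH]; rewrite ?expr0 ?exprS;
  [exact: ringint1 | exact: ringintM].
Qed.
Lemma ringint_sum (n : nat) (f : 'I_n -> F) :
  (forall i, O (f i)) -> O (\sum_i f i).
Proof.
by move=> Of; apply: (big_ind O) => //; [exact: ringint0 | exact: ringintD].
Qed.
Lemma ringint_prod (n : nat) (f : 'I_n -> F) :
  (forall i, O (f i)) -> O (\prod_i f i).
Proof.
by move=> Of; apply: (big_ind O) => //; [exact: ringint1 | exact: ringintM].
Qed.

Lemma ringint_det n (A : 'M[F]_n) : (forall i j, O (A i j)) -> O (\det A).
Proof.
move=> OA; rewrite /determinant.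
apply: (big_ind O) => [||s _]; [exact: ringint0 | exact: ringintD |].
apply: ringintM; last exact: ringint_prod.
by apply: ringintX; apply/ringintN/ringint1.
Qed.

Lemma ringint_root2 u v x : O u -> O v -> x ^+ 2 + u * x + v = 0 -> O x.
Proof.
move=> Ou Ov x0.
have sz : (size (u *: 'X + v%:P)%R < size ('X^2 : {poly F})%R)%N.
  rewrite size_polyXn ltnS (leq_trans (size_polyD _ _)) // geq_max.
  by rewrite (leq_trans (size_scale_leq _ _)) ?size_polyX // size_polyC; case: eqP.
apply: (@integral_root_monic _ _ _ _ ('X^2 + (u *: 'X + v%:P))).
- by rewrite monicE lead_coefDl // lead_coefXn.
- by rewrite rootE !hornerE /= x0.
- apply/integral_poly => i; rewrite !coefE.
  apply: ringintD; first exact: ringint_nat.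
  apply: ringintD; last by case: ifP => // _; exact: ringint0.
  by apply: ringintM => //; exact: ringint_nat.
Qed.

Lemma ringint_sqr x : O (x ^+ 2) -> O x.
Proof.
move=> Ox; apply: (@ringint_root2 0 (- x ^+ 2)); last by ring.
  exact: ringint0.
exact: ringintN.
Qed.

(** The closure conditions of [frac_ideal] alone. Preimages and spans satisfy them without being
    nonzero or having a common denominator, so inclusions of ideal products can be tested against
    any such set. *)
Definition submodule I :=
  [/\ I 0, forall x y, I x -> I y -> I (x + y)
    & forall c x, O c -> I x -> I (c * x)].

Lemma frac_submod I : frac_ideal I -> submodule I.
Proof. by case. Qed.

Lemma submodN I x : submodule I -> I x -> I (- x).
Proof. by case=> _ _ h Ix; rewrite -mulN1r; apply: h => //; apply/ringintN/ringint1. Qed.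

Lemma submodB I x y : submodule I -> I x -> I y -> I (x - y).
Proof. by move=> sI Ix Iy; case: (sI) => _ h _; apply: h => //; apply: submodN. Qed.

Lemma submod_ringint : submodule O.
Proof. by split; [exact: ringint0 | exact: ringintD | exact: ringintM]. Qed.

Lemma submod_preim I z : submodule I -> submodule [set x | I (z * x)].
Proof.
case=> I0 ID IM; split=> /=; first by rewrite mulr0.
- by move=> x y hx hy; rewrite mulrDr; apply: ID.
- by move=> c x Oc hx; rewrite mulrCA; apply: IM.
Qed.

Lemma submod_eq1 I : submodule I -> I `<=` O -> I 1 -> I = O.
Proof.
move=> [_ _ IM] sI I1; apply/seteqP; split => // x Ox.
by rewrite -[x]mulr1; apply: IM.
Qed.

Lemma span_submod (S : set F) : submodule (ideal_span S).
Proof.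
split.
- exists 0%N, (fun=> 0), (fun=> 0); split; [by case | by case | by rewrite big_ord0].
- move=> x y [n [c [v [Oc Sv ->]]]] [m [c' [v' [Oc' Sv' ->]]]].
  exists (n + m)%N, (fun i => match fintype.split i with inl i => c i | inr i => c' i end),
    (fun i => match fintype.split i with inl i => v i | inr i => v' i end); split.
  + by move=> i; case: (fintype.split i).
  + by move=> i; case: (fintype.split i).
  + rewrite big_split_ord /=; congr (_ + _); apply: eq_bigr => i _.
      by rewrite (unsplitK (inl i)).
    by rewrite (unsplitK (inr i)).
- move=> c0 x Oc0 [n [c [v [Oc Sv ->]]]].
  exists n, (fun i => c0 * c i), v; split=> // [i|]; first exact: ringintM.
  by rewrite mulr_sumr; apply: eq_bigr => i _; rewrite mulrA.
Qed.

Lemma span_in (S : set F) x : S x -> ideal_span S x.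
Proof.
move=> Sx; exists 1%N, (fun=> 1), (fun=> x); split=> // [_|]; first exact: ringint1.
by rewrite big_ord1 mul1r.
Qed.

Lemma span_min (S I : set F) : submodule I -> S `<=` I -> ideal_span S `<=` I.
Proof.
move=> [I0 ID IM] SI _ [n [c [v [Oc Sv ->]]]].
by apply: (big_ind I) => // i _; apply: IM => //; apply: SI.
Qed.

Lemma principalE x y : principal x y <-> exists2 c, O c & y = c * x.
Proof.
split; last first.
  by case=> c Oc ->; have [_ _ h] := span_submod [set x]; apply: h => //; apply: span_in.
apply: (@span_min _ [set y | exists2 c, O c & y = c * x]); last first.
  by move=> _ ->; exists 1; [exact: ringint1 | rewrite mul1r].
split; first by exists 0; [exact: ringint0 | rewrite mul0r].
- by move=> _ _ [c Oc ->] [c' Oc' ->]; exists (c + c'); [exact: ringintD | ring].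
- by move=> k _ Ok [c Oc ->]; exists (k * c); [exact: ringintM | ring].
Qed.

Lemma principal_div x y : x != 0 -> principal x y <-> O (y / x).
Proof.
move=> x0; rewrite principalE; split=> [[c Oc ->]|h]; first by rewrite mulfK.
by exists (y / x); rewrite // divfK.
Qed.

Lemma principal_mem x : principal x x.
Proof. exact: span_in. Qed.

Lemma principal1 : principal (1 : F) = O.
Proof.
by apply/seteqP; split=> y; rewrite (principal_div _ (oner_neq0 _)) divr1.
Qed.

Lemma principal_submod x : submodule (principal x).
Proof. exact: span_submod. Qed.

Lemma span2P x y z :
  ideal_span [set x; y] z <-> exists c c', [/\ O c, O c' & z = c * x + c' * y].
Proof.
split; last first.
  case=> c [c' [Oc Oc' ->]]; have [_ hD hM] := span_submod [set x; y].
  by apply: hD; apply: hM => //; apply: span_in; [left | right].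
apply: (@span_min _ [set z | exists c c', [/\ O c, O c' & z = c * x + c' * y]]).
  split.
  - by exists 0, 0; split; try exact: ringint0; ring.
  - move=> _ _ [c [c' [Oc Oc' ->]]] [e [e' [Oe Oe' ->]]].
    by exists (c + e), (c' + e'); split; try exact: ringintD; ring.
  - move=> k _ Ok [c [c' [Oc Oc' ->]]].
    by exists (k * c), (k * c'); split; try exact: ringintM; ring.
by move=> _ [] ->; [exists 1, 0 | exists 0, 1]; split;
  try exact: ringint0; try exact: ringint1; ring.
Qed.

Lemma coprime_eltsP x y :
  coprime_elts x y <->
  [/\ O x, O y & exists u v, [/\ O u, O v & u * x + v * y = 1]].
Proof.
rewrite /coprime_elts; split=> [h|[Ox Oy [u [v [Ou Ov e]]]]].
  split; first by rewrite -h; apply: span_in; left.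
    by rewrite -h; apply: span_in; right.
  have : ideal_span [set x; y] 1 by rewrite h; exact: ringint1.
  by move=> /span2P[u [v [Ou Ov e]]]; exists u, v.
apply: submod_eq1; first exact: span_submod.
  by apply: span_min => [|_ [] ->]; [exact: submod_ringint | exact: Ox | exact: Oy].
by apply/span2P; exists u, v.
Qed.

Lemma coprime_elts_sym x y : coprime_elts x y -> coprime_elts y x.
Proof.
case/coprime_eltsP=> Ox Oy [u [v [Ou Ov e]]]; apply/coprime_eltsP; split=> //.
by exists v, u; rewrite addrC.
Qed.

(** Multiplying [v y = 1 - u x] by [1 + u x] produces the square. *)
Lemma coprime_elts_sqr x y : coprime_elts x y ->
  exists u v, [/\ O u, O v & u * x ^+ 2 + v * y = 1].
Proof.
case/coprime_eltsP=> Ox Oy [u [v [Ou Ov e]]]; exists (u ^+ 2), (v * (1 + u * x)).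
have O1 := ringint1; split; first exact: ringintX.
  by apply: ringintM => //; apply: ringintD => //; exact: ringintM.
transitivity (u * x * (u * x) + v * y * (1 + u * x)); first by ring.
by have -> : v * y = 1 - u * x; [rewrite -e; ring | ring].
Qed.

Lemma ideal_mul_submod I J : submodule (ideal_mul I J).
Proof. exact: span_submod. Qed.

Lemma ideal_mul_in I J x y : I x -> J y -> ideal_mul I J (x * y).
Proof. by move=> Ix Jy; apply: span_in; exists x => //; exists y. Qed.

Lemma ideal_mul_min I J M :
  submodule M -> (forall x y, I x -> J y -> M (x * y)) -> ideal_mul I J `<=` M.
Proof. by move=> sM h; apply: span_min => // _ [x Ix [y Jy <-]]; apply: h. Qed.

Lemma ideal_mulS I I' J J' : I `<=` I' -> J `<=` J' ->
  ideal_mul I J `<=` ideal_mul I' J'.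
Proof.
move=> sI sJ; apply: ideal_mul_min => [|x y Ix Jy]; first exact: ideal_mul_submod.
by apply: ideal_mul_in; [apply: sI | apply: sJ].
Qed.

Lemma ideal_mulC I J : ideal_mul I J = ideal_mul J I.
Proof.
apply/seteqP; split; apply: ideal_mul_min; try exact: ideal_mul_submod;
  by move=> x y Ix Jy; rewrite mulrC; apply: ideal_mul_in.
Qed.

Lemma ideal_mulA I J M :
  ideal_mul I (ideal_mul J M) = ideal_mul (ideal_mul I J) M.
Proof.
apply/seteqP; split; apply: ideal_mul_min; try exact: ideal_mul_submod.
- move=> x y Ix; move: y; apply: ideal_mul_min.
    exact/submod_preim/ideal_mul_submod.
  by move=> y z Jy Mz /=; rewrite mulrA; apply: ideal_mul_in => //; apply: ideal_mul_in.
- move=> x z hx Mz; rewrite mulrC; move: x hx; apply: ideal_mul_min.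
    exact/submod_preim/ideal_mul_submod.
  move=> x y Jy Ix /=; rewrite mulrC -mulrA; apply: ideal_mul_in => //.
  exact: ideal_mul_in.
Qed.

Lemma ideal_mulCA I J M : ideal_mul I (ideal_mul J M) = ideal_mul J (ideal_mul I M).
Proof. by rewrite ideal_mulA (ideal_mulC I) -ideal_mulA. Qed.

Lemma ideal_mulACA I J M N :
  ideal_mul (ideal_mul I J) (ideal_mul M N) = ideal_mul (ideal_mul I M) (ideal_mul J N).
Proof. by rewrite -!ideal_mulA (ideal_mulCA J). Qed.

Lemma ideal_mul1 I : submodule I -> ideal_mul O I = I.
Proof.
move=> sI; apply/seteqP; split; first by apply: ideal_mul_min => //; case: sI.
by move=> x Ix; rewrite -[x]mul1r; apply: ideal_mul_in => //; exact: ringint1.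
Qed.

Lemma ideal_mulr1 I : submodule I -> ideal_mul I O = I.
Proof. by move=> sI; rewrite ideal_mulC ideal_mul1. Qed.

Lemma scale_ideal x I : submodule I -> [set x * y | y in I] = ideal_mul (principal x) I.
Proof.
move=> sI; apply/seteqP; split.
  by move=> _ [y Iy <-]; apply: ideal_mul_in => //; exact: principal_mem.
apply: ideal_mul_min.
  case: sI => I0 ID IM; split.
  - by exists 0; rewrite ?mulr0.
  - by move=> _ _ [y Iy <-] [z Iz <-]; exists (y + z); [exact: ID | rewrite mulrDr].
  - by move=> c _ Oc [y Iy <-]; exists (c * y); [exact: IM | rewrite mulrCA].
move=> _ y /principalE[c Oc ->] Iy; exists (c * y); last by ring.
by case: sI => _ _; apply.
Qed.

Lemma principal_mulE x I y : x != 0 -> submodule I ->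
  ideal_mul (principal x) I y <-> I (y / x).
Proof.
move=> x0 sI; rewrite -scale_ideal //; split=> [[z Iz <-]|Iy].
  by rewrite mulrC mulKf.
by exists (y / x) => //; rewrite mulrC divfK.
Qed.

Lemma principalM x y : ideal_mul (principal x) (principal y) = principal (x * y).
Proof.
rewrite -scale_ideal; last exact: principal_submod.
apply/seteqP; split=> [_ [_ /principalE[c Oc ->] <-]|_ /principalE[c Oc ->]].
  by apply/principalE; exists c => //; ring.
by exists (c * y); [apply/principalE; exists c | ring].
Qed.

Lemma principal_sub x y : principal x y -> principal y `<=` principal x.
Proof.
move=> hxy; apply: span_min => [|_ -> //]; exact: principal_submod.
Qed.

Lemma principal_eq x y : x != 0 -> y != 0 ->
  principal x = principal y <-> O (x / y) /\ O (y / x).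
Proof.
move=> x0 y0; split=> [e|[h1 h2]].
  split; apply/principal_div => //; [rewrite -e | rewrite e]; exact: principal_mem.
by apply/seteqP; split; apply: principal_sub; apply/principal_div.
Qed.

Lemma ideal_inv_submod I : submodule (ideal_inv I).
Proof.
split=> [y _|x y hx hy z Iz|c x Oc hx z Iz]; first by rewrite mul0r; exact: ringint0.
- by rewrite mulrDl; apply: ringintD; [apply: hx | apply: hy].
- by rewrite -mulrA; apply: ringintM => //; apply: hx.
Qed.

(** If [z] sends [I] into the integers, write [1] as a sum of products [x y] with [x] in [I] and [y]
    in [J]; then [z] is a sum of terms [(z x) y], which lie in [J]. *)
Lemma ideal_inv_eq I J : submodule I -> submodule J -> ideal_mul I J = O ->
  ideal_inv I = J.
Proof.
move=> sI sJ e; apply/seteqP; split; last first.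
  by move=> x Jx y Iy; rewrite -e mulrC; apply: ideal_mul_in.
move=> z hz; have : ideal_mul I J 1 by rewrite e; exact: ringint1.
rewrite -[X in J X]mulr1; move: 1; apply: ideal_mul_min; first exact: submod_preim.
by move=> x y Ix Jy /=; rewrite mulrA; case: sJ => _ _; apply=> //; apply: hz.
Qed.

Lemma inv_principal x : x != 0 -> ideal_inv (principal x) = principal x^-1.
Proof.
move=> x0; apply: ideal_inv_eq; try exact: principal_submod.
by rewrite principalM mulfV // principal1.
Qed.

Lemma frac_mul I J : frac_ideal I -> frac_ideal J -> frac_ideal (ideal_mul I J).
Proof.
move=> [_ _ _ [x Ix x0] [c c0 cI]] [_ _ _ [y Jy y0] [c' c'0 cJ]].
have [h1 h2 h3] := ideal_mul_submod I J; split=> //.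
  by exists (x * y); [exact: ideal_mul_in | rewrite mulf_neq0].
exists (c * c'); first by rewrite mulf_neq0.
apply: ideal_mul_min; first exact: submod_preim submod_ringint.
by move=> u v Iu Jv /=; rewrite mulrACA; apply: ringintM; [apply: cI | apply: cJ].
Qed.

Lemma ideal_exp_submod I n : submodule (ideal_exp I n).
Proof. by case: n => [|n]; [exact: submod_ringint | exact: ideal_mul_submod]. Qed.

Definition has_denominators := forall x, exists2 m, m != 0 & O m /\ O (m * x).

Lemma frac_principal x : has_denominators -> x != 0 -> frac_ideal (principal x).
Proof.
move=> hden x0; have [h1 h2 h3] := principal_submod x; split=> //.
  by exists x => //; exact: principal_mem.
have [m m0 [Om Omx]] := hden x; exists m => //.
apply: span_min; first exact: submod_preim submod_ringint.
by move=> _ ->.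
Qed.

End Submodules.

(** * Principal ideal domains *)

Section PrincipalIdealDomain.
Variable F : fieldType.
Local Notation O := (ring_int F).
Hypothesis den : has_denominators F.
Hypothesis pid : forall I : set F, frac_ideal I -> exists2 x, x != 0 & I = principal x.
Implicit Types (q : set F) (x y z pi u v : F).

Lemma gcd_exists x y : x != 0 ->
  exists g, [/\ g != 0, O (x / g), O (y / g) &
    exists u v, [/\ O u, O v & g = u * x + v * y]].
Proof.
move=> x0; have fI : frac_ideal (ideal_span [set x; y]).
  have [h1 h2 h3] := span_submod [set x; y]; split=> //.
    by exists x => //; apply: span_in; left.
  have [m m0 [Om Omx]] := den x; have [n n0 [On Ony]] := den y.
  exists (m * n); first by rewrite mulf_neq0.
  apply: span_min; first exact: submod_preim (submod_ringint _).
  move=> _ [] -> /=; first by rewrite mulrAC; apply: ringintM.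
  by rewrite -mulrA; apply: ringintM.
have [g g0 eI] := pid fI; exists g; split=> //.
- by apply/(principal_div _ g0); rewrite -eI; apply: span_in; left.
- by apply/(principal_div _ g0); rewrite -eI; apply: span_in; right.
- by apply/span2P; rewrite eI; exact: principal_mem.
Qed.

(* The ascending chain condition, obtained from a generator of the union of
   the chain of principal ideals. *)
Lemma divisor_ind (Q : F -> Prop) :
  (forall x, O x -> x != 0 ->
     (forall y, O y -> y != 0 -> O (x / y) -> ~ O (y / x) -> Q y) -> Q x) ->
  forall x, O x -> x != 0 -> Q x.
Proof.
move=> IH x0 Ox0 nz0; apply: contrapT => nQ.
pose bad x := [/\ O x, x != 0 & ~ Q x].
have /choice[f Hf] : forall x, exists y, bad x ->
    [/\ bad y, O (x / y) & ~ O (y / x)].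
  move=> x; have [[Ox nz nQx]|nb] := pselect (bad x); last by exists x.
  apply: contrapT => /forallNP h; apply: nQx; apply: IH => // y Oy y0 Oxy nO.
  by apply: contrapT => nQy; apply: (h y).
pose u n := iter n f x0.
have ub n : bad (u n) by elim: n => // n /Hf[].
have us n : O (u n / u n.+1) by have [] := Hf _ (ub n).
have u0 n : u n != 0 by have [] := ub n.
have mono m n : (m <= n)%N -> principal (u m) `<=` principal (u n).
  elim: n => [|n IHn]; first by rewrite leqn0 => /eqP->.
  rewrite leq_eqVlt => /orP[/eqP-> //|/IHn h] z /h.
  by apply: principal_sub; apply/principal_div.
pose I := [set z | exists n, principal (u n) z].
have fI : frac_ideal I.
  split.
  - by exists 0%N; case: (principal_submod (u 0%N)).
  - move=> x y [m hx] [n hy]; exists (maxn m n).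
    have [_ hD _] := principal_submod (u (maxn m n)).
    by apply: hD; [apply: mono hx; apply: leq_maxl | apply: mono hy; apply: leq_maxr].
  - by move=> c x Oc [n hx]; exists n; have [_ _] := principal_submod (u n); apply.
  - by exists (u 0%N) => //; exists 0%N; apply: principal_mem.
  - exists 1; first exact: oner_neq0.
    move=> x [n /principalE[c Oc ->]]; rewrite mul1r; apply: ringintM => //.
    by case: (ub n).
have [g g0 eI] := pid fI.
have [n /(principal_div _ (u0 n)) hg] : I g by rewrite eI; apply: principal_mem.
have [_ _] := Hf _ (ub n); apply; rewrite -[f _]/(u n.+1).
have /(principal_div _ g0) h : principal g (u n.+1) by rewrite -eI; exists n.+1; apply: principal_mem.
by have := ringintM h hg; rewrite mulrA divfK.
Qed.

Lemma prime_submod q : prime_ideal q -> submodule q.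
Proof. by case=> [[/frac_submod]]. Qed.

Lemma prime_sub q x : prime_ideal q -> q x -> O x.
Proof. by case=> [[_ h]] _ _; apply: h. Qed.

Lemma prime_not1 q : prime_ideal q -> ~ q 1.
Proof.
move=> hq q1; case: (hq) => _ h _; apply: h; apply: submod_eq1 => //.
  exact: prime_submod.
by move=> x; exact: prime_sub.
Qed.

Lemma prime_mul q x y : prime_ideal q -> O x -> O y -> q (x * y) -> q x \/ q y.
Proof. by case=> _ _ h Ox Oy /(h _ _ Ox Oy). Qed.

Lemma prime_sqr q x : prime_ideal q -> O x -> q (x ^+ 2) -> q x.
Proof. by move=> hq Ox; rewrite expr2 => /(prime_mul hq Ox Ox)[]. Qed.

Lemma primeM q x y : prime_ideal q -> O x -> q y -> q (x * y).
Proof. by move=> /prime_submod[_ _ h]; apply: h. Qed.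

Lemma prime_notunit q x : prime_ideal q -> x != 0 -> q x -> ~ O x^-1.
Proof. by move=> hq x0 qx Oxi; apply: (prime_not1 hq); rewrite -(mulVf x0); apply: primeM. Qed.

Lemma prime_gen q : prime_ideal q -> exists2 pi, pi != 0 & q = principal pi.
Proof. by case=> [[/pid]]. Qed.

Lemma prime_elt_neq0 pi : prime_ideal (principal pi) -> pi != 0.
Proof.
case=> [[[_ _ _ [x /principalE[c _ ->]]]]] h _ _ _ _.
by move: h; rewrite mulf_eq0 negb_or => /andP[].
Qed.

(** Let [g] be a gcd of [x] and the generator [pi]. From [pi = g (pi / g)], either [g] is in [q],
    and then so is its multiple [x], or [pi / g] is in [q], and [g] is a unit. *)
Lemma prime_comax q x : prime_ideal q -> O x -> ~ q x ->
  exists u v, [/\ O u, q v & u * x + v = 1].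
Proof.
move=> hq Ox nqx; have [pi pi0 eq] := prime_gen hq.
have [g [g0 h1 h2 [u [v [Ou Ov eg]]]]] := gcd_exists x pi0.
have Opi : O pi by apply: (prime_sub hq); rewrite eq; exact: principal_mem.
have Og : O g by rewrite eg; apply: ringintD; apply: ringintM.
have : q (g * (pi / g)) by rewrite mulrC divfK // eq; exact: principal_mem.
case/(prime_mul hq Og h1) => [qg|].
  by case: nqx; rewrite -[x](divfK g0); apply: primeM.
rewrite eq => /principal_div; rewrite pi0 mulrAC mulfV // mul1r => /(_ isT) Ogi.
exists (g^-1 * v), (g^-1 * u * pi); split; first exact: ringintM.
  by apply/principalE; exists (g^-1 * u) => //; apply: ringintM.
by rewrite -mulrA -mulrA -mulrDr addrC -eg mulVf.
Qed.

Lemma prime_eq q q' : prime_ideal q -> prime_ideal q' -> q `<=` q' -> q = q'.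
Proof.
move=> hq hq' s; apply/seteqP; split=> // x hx; apply: contrapT => nqx.
have [u [v [Ou qv e]]] := prime_comax hq (prime_sub hq' hx) nqx.
apply: (prime_not1 hq'); rewrite -e.
by case: (prime_submod hq') => _ hD hM; apply: hD; [apply: hM | apply: s].
Qed.

(** Once [x] has no proper divisor except units, its gcd with any integer is a unit or an associate
    of [x], and the Bezout relation makes [principal x] prime. *)
Lemma prime_divisor x : O x -> x != 0 -> ~ O x^-1 ->
  exists2 q, prime_ideal q & q x.
Proof.
move: x; apply: (@divisor_ind (fun x => ~ O x^-1 -> exists2 q, prime_ideal q & q x)).
move=> x Ox x0 IH nx.
have [[y [Oy y0 [hxy nyx ny]]]|h] := pselect (exists y, [/\ O y, y != 0 &
    [/\ O (x / y), ~ O (y / x) & ~ O y^-1]]).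
  have [q hq qy] := IH y Oy y0 hxy nyx ny.
  by exists q => //; rewrite -[x](divfK y0); apply: primeM.
exists (principal x); last exact: principal_mem.
split.
- split; first exact: frac_principal.
  by apply: span_min => [|_ ->//]; exact: submod_ringint.
- by move=> e; apply: nx; rewrite -div1r; apply/(principal_div _ x0); rewrite e; exact: ringint1.
- move=> c c' Oc Oc' /(principal_div _ x0) hcc.
  have [g [g0 h1 h2 [u [v [Ou Ov eg]]]]] := gcd_exists c x0.
  have Og : O g by rewrite eg; apply: ringintD; apply: ringintM.
  have [Ogi|ngi] := pselect (O g^-1).
    right; apply/(principal_div _ x0).
    have -> : c' / x = g^-1 * (u * c' + v * (c * c' / x)).
      by apply: (mulfI g0); rewrite mulVKf // {1}eg; field.
    by apply: ringintM => //; apply: ringintD; apply: ringintM.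
  left; apply/(principal_div _ x0).
  have Ogx : O (g / x) by apply: contrapT => ngx; apply: h; exists g.
  by have := ringintM h2 Ogx; rewrite mulrA divfK.
Qed.

Lemma factor_ind (Q : F -> Prop) :
  (forall x, O x -> x != 0 -> O x^-1 -> Q x) ->
  (forall pi x, prime_ideal (principal pi) -> O x -> x != 0 -> Q x -> Q (pi * x)) ->
  forall x, O x -> x != 0 -> Q x.
Proof.
move=> Qu Qp; apply: divisor_ind => x Ox x0 IH.
have [Oxi|nxi] := pselect (O x^-1); first exact: Qu.
have [q hq qx] := prime_divisor Ox x0 nxi; have [pi pi0 eq] := prime_gen hq.
have Oxp : O (x / pi) by apply/(principal_div _ pi0); rewrite -eq.
have xp0 : x / pi != 0 by rewrite mulf_neq0 ?invr_eq0.
rewrite -[x](divfK pi0) mulrC; apply: Qp => //; first by rewrite -eq.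
apply: IH => //; first by rewrite invf_div mulrCA mulfV // mulr1; apply: prime_sub hq _;
  rewrite eq; exact: principal_mem.
rewrite mulrAC mulfV // mul1r => Opi; apply: (prime_not1 hq).
by rewrite eq; apply/(principal_div _ pi0); rewrite div1r.
Qed.

Lemma chinese_remainder (r : set F -> F) x : O x -> x != 0 ->
  (forall q, prime_ideal q -> q x -> O (r q)) ->
  exists2 mu, O mu & forall q, prime_ideal q -> q x -> q (mu - r q).
Proof.
move: x; apply: (@factor_ind (fun x => (forall q, prime_ideal q -> q x -> O (r q)) ->
  exists2 mu, O mu & forall q, prime_ideal q -> q x -> q (mu - r q))).
  move=> x Ox x0 Oxi _; exists 0; first exact: ringint0.
  by move=> q hq qx; case: (prime_notunit hq x0 qx).
move=> pi x hpi Ox x0 IH Or.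
have Opi : O pi by apply: (prime_sub hpi); exact: principal_mem.
have [mu Omu Hmu] : exists2 mu, O mu & forall q, prime_ideal q -> q x -> q (mu - r q).
  by apply: IH => q hq qx; apply: Or => //; apply: primeM.
have e q : prime_ideal q -> q pi -> q = principal pi.
  move=> hq qp; apply/esym/prime_eq => //.
  by apply: span_min => [|_ ->//]; exact: prime_submod.
have [pix|npix] := pselect (principal pi x).
  exists mu => // q hq; case/(prime_mul hq Opi Ox); last exact: Hmu.
  by move/(e _ hq) => eq; apply: Hmu => //; rewrite eq.
have [u [v [Ou qv e1]]] := prime_comax hpi Ox npix.
have Ov := prime_sub hpi qv.
have Orp : O (r (principal pi)).
  by apply: Or => //; rewrite mulrC; apply: primeM => //; exact: principal_mem.
(* Since [u x + v = 1] with [v] divisible by [pi], this is [mu] modulo the other primes dividing [x]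
   and [r (principal pi)] modulo [pi]. *)
exists (mu * v + r (principal pi) * (u * x)).
  by apply: ringintD; apply: ringintM => //; apply: ringintM.
move=> q hq; have [_ hD _] := prime_submod hq.
case/(prime_mul hq Opi Ox) => [/(e _ hq)->|qx].
  have -> : mu * v + r (principal pi) * (u * x) - r (principal pi)
    = (mu - r (principal pi)) * v.
    by rewrite -[X in _ - X]mulr1 -e1; ring.
  by apply: primeM => //; apply: ringintB.
have -> : mu * v + r (principal pi) * (u * x) - r q
    = (mu - r q) + u * (r (principal pi) - mu) * x.
  by have -> : v = 1 - u * x; [rewrite -e1; ring | ring].
apply: hD; first exact: Hmu.
by apply: primeM => //; apply: ringintM => //; apply: ringintB.
Qed.

(** [Bad] will mark the ramified primes at which a sign has to be changed. *)
Lemma divisor_with_primes (Bad : set F -> Prop) x : O x -> x != 0 ->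
  exists y, [/\ O y, y != 0, O (x / y) &
    forall q, prime_ideal q -> q x -> (q y <-> Bad q)].
Proof.
move: x; apply: (@factor_ind (fun x => exists y, [/\ O y, y != 0, O (x / y) &
    forall q, prime_ideal q -> q x -> (q y <-> Bad q)])).
  move=> x Ox x0 Oxi; exists 1; split; rewrite ?divr1 ?oner_neq0 //; first exact: ringint1.
  by move=> q hq qx; case: (prime_notunit hq x0 qx).
move=> pi x hpi Ox x0 [y [Oy y0 Oxy Hy]].
have Opi : O pi by apply: (prime_sub hpi); exact: principal_mem.
have pi0 := prime_elt_neq0 hpi.
have e q : prime_ideal q -> q pi -> q = principal pi.
  move=> hq qp; apply/esym/prime_eq => //.
  by apply: span_min => [|_ ->//]; exact: prime_submod.
(* The prime [pi] enters [y] only if it is bad and has not been met already in [x]. *)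
have [h|h] := pselect (~ principal pi x /\ Bad (principal pi)); last first.
  exists y; split=> //; first by rewrite -mulrA; apply: ringintM.
  move=> q hq; case/(prime_mul hq Opi Ox) => [qp|]; last exact: Hy.
  have [qx|nqx] := pselect (q x); first exact: Hy.
  split=> [qy|Bq]; first by case: nqx; rewrite -[x](divfK y0); apply: primeM.
  by case: h; rewrite -(e q).
exists (pi * y); split; [exact: ringintM | exact: mulf_neq0 | |].
  by rewrite invfM mulrACA mulfV // mul1r.
case: h => nx Bp q hq /(prime_mul hq Opi Ox) hpx; have [qp|nqp] := pselect (q pi).
  rewrite (e q) //; split=> // _; rewrite mulrC; apply: primeM => //.
  exact: principal_mem.
have qx : q x by case: hpx.
by rewrite -(Hy q) //; split; [case/(prime_mul hq Opi Oy) | exact: primeM].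
Qed.

Lemma coprime_unitP x y : O x -> x != 0 -> O y ->
  (forall q, prime_ideal q -> q x -> ~ q y) -> coprime_elts x y.
Proof.
move=> Ox x0 Oy h; apply/coprime_eltsP; split=> //.
have [g [g0 h1 h2 [u [v [Ou Ov eg]]]]] := gcd_exists y x0.
have Og : O g by rewrite eg; apply: ringintD; apply: ringintM.
have [Ogi|ngi] := pselect (O g^-1); last first.
  have [q hq qg] := prime_divisor Og g0 ngi.
  by case: (h q hq); [rewrite -[x](divfK g0) | rewrite -[y](divfK g0)]; apply: primeM.
exists (g^-1 * u), (g^-1 * v); split; try exact: ringintM.
by rewrite -!mulrA -mulrDr -eg mulVf.
Qed.

(** * Squarefree elements and parity of valuations *)

Definition squarefree x := forall pi, prime_ideal (principal pi) -> ~ O (x / pi ^+ 2).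

Lemma squarefree_coprime x y : O x -> x != 0 -> squarefree x -> O y -> O (x / y) ->
  y != 0 -> coprime_elts y (x / y).
Proof.
move=> Ox x0 sq Oy Oxy y0.
apply: coprime_unitP => // q hq; have [pi pi0 eq] := prime_gen hq.
rewrite eq => /(principal_div _ pi0) h1 /(principal_div _ pi0) h2.
apply: (sq pi); first by rewrite -eq.
by have := ringintM h1 h2; congr O; field; rewrite pi0.
Qed.

(** With [g] a gcd of [u] and [x], a prime dividing [x / g] divides [x], hence [u] and [g], so that
    its square would divide [x]. *)
Lemma squarefree_mem x u : O x -> x != 0 -> squarefree x -> O u ->
  (forall q, prime_ideal q -> q x -> q u) -> O (u / x).
Proof.
move=> Ox x0 sq Ou h.
have [g [g0 h1 h2 [c [c' [Oc Oc' eg]]]]] := gcd_exists u x0.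
have xg0 : x / g != 0 by rewrite mulf_neq0 ?invr_eq0.
have Og : O g by rewrite eg; apply: ringintD; apply: ringintM.
have [Oi|ni] := pselect (O (x / g)^-1).
  by have := ringintM Oi h2; congr O; field; rewrite ?g0 ?x0.
have [q hq qxg] := prime_divisor h1 xg0 ni.
have qx : q x by rewrite -(divfK g0 x) mulrC; apply: primeM.
have qg : q g.
  have [_ qD _] := prime_submod hq; rewrite eg.
  by apply: qD; apply: primeM => //; apply: h.
have [pi pi0 eq] := prime_gen hq; case: (sq pi); first by rewrite -eq.
move: qg qxg; rewrite eq => /(principal_div _ pi0) k1 /(principal_div _ pi0) k2.
by have := ringintM k1 k2; congr O; field; rewrite pi0.
Qed.

Lemma squarefree_primeP x pi : prime_ideal (principal pi) -> O (x / pi) -> squarefree x ->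
  ~ principal pi (x / pi).
Proof.
move=> hpi Oxp sq; have pi0 := prime_elt_neq0 hpi; move=> /(principal_div _ pi0).
by rewrite -mulrA -invfM -expr2; apply: sq.
Qed.

(* The parity of the [pi]-adic valuation of [x]: the factor [h ^+ 2] clears
   denominators without changing it. *)
Definition oddval pi x : bool := `[< exists h k u,
  [/\ h != 0, O u, ~ principal pi u, x * h ^+ 2 = pi ^+ k * u & odd k] >].

Lemma prime_power_decomp pi x : prime_ideal (principal pi) -> O x -> x != 0 ->
  exists k u, [/\ O u, ~ principal pi u & x = pi ^+ k * u].
Proof.
move=> hpi; have pi0 := prime_elt_neq0 hpi; move: x.
apply: divisor_ind => x Ox x0 IH.
have [/(principal_div _ pi0) h|h] := pselect (principal pi x); last first.
  by exists 0%N, x; rewrite mul1r.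
have xp0 : x / pi != 0 by rewrite mulf_neq0 ?invr_eq0.
have [||k [u [Ou nu e]]] := IH _ h xp0.
- by rewrite invf_div mulrCA mulfV // mulr1; apply: prime_sub hpi _; exact: principal_mem.
- rewrite mulrAC mulfV // mul1r => Opi.
  exact: (prime_notunit hpi pi0 (principal_mem _)).
- by exists k.+1, u; split=> //; rewrite -(divfK pi0 x) e exprS; ring.
Qed.

Lemma prime_power_uniq pi k l u v : prime_ideal (principal pi) -> O u -> O v ->
  ~ principal pi u -> ~ principal pi v -> pi ^+ k * u = pi ^+ l * v -> k = l.
Proof.
move=> hpi; have pi0 := prime_elt_neq0 hpi.
wlog lekl : k l u v / (k <= l)%N.
  move=> H Ou Ov nu nv e; case/orP: (leq_total k l) => h; first exact: (H k l u v).
  by apply/esym/(H l k v u).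
move=> Ou Ov nu nv; rewrite -(subnKC lekl) exprD -mulrA.
move/(mulfI (expf_neq0 _ pi0)) => e.
case: (l - k)%N e => [|m] e; first by rewrite addn0.
case: nu; rewrite e exprSr mulrAC; apply: primeM => //; last exact: principal_mem.
by apply: ringintM => //; apply: ringintX; apply: prime_sub hpi _; exact: principal_mem.
Qed.

Lemma not_principalM pi u v : prime_ideal (principal pi) -> O u -> O v ->
  ~ principal pi u -> ~ principal pi v -> ~ principal pi (u * v).
Proof. by move=> hpi Ou Ov nu nv /(prime_mul hpi Ou Ov)[]. Qed.

Lemma oddvalE pi x h k u : prime_ideal (principal pi) -> x != 0 -> h != 0 -> O u ->
  ~ principal pi u -> x * h ^+ 2 = pi ^+ k * u -> oddval pi x = odd k.
Proof.
move=> hpi x0 h0 Ou nu e; have pi0 := prime_elt_neq0 hpi.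
apply/asboolP/idP => [[h' [k' [u' [h'0 Ou' nu' e' ok']]]]|ok]; last first.
  by exists h, k, u.
have [m m0 [Om Omh]] := den h; have [m' m'0 [Om' Omh']] := den h'.
have [||i [v [Ov nv ei]]] := @prime_power_decomp pi (m * m' * h) hpi.
- by rewrite mulrAC; apply: ringintM.
- by rewrite !mulf_neq0.
have [||j [w [Ow nw ej]]] := @prime_power_decomp pi (m * m' * h') hpi.
- by rewrite -mulrA; apply: ringintM.
- by rewrite !mulf_neq0.
(* Both sides equal [x (m m' h h') ^ 2]; comparing the exponents of [pi] gives [k] and [k'] the same
   parity. *)
have : pi ^+ (k + 2 * j) * (u * w ^+ 2) = pi ^+ (k' + 2 * i) * (u' * v ^+ 2).
  rewrite (exprD pi k) (exprD pi k') (mulnC 2 j) (mulnC 2 i) !exprM.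
  have -> : pi ^+ k * (pi ^+ j) ^+ 2 * (u * w ^+ 2) = (pi ^+ k * u) * (pi ^+ j * w) ^+ 2 by ring.
  have -> : pi ^+ k' * (pi ^+ i) ^+ 2 * (u' * v ^+ 2) = (pi ^+ k' * u') * (pi ^+ i * v) ^+ 2 by ring.
  by rewrite -e -e' -ei -ej; ring.
move/prime_power_uniq => H.
have : (k + 2 * j)%N = (k' + 2 * i)%N.
  by apply: H; rewrite ?expr2; do ?[exact: hpi | apply: ringintM | apply: not_principalM].
by move/(congr1 odd); rewrite (oddD k) (oddD k') !oddM /= !addbF => ->.
Qed.

Lemma oddvalP pi x : prime_ideal (principal pi) -> x != 0 ->
  exists h k u, [/\ h != 0, O u, ~ principal pi u, x * h ^+ 2 = pi ^+ k * u
    & oddval pi x = odd k].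
Proof.
move=> hpi x0; have [m m0 [Om Omx]] := den x.
have [||k [u [Ou nu e]]] := @prime_power_decomp pi (x * m ^+ 2) hpi.
- by rewrite expr2 mulrA mulrC (mulrC x); apply: ringintM.
- by rewrite mulf_neq0 // expf_neq0.
by exists m, k, u; split=> //; apply: oddvalE e.
Qed.

Lemma oddvalM pi x y : prime_ideal (principal pi) -> x != 0 -> y != 0 ->
  oddval pi (x * y) = oddval pi x (+) oddval pi y.
Proof.
move=> hpi x0 y0; have [h [k [u [h0 Ou nu e ->]]]] := oddvalP hpi x0.
have [h' [k' [u' [h'0 Ou' nu' e' ->]]]] := oddvalP hpi y0.
rewrite -oddD; apply: (@oddvalE pi _ (h * h') _ (u * u')) => //; try exact: mulf_neq0.
- exact: ringintM.
- exact: not_principalM.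
- by rewrite exprMn mulrACA e e' exprD; ring.
Qed.

Lemma oddval_unit pi x : prime_ideal (principal pi) -> O x -> ~ principal pi x ->
  oddval pi x = false.
Proof.
move=> hpi Ox nx; rewrite (@oddvalE pi x 1 0 x) ?oner_neq0 ?expr1n ?mulr1 ?mul1r //.
by apply/eqP => x0; apply: nx; rewrite x0; case: (principal_submod pi).
Qed.

Lemma oddval_sqr pi x : prime_ideal (principal pi) -> x != 0 -> oddval pi (x ^+ 2) = false.
Proof. by move=> hpi x0; rewrite expr2 oddvalM // addbb. Qed.

Lemma oddval_uniformizer pi u : prime_ideal (principal pi) -> O u -> ~ principal pi u ->
  oddval pi (pi * u) = true.
Proof.
move=> hpi Ou nu; have pi0 := prime_elt_neq0 hpi.
rewrite (@oddvalE pi _ 1 1 u) ?oner_neq0 ?expr1n ?mulr1 //.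
apply: mulf_neq0 => //.
by apply/eqP => u0; apply: nu; rewrite u0; case: (principal_submod pi).
Qed.

Lemma oddvalV pi x : prime_ideal (principal pi) -> x != 0 -> oddval pi x^-1 = oddval pi x.
Proof.
move=> hpi x0; apply: (@addbI (oddval pi x)); rewrite addbb -oddvalM ?invr_eq0 //.
by rewrite mulfV // oddval_unit //; [exact: ringint1 | exact: prime_not1].
Qed.

Lemma oddval_true_mem pi x : prime_ideal (principal pi) -> O x -> oddval pi x ->
  principal pi x.
Proof. by move=> hpi Ox ox; apply: contrapT => nx; rewrite oddval_unit in ox. Qed.

End PrincipalIdealDomain.

(** * Integers in an extension *)

Section Denominators.

(** [m x] is a root of the monic polynomial with coefficients [m ^ (n - i) p_i], and below the
    leading term each of these contains a factor [m p_i]. *)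
Lemma ringint_clear (F : fieldType) (p : {poly F}) (m x : F) :
  p \is monic -> root p x -> ring_int F m -> (forall i, ring_int F (m * p`_i)) ->
  ring_int F (m * x).
Proof.
move=> mp px Om Omp; set n := (size p).-1.
have sz : size p = n.+1 by rewrite /n prednK // size_poly_gt0 monic_neq0.
pose P := \poly_(i < n.+1) (m ^+ (n - i) * p`_i).
have Pn : P`_n = 1.
  by rewrite coef_poly ltnSn subnn mul1r -(monicP mp) lead_coefE /n.
have szP : size P = n.+1.
  apply/eqP; rewrite eqn_leq size_poly /=.
  by rewrite ltnNge; apply/negP => /(nth_default 0); rewrite Pn => /eqP; rewrite oner_eq0.
apply: (@integral_root_monic _ _ _ _ P).
- by rewrite monicE lead_coefE szP Pn.
- rewrite rootE horner_poly.
  have -> : \sum_(i < n.+1) m ^+ (n - i) * p`_i * (m * x) ^+ i = m ^+ n * p.[x].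
    rewrite horner_coef sz mulr_sumr; apply: eq_bigr => i _.
    have -> : m ^+ n = m ^+ (n - i) * m ^+ i by rewrite -exprD subnK // -ltnS.
    by rewrite exprMn; ring.
  by rewrite (eqP px) mulr0.
- apply/integral_poly => i; rewrite coef_poly; case: ifP => [|_]; last exact: integral0.
  rewrite ltnS leq_eqVlt => /orP[/eqP->|lt].
    rewrite subnn mul1r /n -lead_coefE (monicP mp); exact: integral1.
  rewrite -(subnSK lt) exprSr -mulrA; apply: ringintM; last exact: Omp.
  exact: ringintX.
Qed.

Lemma common_denominator (F : fieldType) (l : seq F) : has_denominators F ->
  exists2 m, m != 0 & ring_int F m /\ {in l, forall x, ring_int F (m * x)}.
Proof.
move=> den; elim: l => [|x l [m m0 [Om Hm]]].
  by exists 1; [exact: oner_neq0 | split=> //; exact: ringint1].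
have [n n0 [On Onx]] := den x; exists (m * n); first exact: mulf_neq0.
split; first exact: ringintM.
move=> y; rewrite inE => /orP[/eqP->|/Hm h]; first by rewrite -mulrA; apply: ringintM.
by rewrite mulrAC; apply: ringintM.
Qed.

Lemma number_field_denominators (L : fieldExtType rat) : has_denominators L.
Proof.
move=> x; have [p mp px] := alg_integral x.
have [q [c c0 ep]] := rat_poly_scale p.
exists c%:~R; first by rewrite -(rmorph_int (in_alg L)) fmorph_eq0 intr_eq0.
have Oz (z : int) : ring_int L z%:~R by exact: integral_id.
split=> //; apply: (@ringint_clear _ (map_poly (in_alg L) p)) => //.
  by rewrite map_monic.
move=> i; rewrite coef_map ep coefZ coef_map /=.
have -> : c%:~R * (c%:~R^-1 * (q`_i)%:~R)%:A = (q`_i)%:~R :> L.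
  rewrite -(rmorph_int (in_alg L) c) -rmorphM /= mulVKf ?intr_eq0 //.
  by rewrite -(rmorph_int (in_alg L)).
exact: Oz.
Qed.

Variables (L : fieldExtType rat) (K : fieldExtType L).

Lemma ringint_alg (l : L) : ring_int K l%:A <-> ring_int L l.
Proof.
have e : (in_alg K \o intr : int -> K) =1 intr by move=> z /=; rewrite -in_algE rmorph_int.
split=> [[p mp px]|].
  exists p => //; rewrite -(fmorph_root (in_alg K)) -map_poly_comp.
  by rewrite (eq_map_poly e).
case=> p mp px; exists p => //.
by rewrite -(eq_map_poly e) map_poly_comp -in_algE fmorph_root.
Qed.

(** The multiplier is taken in [L], where conjugation will fix it. *)
Lemma extension_denominators (x : K) :
  exists2 m : L, m != 0 & ring_int L m /\ ring_int K (m%:A * x).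
Proof.
have [p mp px] := alg_integral x.
have [m m0 [Om Hm]] := common_denominator p (@number_field_denominators L).
exists m => //; split=> //; apply: (@ringint_clear _ (map_poly (in_alg K) p)) => //.
- by rewrite map_monic.
- by apply/ringint_alg.
- move=> i; rewrite coef_map /=.
  rewrite -in_algE -[(p`_i)%:A]in_algE -rmorphM /=; apply/ringint_alg.
  have [h|h] := ltnP i (size p); first by apply/Hm/mem_nth.
  by rewrite nth_default // mulr0; exact: ringint0.
Qed.

Lemma extension_has_denominators : has_denominators K.
Proof.
move=> x; have [m m0 [Om Omx]] := extension_denominators x.
exists m%:A; first by rewrite -in_algE fmorph_eq0.
by split=> //; apply/ringint_alg.
Qed.

Lemma algD (x y : L) : (x + y)%:A = x%:A + y%:A :> K. Proof. exact: scalerDl. Qed.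
Lemma algN (x : L) : (- x)%:A = - x%:A :> K. Proof. exact: scaleNr. Qed.
Lemma algM (x y : L) : (x * y)%:A = x%:A * y%:A :> K. Proof. exact: (rmorphM (in_alg K)). Qed.
Lemma algV (x : L) : (x^-1)%:A = x%:A^-1 :> K. Proof. exact: (fmorphV (in_alg K)). Qed.
Lemma algX (x : L) n : (x ^+ n)%:A = x%:A ^+ n :> K. Proof. exact: (rmorphXn (in_alg K)). Qed.
Lemma algn n : (n%:R : L)%:A = n%:R :> K. Proof. exact: (rmorph_nat (in_alg K)). Qed.
Lemma alg0 : (0 : L)%:A = 0 :> K. Proof. exact: scale0r. Qed.
Lemma alg1 : (1 : L)%:A = 1 :> K. Proof. exact: scale1r. Qed.
Definition algE := (alg0, alg1, algn, algD, algN, algM, algV, algX).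
Lemma alg_inj (x y : L) : x%:A = y%:A :> K -> x = y. Proof. exact: (fmorph_inj (in_alg K)). Qed.
Lemma alg_eq0 (x : L) : (x%:A == 0 :> K) = (x == 0). Proof. exact: (fmorph_eq0 (in_alg K)). Qed.

End Denominators.

(** * Ideals of a quadratic extension *)

Section QuadraticExtension.
Variables (L : fieldExtType rat) (K : fieldExtType L) (bar : {lrmorphism K -> K}).
Hypothesis pid : forall I : set L, frac_ideal I -> exists2 x, x != 0 & I = principal x.
Hypothesis hbar : exists x, bar x <> x.
Variables (a b : L) (t : K).
Hypotheses (ha : ring_int L a) (hb : ring_int L b).
Hypothesis ht : t ^+ 2 + a%:A * t + b%:A = 0.
Hypothesis hOK : ring_int K = adjoin_int t.
Variables (d : L) (s : K).
Hypothesis hd : d = a ^+ 2 - 4 * b.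
Hypothesis hs : s ^+ 2 = d%:A.
Hypothesis hd2 : coprime_elts d 2.

Local Notation OL := (ring_int L).
Local Notation OK := (ring_int K).
Let denL := @number_field_denominators L.
Let denK := @extension_has_denominators L K.

(** * Coordinates in the basis [1, t], conjugation, norm and trace *)

Lemma t_sqr : t ^+ 2 = - a%:A * t - b%:A.
Proof. by apply/eqP; rewrite -subr_eq0 -[X in _ == X]ht; apply/eqP; ring. Qed.

Lemma OK_coord x : OK x <-> exists u v, [/\ OL u, OL v & x = u%:A + v%:A * t].
Proof.
rewrite hOK; split; last first.
  case=> u [v [Ou Ov ->]]; exists (v *: 'X + u%:P); last first.
    by rewrite rmorphD /= map_polyZ map_polyX map_polyC /= !hornerE /= addrC.
  move=> i; rewrite coefD coefZ coefX coefC; apply: ringintD.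
    by apply: ringintM => //; exact: ringint_nat.
  by case: ifP => // _; exact: ringint0.
case=> q Oq ->; elim/poly_ind: q Oq => [|q c IH] Oq.
  by exists 0, 0; rewrite rmorph0 horner0 alg0 mul0r addr0; split=> //; exact: ringint0.
have [|u [v [Ou Ov e]]] := IH.
  by move=> i; have := Oq i.+1; rewrite coefD coefMX coefC addr0.
have Oc : OL c by have := Oq 0%N; rewrite coefD coefMX coefC add0r.
exists (c - v * b), (u - v * a); split.
- by apply: ringintB => //; apply: ringintM.
- by apply: ringintB => //; apply: ringintM.
- rewrite rmorphD rmorphM /= map_polyX map_polyC !hornerE /= e !algE.
  have -> : (u%:A + v%:A * t) * t = u%:A * t + v%:A * t ^+ 2 by ring.
  by rewrite t_sqr; ring.
Qed.

Lemma K_coord x : exists u v : L, x = u%:A + v%:A * t.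
Proof.
have [m m0 [Om /OK_coord[u [v [_ _ e]]]]] := extension_denominators x.
exists (u / m), (v / m); rewrite !algE.
by apply: (@mulfI _ m%:A); rewrite ?alg_eq0 // e; field; rewrite alg_eq0.
Qed.

Lemma bar_alg (l : L) : bar l%:A = l%:A.
Proof. by rewrite linearZ /= rmorph1. Qed.

Lemma bar_t : bar t = - a%:A - t.
Proof.
have nt : bar t != t.
  apply/eqP => e; have [x] := hbar; apply; have [u [v ->]] := K_coord x.
  by rewrite rmorphD rmorphM /= !bar_alg e.
have := congr1 bar ht; rewrite !rmorphD rmorphXn rmorphM /= !bar_alg rmorph0 => e.
have : (bar t - t) * (bar t + a%:A + t) = 0.
  by rewrite -[RHS](subrr 0) -{1}e -ht; ring.
move/eqP; rewrite mulf_eq0 subr_eq0 (negbTE nt) /= => /eqP e'.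
by rewrite -[LHS]subr0 -e'; ring.
Qed.

Lemma bar_t_neq : t - bar t != 0.
Proof.
rewrite subr_eq0; apply/eqP => e; have [x] := hbar; apply.
by have [u [v ->]] := K_coord x; rewrite rmorphD rmorphM /= !bar_alg -e.
Qed.

Lemma barK x : bar (bar x) = x.
Proof.
have [u [v ->]] := K_coord x.
by rewrite !rmorphD !rmorphM /= !bar_alg bar_t rmorphB rmorphN /= bar_alg bar_t; ring.
Qed.

Lemma coord_uniq (u v u' v' : L) :
  u%:A + v%:A * t = u'%:A + v'%:A * t -> u = u' /\ v = v'.
Proof.
move=> e; have e1 := congr1 bar e.
move: e1; rewrite !rmorphD !rmorphM /= !bar_alg => e1.
have : (v%:A - v'%:A) * (t - bar t) = 0.
  have -> : (v%:A - v'%:A) * (t - bar t) = (u%:A + v%:A * t) - (u'%:A + v'%:A * t)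
    - ((u%:A + v%:A * bar t) - (u'%:A + v'%:A * bar t)) by ring.
  by rewrite e e1 !subrr.
move/eqP; rewrite mulf_eq0 (negbTE bar_t_neq) orbF subr_eq0 => /eqP ev.
split; last exact: alg_inj ev.
by apply: (@alg_inj _ K); apply: (addIr (v%:A * t)); rewrite e ev.
Qed.

Lemma bar_fix x : bar x = x -> exists l : L, x = l%:A.
Proof.
have [u [v ->]] := K_coord x; rewrite rmorphD rmorphM /= !bar_alg => e.
exists u; have : v%:A * (t - bar t) = 0 by move/addrI: e => e; rewrite mulrBr e subrr.
by move/eqP; rewrite mulf_eq0 (negbTE bar_t_neq) orbF => /eqP->; rewrite mul0r addr0.
Qed.

(** [x (bar x)] is fixed by [bar], hence comes from [L] by [bar_fix]: the default value of [xget]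
    does not occur. The same holds for [trace]. *)
Definition norm x : L := xget 0 [set l | l%:A = x * bar x].
Definition trace x : L := xget 0 [set l | l%:A = x + bar x].

Lemma normE x : (norm x)%:A = x * bar x.
Proof.
apply: (@xgetPex _ 0 [set l : L | l%:A = x * bar x]).
by have [|l e] := @bar_fix (x * bar x); [rewrite rmorphM /= barK mulrC | exists l].
Qed.

Lemma traceE x : (trace x)%:A = x + bar x.
Proof.
apply: (@xgetPex _ 0 [set l : L | l%:A = x + bar x]).
by have [|l e] := @bar_fix (x + bar x); [rewrite rmorphD /= barK addrC | exists l].
Qed.

Lemma bar_neq0 x : x != 0 -> bar x != 0. Proof. by rewrite fmorph_eq0. Qed.

Lemma norm_neq0 x : x != 0 -> norm x != 0.
Proof. by move=> x0; rewrite -(alg_eq0 K) normE mulf_neq0 ?fmorph_eq0. Qed.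

Lemma normM x y : norm (x * y) = norm x * norm y.
Proof. by apply: (@alg_inj _ K); rewrite algM !normE rmorphM /=; ring. Qed.

Lemma norm_alg l : norm l%:A = l ^+ 2.
Proof. by apply: (@alg_inj _ K); rewrite normE bar_alg algX expr2. Qed.

(** Both [s] and [t - bar t] have square [a ^ 2 - 4 b]. *)
Lemma s_sign : s = t - bar t \/ s = - (t - bar t).
Proof.
suff: (s == t - bar t) || (s == - (t - bar t)) by case/orP=> /eqP; [left | right].
rewrite -[s == _]subr_eq0 -[s == - _]subr_eq0 -mulf_eq0.
have -> : (s - (t - bar t)) * (s - - (t - bar t)) = s ^+ 2 - (t - bar t) ^+ 2 by ring.
rewrite hs hd bar_t !algE.
have -> : (t - (- a%:A - t)) ^+ 2 = 4 * t ^+ 2 + 4 * (a%:A * t) + a%:A ^+ 2 by ring.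
by rewrite t_sqr; apply/eqP; ring.
Qed.

Lemma bar_s : bar s = - s.
Proof. by case: s_sign => ->; rewrite ?rmorphN rmorphB /= barK; ring. Qed.

Lemma s_neq0 : s != 0.
Proof. by case: s_sign => ->; rewrite ?oppr_eq0 bar_t_neq. Qed.

Lemma d_neq0 : d != 0.
Proof. by rewrite -(alg_eq0 K) -hs expf_neq0 // s_neq0. Qed.

Lemma norm_s : norm s = - d.
Proof. by apply: (@alg_inj _ K); rewrite normE bar_s algN -hs; ring. Qed.

Lemma OL_d : OL d. Proof. by case/coprime_eltsP: hd2. Qed.

Lemma OK_s : OK s.
Proof. by apply: ringint_sqr; rewrite hs; apply/ringint_alg/OL_d. Qed.

Lemma OK_bar x : OK x -> OK (bar x).
Proof.
move=> /OK_coord[u [v [Ou Ov ->]]]; apply/OK_coord; exists (u - v * a), (- v).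
split; [by apply: ringintB => //; apply: ringintM | exact: ringintN |].
by rewrite rmorphD rmorphM /= !bar_alg bar_t !algE; ring.
Qed.

Lemma OK_barE x : OK (bar x) <-> OK x.
Proof. by split=> /OK_bar; rewrite ?barK. Qed.

Lemma OL_norm x : OK x -> OL (norm x).
Proof.
by move=> Ox; rewrite -(ringint_alg K) normE; apply: ringintM => //; apply: OK_bar.
Qed.

Lemma OL_trace x : OK x -> OL (trace x).
Proof.
by move=> Ox; rewrite -(ringint_alg K) traceE; apply: ringintD => //; apply: OK_bar.
Qed.

Lemma OK_trace_norm x : OL (trace x) -> OL (norm x) -> OK x.
Proof.
move=> /(ringint_alg K) h1 /(ringint_alg K) h2.
apply: (@ringint_root2 _ (- (trace x)%:A) (norm x)%:A) => //; first exact: ringintN.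
by rewrite traceE normE; ring.
Qed.

Lemma OK_diff x : OK x -> exists2 v, OL v & x - bar x = v%:A * s.
Proof.
case/OK_coord=> u [v [Ou Ov ->]]; rewrite rmorphD rmorphM /= !bar_alg.
case: s_sign => ->; [exists v => // | exists (- v); first exact: ringintN].
  by ring.
by rewrite algN; ring.
Qed.

(** Conjugation is trivial modulo [s], so [2 x] is congruent to the trace of [x]; the Bezout
    coefficient [g] inverts [2] modulo [d = s ^ 2]. *)
Lemma OK_mod_s x : OK x -> exists2 l, OL l & OK ((x - l%:A) / s).
Proof.
move=> Ox; have [v Ov e] := OK_diff Ox.
have [_ _ [f [g [Of Og efg]]]] := (coprime_eltsP _ _).1 hd2.
exists (g * trace x); first by apply: ringintM => //; exact: OL_trace.
have -> : (x - (g * trace x)%:A) / s = (g * v)%:A + f%:A * s * x.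
  apply: (@mulIf _ s); rewrite ?s_neq0 // divfK ?s_neq0 // mulrDl.
  have -> : f%:A * s * x * s = f%:A * d%:A * x by rewrite -hs; ring.
  have e1 := congr1 (fun z => z%:A : K) efg; rewrite !algE in e1.
  have ex : x = (f%:A * d%:A + g%:A * 2) * x by rewrite e1 mul1r.
  have e2 : (g * v)%:A * s = g%:A * (x - bar x) by rewrite e algM; ring.
  by rewrite e2 algM traceE [X in X - _]ex; ring.
apply: ringintD; first by apply/ringint_alg/ringintM.
by apply: ringintM => //; apply: ringintM; [apply/ringint_alg | exact: OK_s].
Qed.

(** [r d = (r s) s] is integral, and so is [2 r], because [r s - bar (r s) = 2 r s] is a multiple of
    [s] by an integer of [L]; and [d] is prime to [2]. *)
Lemma OL_of_scaled_s r : OK (r%:A * s) -> OL r.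
Proof.
move=> Ors; have [v Ov e] := OK_diff Ors.
have e2 : 2 * r = v.
  apply: (@alg_inj _ K); apply: (@mulIf _ s); first exact: s_neq0.
  by rewrite -e rmorphM /= bar_alg bar_s !algE; ring.
have Ord : OL (r * d).
  by rewrite -(ringint_alg K) algM -hs expr2 mulrA; apply: ringintM => //; exact: OK_s.
have [_ _ [f [g [Of Og efg]]]] := (coprime_eltsP _ _).1 hd2.
have -> : r = f * (r * d) + g * v.
  by rewrite -e2 -[LHS]mul1r; transitivity ((f * d + g * 2) * r); [rewrite efg | ring].
by apply: ringintD; apply: ringintM.
Qed.

(** If [pi ^ 2] divided [d], the square of [s / pi] would be integral, hence [s / pi], and [1 / pi]
    by [OL_of_scaled_s]. *)
Lemma d_squarefree : squarefree d.
Proof.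
move=> pi hpi; have pi0 := prime_elt_neq0 hpi => h.
have : OK (pi^-1%:A * s).
  by apply: ringint_sqr; rewrite exprMn hs -algX -algM ringint_alg exprVn mulrC.
by move/OL_of_scaled_s; apply: (prime_notunit hpi pi0); exact: principal_mem.
Qed.

(** * Conjugate ideals, norms and inverses of ideals *)

Definition conj_ideal (I : set K) : set K := [set bar x | x in I].

Lemma conj_idealE I x : conj_ideal I x <-> I (bar x).
Proof. by split=> [[y Iy <-]|Ix]; [rewrite barK | exists (bar x); rewrite ?barK]. Qed.

Lemma conj_ideal_sub I J : I `<=` J -> conj_ideal I `<=` conj_ideal J.
Proof. by move=> s' x /conj_idealE/s' h; apply/conj_idealE. Qed.

Lemma conj_idealK I : conj_ideal (conj_ideal I) = I.
Proof. by apply/seteqP; split=> x; rewrite !conj_idealE barK. Qed.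

Lemma conj_submod I : submodule I -> submodule (conj_ideal I).
Proof.
case=> I0 ID IM; split=> [|x y|c x Oc]; rewrite !conj_idealE ?rmorph0 //.
  by move=> hx hy; rewrite rmorphD; apply: ID.
by move=> hx; rewrite rmorphM; apply: IM => //; apply: OK_bar.
Qed.

Lemma conj_frac I : frac_ideal I -> frac_ideal (conj_ideal I).
Proof.
move=> fI; have [h1 h2 h3] := conj_submod (frac_submod fI).
case: fI => _ _ _ [x Ix x0] [c c0 cI]; split=> //.
  by exists (bar x); [apply/conj_idealE; rewrite barK | exact: bar_neq0].
exists (bar c); first exact: bar_neq0.
by move=> y /conj_idealE/cI/OK_bar; rewrite rmorphM /= barK.
Qed.

Lemma conj_ringint : conj_ideal OK = OK.
Proof. by apply/seteqP; split=> x; rewrite conj_idealE OK_barE. Qed.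

Lemma conj_mul I J : conj_ideal (ideal_mul I J) = ideal_mul (conj_ideal I) (conj_ideal J).
Proof.
have h I' J' : conj_ideal (ideal_mul I' J') `<=` ideal_mul (conj_ideal I') (conj_ideal J').
  move=> x /conj_idealE; rewrite -{2}(barK x); move: (bar x).
  apply: (@ideal_mul_min _ _ _ [set y | ideal_mul (conj_ideal I') (conj_ideal J') (bar y)]).
    have [k1 k2 k3] := ideal_mul_submod (conj_ideal I') (conj_ideal J').
    split=> /= [|y z|c y Oc]; rewrite ?rmorph0 ?rmorphD ?rmorphM //; first exact: k2.
    by move=> hy; apply: k3 => //; exact: OK_bar.
  move=> y z Iy Jz /=; rewrite rmorphM.
  by apply: ideal_mul_in; apply/conj_idealE; rewrite barK.
apply/seteqP; split=> //.
rewrite -[X in X `<=` _]conj_idealK; apply: conj_ideal_sub => x /h.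
by rewrite !conj_idealK.
Qed.

Lemma conj_principal x : conj_ideal (principal x) = principal (bar x).
Proof.
apply/seteqP; split=> y.
  move=> /conj_idealE/principalE[c Oc e]; apply/principalE; exists (bar c).
    exact: OK_bar.
  by rewrite -[LHS]barK e rmorphM.
move=> /principalE[c Oc ->]; apply/conj_idealE/principalE; exists (bar c).
  exact: OK_bar.
by rewrite rmorphM /= barK.
Qed.

(** [n] is a generator of the relative norm of [I], determined only up to a unit. The identity makes
    [n^-1 (bar I)] the inverse of [I]. *)
Definition ideal_norm (I : set K) (n : L) : Prop :=
  n != 0 /\ ideal_mul I (conj_ideal I) = principal n%:A.

(* The generator is that of the [O_L]-module spanned by the norms of elements
   and the traces [x (bar y) + y (bar x)]: all [x (bar y) / n] have integral
   trace and norm. *)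
Lemma ideal_norm_exists I : frac_ideal I -> exists n, ideal_norm I n.
Proof.
move=> fI; have sI := frac_submod fI.
pose S := [set l : L | exists x y, [/\ I x, I y & l = norm x \/ l = trace (x * bar y)]].
have fS : frac_ideal (ideal_span S).
  have [h1 h2 h3] := span_submod S.
  case: fI => _ _ _ [x Ix x0] [c c0 cI]; split=> //.
    exists (norm x); last exact: norm_neq0.
    by apply: span_in; exists x, x; split=> //; left.
  exists (norm c); first exact: norm_neq0.
  apply: span_min; first exact: submod_preim (submod_ringint _).
  move=> _ [y [z [Iy Iz [->|->]]]] /=; first by rewrite -normM; apply/OL_norm/cI.
  have -> : norm c * trace (y * bar z) = trace ((c * y) * bar (c * z)).
    apply: (@alg_inj _ K); rewrite algM normE !traceE !rmorphM /= !barK; ring.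
  by apply: OL_trace; apply: ringintM; [apply: cI | apply/OK_bar/cI].
have [n n0 eS] := pid fS; exists n; split=> //.
have n0K : n%:A != 0 :> K by rewrite alg_eq0.
have Sn l : S l -> OL (l / n).
  by move=> Sl; apply/(principal_div _ n0); rewrite -eS; apply: span_in.
apply/seteqP; split; last first.
  apply: span_min => [|_ ->]; first exact: ideal_mul_submod.
  suff h : ideal_span S `<=` [set l | ideal_mul I (conj_ideal I) l%:A].
    by apply: h; rewrite eS; exact: principal_mem.
  have [h1 h2 h3] := ideal_mul_submod I (conj_ideal I).
  apply: span_min.
    split=> /= [|x y hx hy|c x Oc hx]; first by rewrite alg0.
      by rewrite algD; apply: h2.
    by rewrite algM; apply: h3 => //; apply/ringint_alg.
  move=> _ [x [y [Ix Iy [->|->]]]] /=.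
    by rewrite normE; apply: ideal_mul_in => //; apply/conj_idealE; rewrite barK.
  rewrite traceE rmorphM /= barK (mulrC (bar x)).
  by apply: h2; apply: ideal_mul_in => //; apply/conj_idealE; rewrite barK.
apply: ideal_mul_min; first exact: principal_submod.
move=> x y Ix /conj_idealE Iy; apply/(principal_div _ n0K); rewrite -algV.
apply: OK_trace_norm.
  have -> : trace (x * y * n^-1%:A) = trace (x * bar (bar y)) / n.
    by apply: (@alg_inj _ K); rewrite algM !traceE barK !rmorphM /= bar_alg; ring.
  by apply: Sn; exists x, (bar y); split=> //; right.
have -> : norm (x * y * n^-1%:A) = (norm x / n) * (norm (bar y) / n).
  by apply: (@alg_inj _ K); rewrite !algM !normE !rmorphM /= bar_alg barK; ring.
by apply: ringintM; apply: Sn; [exists x, x | exists (bar y), (bar y)]; split=> //; left.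
Qed.

Implicit Types I J M : set K.

Lemma ideal_norm_eq I m n : ideal_norm I n -> OL (m / n) -> OL (n / m) -> m != 0 ->
  ideal_norm I m.
Proof.
move=> [n0 e] h1 h2 m0; split=> //; rewrite e; apply/principal_eq; rewrite ?alg_eq0 //.
by rewrite -!algV -!algM !ringint_alg.
Qed.

Lemma ideal_norm_uniq I m n : ideal_norm I n -> ideal_norm I m -> OL (m / n) /\ OL (n / m).
Proof.
move=> [n0 en] [m0 em]; have := etrans (esym em) en.
move/principal_eq; rewrite !alg_eq0 => /(_ m0 n0).
by rewrite -!algV -!algM !ringint_alg.
Qed.

Lemma ideal_normM I J m n : ideal_norm I m -> ideal_norm J n ->
  ideal_norm (ideal_mul I J) (m * n).
Proof.
move=> [m0 em] [n0 en]; split; first exact: mulf_neq0.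
by rewrite conj_mul ideal_mulACA em en principalM algM.
Qed.

Lemma ideal_norm_conj I n : ideal_norm I n -> ideal_norm (conj_ideal I) n.
Proof. by case=> n0 en; split=> //; rewrite conj_idealK ideal_mulC. Qed.

Lemma ideal_norm_principal x : x != 0 -> ideal_norm (principal x) (norm x).
Proof.
by move=> x0; split; [exact: norm_neq0 | rewrite conj_principal principalM normE].
Qed.

Lemma ideal_inv_conj I n : frac_ideal I -> ideal_norm I n ->
  ideal_inv I = ideal_mul (principal n^-1%:A) (conj_ideal I).
Proof.
move=> fI [n0 en]; apply: ideal_inv_eq; [exact: frac_submod | exact: ideal_mul_submod |].
by rewrite ideal_mulCA en principalM algV mulVf ?alg_eq0 // principal1.
Qed.

Lemma frac_inv I : frac_ideal I -> frac_ideal (ideal_inv I).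
Proof.
move=> fI; have [n hn] := ideal_norm_exists fI; rewrite (ideal_inv_conj fI hn).
apply: frac_mul; last exact: conj_frac.
by apply: frac_principal; rewrite // alg_eq0 invr_eq0; case: hn.
Qed.

Lemma ideal_mulV I : frac_ideal I -> ideal_mul I (ideal_inv I) = OK.
Proof.
move=> fI; have [n hn] := ideal_norm_exists fI; rewrite (ideal_inv_conj fI hn).
by case: hn => n0 en; rewrite ideal_mulCA en principalM algV mulVf ?alg_eq0 // principal1.
Qed.

Lemma ideal_mulVl I : frac_ideal I -> ideal_mul (ideal_inv I) I = OK.
Proof. by move=> fI; rewrite ideal_mulC ideal_mulV. Qed.

Lemma ideal_mulKl I J : frac_ideal I -> submodule J ->
  ideal_mul (ideal_inv I) (ideal_mul I J) = J.
Proof. by move=> fI sJ; rewrite ideal_mulA ideal_mulVl // ideal_mul1. Qed.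

Lemma ideal_mulVKl I J : frac_ideal I -> submodule J ->
  ideal_mul I (ideal_mul (ideal_inv I) J) = J.
Proof. by move=> fI sJ; rewrite ideal_mulA ideal_mulV // ideal_mul1. Qed.

Lemma ideal_mul_inj I J J' : frac_ideal I -> submodule J -> submodule J' ->
  ideal_mul I J = ideal_mul I J' -> J = J'.
Proof. by move=> fI sJ sJ' e; rewrite -(ideal_mulKl fI sJ) e ideal_mulKl. Qed.

Lemma conj_inv I : frac_ideal I -> conj_ideal (ideal_inv I) = ideal_inv (conj_ideal I).
Proof.
move=> fI; apply/esym/ideal_inv_eq.
- exact/frac_submod/conj_frac.
- exact/conj_submod/ideal_inv_submod.
- by rewrite -conj_mul ideal_mulV // conj_ringint.
Qed.

Lemma ideal_norm_inv I n : frac_ideal I -> ideal_norm I n -> ideal_norm (ideal_inv I) n^-1.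
Proof.
move=> fI hn; split; first by rewrite invr_eq0; case: hn.
rewrite conj_inv // (ideal_inv_conj fI hn).
case: hn => n0 en; rewrite -(ideal_inv_conj fI (conj n0 en)).
apply: (@ideal_mul_inj (principal n%:A)); try exact: ideal_mul_submod;
  try exact: principal_submod; first by apply: frac_principal; rewrite // alg_eq0.
rewrite -{1}en ideal_mulACA ideal_mulV // ideal_mulV; last exact: conj_frac.
by rewrite ideal_mul1 ?principalM ?algV ?mulfV ?alg_eq0 ?principal1 //; exact: submod_ringint.
Qed.

Lemma ideal_norm_mul_mem I n x y : ideal_norm I n -> I x -> I y -> OK (x * bar y / n%:A).
Proof.
case=> n0 en Ix Iy; apply/principal_div; rewrite ?alg_eq0 // -en.
by apply: ideal_mul_in => //; apply/conj_idealE; rewrite barK.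
Qed.

Lemma ideal_norm_norm_mem I n x : ideal_norm I n -> I x -> OL (norm x / n).
Proof.
move=> hn Ix; rewrite -(ringint_alg K) algM algV normE.
exact: (ideal_norm_mul_mem hn Ix Ix).
Qed.

Lemma ideal_norm_mem I n : submodule I -> I `<=` OK -> ideal_norm I n -> I n%:A.
Proof.
move=> sI IO [n0 en]; have : ideal_mul I (conj_ideal I) n%:A.
  by rewrite en; exact: principal_mem.
apply: ideal_mul_min => // x y Ix /conj_idealE/IO/OK_bar; rewrite barK mulrC => Oy.
by case: sI => _ _; apply.
Qed.

Lemma ideal_norm_int I n : submodule I -> I `<=` OK -> ideal_norm I n -> OL n.
Proof. by move=> sI IO hn; rewrite -(ringint_alg K); apply: (IO); exact: ideal_norm_mem hn. Qed.

Lemma frac_denominator I : frac_ideal I ->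
  exists m : L, [/\ m != 0, OL m & forall x, I x -> OK (m%:A * x)].
Proof.
case=> _ _ _ _ [c c0 cI]; have [m m0 [Om h]] := extension_denominators (bar c).
have [k k0 [Ok Oh]] := denL (norm c).
(* The denominator [c] is replaced by its norm, which lies in [L]; [m] clears the denominator of
   [bar c], and [k] that of [norm c]. *)
exists (k * (m * norm c)); split.
- by rewrite !mulf_neq0 // norm_neq0.
- by rewrite mulrCA; apply: ringintM.
- move=> x /cI Ocx; rewrite !algM normE.
  have -> : k%:A * (m%:A * (c * bar c)) * x = k%:A * ((m%:A * bar c) * (c * x)) by ring.
  by apply: ringintM; [apply/ringint_alg | apply: ringintM].
Qed.

(** Hermite normal form relative to [1, t]: [m1 = n0] generates the part of [I] in [L], and [v0]
    generates the ideal of [t]-coordinates, attained by [m2 = u0 + v0 t]. The norm is [n0 v0]. The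
    last identity will yield the discriminant of an order. *)
Lemma ideal_basis I : frac_ideal I -> exists m1 m2 n,
  [/\ ideal_norm I n,
      forall x, I x <-> exists l1 l2, [/\ OL l1, OL l2 & x = l1%:A * m1 + l2%:A * m2],
      forall x, exists l1 l2 : L, x = l1%:A * m1 + l2%:A * m2
    & (m1 * bar m2 - bar m1 * m2) ^+ 2 = (n ^+ 2 * d)%:A].
Proof.
move=> fI; have sI := frac_submod fI; have [I0 ID IM] := sI.
have IML l x : OL l -> I x -> I (l%:A * x) by move=> Ol; apply: IM; apply/ringint_alg.
have [m [m0 Om Hm]] := frac_denominator fI.
have Ot : OK t by apply/OK_coord; exists 0, 1; rewrite alg0 alg1 mul1r add0r; split=> //;
  [exact: ringint0 | exact: ringint1].
have [n0 n00 eA] : exists2 n0, n0 != 0 & [set u : L | I u%:A] = principal n0.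
  apply: pid; split=> /= [|x y|c x Oc||].
  - by rewrite alg0.
  - by rewrite algD; apply: ID.
  - by rewrite algM; apply: IML.
  - case: fI => _ _ _ [x Ix x0] _; have [k k0 [Ok Okx]] := extension_denominators (bar x).
    exists (k * norm x); last by rewrite mulf_neq0 ?norm_neq0.
    by rewrite algM normE mulrCA mulrC; apply: IM; rewrite // mulrC.
  - by exists m => // x /Hm; rewrite -algM ringint_alg.
have [v0 v00 eB] : exists2 v0, v0 != 0 & [set v : L | exists u : L, I (u%:A + v%:A * t)] = principal v0.
  apply: pid; split=> /= [|x y [u hu] [u' hu']|c x Oc [u hu]||].
  - by exists 0; rewrite alg0 mul0r addr0.
  - by exists (u + u'); rewrite !algD; have := ID _ _ hu hu'; congr I; ring.
  - by exists (c * u); rewrite !algM; have := IML _ _ Oc hu; congr I; ring.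
  - exists n0 => //; exists 0; rewrite alg0 add0r mulrC; apply: IM => //.
    by have : principal n0 n0 by [exact: principal_mem]; rewrite -eA.
  - exists m => // v [u /Hm/OK_coord[u' [v' [_ Ov']]]].
    by rewrite mulrDr mulrA -!algM => /coord_uniq[_ ->].
have In0 : I n0%:A by have : principal n0 n0 by [exact: principal_mem]; rewrite -eA.
have [u0 Im2] : exists u : L, I (u%:A + v0%:A * t).
  by have : principal v0 v0 by [exact: principal_mem]; rewrite -eB.
pose m1 : K := n0%:A; pose m2 := u0%:A + v0%:A * t.
have v0K : v0%:A != 0 :> K by rewrite alg_eq0.
have n0K : n0%:A != 0 :> K by rewrite alg_eq0.
have Onv : OL (n0 / v0).
  apply/(principal_div _ v00); rewrite -eB; exists 0.
  by rewrite alg0 add0r mulrC; apply: IM.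
(* From [t m2], an element of [I] with [t]-coordinate [u0 - v0 a]. *)
have Ouv : OL (u0 / v0).
  have : OL ((u0 - v0 * a) / v0).
    apply/(principal_div _ v00); rewrite -eB; exists (- (v0 * b)).
    have := IM _ _ Ot Im2; congr I; rewrite mulrDr.
    have -> : t * (v0%:A * t) = v0%:A * t ^+ 2 by ring.
    by rewrite t_sqr !algE; ring.
  by move=> h; have := ringintD h ha; congr OL; field.
have Om2v : OK (m2 / v0%:A).
  apply/OK_coord; exists (u0 / v0), 1; split=> //; first exact: ringint1.
  by rewrite /m2 !algE; field.
have Obm2v : OK (bar m2 / v0%:A).
  by have := OK_bar Om2v; rewrite rmorphM fmorphV /= bar_alg.
have ON : OK (norm m2 / v0 / n0)%:A.
  apply/ringint_alg/(principal_div _ n00); rewrite -eA /=.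
  have -> : (norm m2 / v0)%:A = bar m2 / v0%:A * m2 by rewrite algM algV normE; ring.
  exact: IM.
have Ispan x : I x <-> exists l1 l2, [/\ OL l1, OL l2 & x = l1%:A * m1 + l2%:A * m2].
  split; last by case=> l1 [l2 [O1 O2 ->]]; apply: ID; apply: IML.
  have [u [v ex]] := K_coord x => Ix.
  have : principal v0 v by rewrite -eB; exists u; rewrite -ex.
  case/principalE=> l2 O2 ev.
  have : principal n0 (u - l2 * u0).
    rewrite -eA /=; have := submodB sI Ix (IML _ _ O2 Im2); congr I.
    by rewrite ex ev !algE; ring.
  case/principalE=> l1 O1 eu; exists l1, l2; split=> //.
  by rewrite /m1 /m2 -algM -eu ex ev !algE; ring.
have eD : m1 * bar m2 - bar m1 * m2 = - ((n0 * v0)%:A * (t - bar t)).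
  by rewrite /m1 /m2 rmorphD rmorphM /= !bar_alg algM; ring.
exists m1, m2, (n0 * v0); split=> //.
(* [n] and [n0 v0] divide each other: [n] divides [n0 v0] by the difference
   [m2 (bar m1) - m1 (bar m2)], and [n0 v0] divides [n] by expanding products of basis elements. *)
- have [n hn] := ideal_norm_exists fI; have [nz en] := hn.
  have nv0 : n0 * v0 != 0 by exact: mulf_neq0.
  apply: (ideal_norm_eq hn) => //.
    apply: OL_of_scaled_s.
    have h : OK ((n0 * v0 / n)%:A * (t - bar t)).
      have I1 : I m1 by []; have I2 : I m2 by [].
      have := ringintB (ideal_norm_mul_mem hn I2 I1) (ideal_norm_mul_mem hn I1 I2).
      congr OK; rewrite -mulrBl -[X in X / _]opprB (mulrC m2) eD !algE.
      by field; rewrite alg_eq0.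
    by case: s_sign => -> //; rewrite mulrN; apply: ringintN.
  rewrite -(ringint_alg K) algM algV; apply/principal_div; first by rewrite alg_eq0.
  have : principal (n%:A : K) n%:A by exact: principal_mem.
  rewrite -{1}en; apply: ideal_mul_min; first exact: principal_submod.
  move=> x y /Ispan[l1 [l2 [O1 O2 ->]]] /conj_idealE/Ispan[k1 [k2 [Ok1 Ok2 ey]]].
  have {ey}-> : y = k1%:A * m1 + k2%:A * bar m2.
    by rewrite -[y]barK ey rmorphD !rmorphM /= !bar_alg.
  apply/principal_div; first by rewrite alg_eq0.
  have -> : (l1%:A * m1 + l2%:A * m2) * (k1%:A * m1 + k2%:A * bar m2) / (n0 * v0)%:A
    = (l1 * k1)%:A * (n0 / v0)%:A + (l1 * k2)%:A * (bar m2 / v0%:A)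
     + (l2 * k1)%:A * (m2 / v0%:A) + (l2 * k2)%:A * (norm m2 / v0 / n0)%:A.
    rewrite !algM !algV normE /m1; field; by rewrite v0K n0K.
  have h l k x0 : OL l -> OL k -> OK x0 -> OK ((l * k)%:A * x0).
    by move=> Ol Ok Ox; apply: ringintM => //; apply/ringint_alg/ringintM.
  by apply: ringintD; [apply: ringintD; [apply: ringintD |] |]; apply: h => //; apply/ringint_alg.
- move=> x; have [u [v ->]] := K_coord x.
  exists ((u - v / v0 * u0) / n0), (v / v0); rewrite /m1 /m2 !algE.
  by field; rewrite v0K n0K.
- rewrite eD sqrrN exprMn [RHS]algM algX -hs.
  by case: s_sign => ->; rewrite ?sqrrN.
Qed.

Lemma ext_principal (x : L) : ideal_ext K (principal x) = principal x%:A.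
Proof.
apply/seteqP; split.
  apply: span_min; first exact: principal_submod.
  move=> _ [_ /principalE[c Oc ->] <-]; apply/principalE.
  by exists c%:A; [apply/ringint_alg | rewrite algM].
apply: span_min; first exact: span_submod.
by move=> _ ->; apply: span_in; exists x => //; exact: principal_mem.
Qed.

(** * Ramified primes *)

Definition ramified (pi : L) (P : set K) : Prop :=
  [/\ prime_ideal (principal pi), principal pi d, prime_ideal P
    & ideal_ext K (principal pi) = ideal_mul P P].

Section RamifiedPrime.
Variables (pi : L) (P : set K).
Hypothesis hr : ramified pi P.

Let hpi : prime_ideal (principal pi). Proof. by case: hr. Qed.
Let hpd : principal pi d. Proof. by case: hr. Qed.
Let hP : prime_ideal P. Proof. by case: hr. Qed.
Let hPP : ideal_ext K (principal pi) = ideal_mul P P. Proof. by case: hr. Qed.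
Let pi0 : pi != 0 := prime_elt_neq0 hpi.
Let piK : pi%:A != 0 :> K. Proof. by rewrite alg_eq0. Qed.
Let sP : submodule P := prime_submod hP.

Lemma OL_uniformizer : OL pi.
Proof. by apply: (prime_sub hpi); exact: principal_mem. Qed.

Lemma ramified_sqr : ideal_mul P P = principal pi%:A.
Proof. by rewrite -hPP ext_principal. Qed.

Lemma ramified_frac : frac_ideal P. Proof. by case: hP => [[]]. Qed.

Lemma ramified_mul2 x y : P x -> P y -> OK (x * y / pi%:A).
Proof.
by move=> Px Py; apply/(principal_div _ piK); rewrite -ramified_sqr; apply: ideal_mul_in.
Qed.

Lemma ramified_uniformizer : P pi%:A.
Proof.
have h : ideal_mul P P pi%:A by rewrite ramified_sqr; exact: principal_mem.
by move: h; apply: ideal_mul_min => // x y /(prime_sub hP) Ox; case: sP => _ _; apply.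
Qed.

Lemma ramified_alg l : OL l -> P l%:A <-> principal pi l.
Proof.
move=> Ol; split=> [Pl|/principalE[c Oc ->]].
  apply: (prime_sqr hpi Ol); apply/(principal_div _ pi0); rewrite -(ringint_alg K).
  by rewrite algM algV algX expr2; apply: ramified_mul2.
by rewrite algM; case: sP => _ _; apply; [apply/ringint_alg | exact: ramified_uniformizer].
Qed.

Lemma ramified_s : P s.
Proof. by apply: (prime_sqr hP); [exact: OK_s | rewrite hs; apply/ramified_alg => //; exact: OL_d]. Qed.

(** Such a difference is a multiple of [s], which is in [P]: conjugation acts trivially on the
    residue field. *)
Lemma ramified_diff x : OK x -> P (x - bar x).
Proof.
move=> Ox; have [v Ov ->] := OK_diff Ox.
by case: sP => _ _; apply; [apply/ringint_alg | exact: ramified_s].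
Qed.

Lemma ramified_bar x : P (bar x) <-> P x.
Proof.
suff h y : P y -> P (bar y) by split=> [/h|/h //]; rewrite barK.
move=> Py; have Oy := prime_sub hP Py.
by have := submodB sP Py (ramified_diff Oy); congr P; ring.
Qed.

Lemma ramified_conj : conj_ideal P = P.
Proof. by apply/seteqP; split=> x; rewrite conj_idealE ramified_bar. Qed.

Lemma ramified_ideal_norm : ideal_norm P pi.
Proof. by split; rewrite // ramified_conj ramified_sqr. Qed.

Lemma ramified_norm x : OK x -> P x <-> principal pi (norm x).
Proof.
move=> Ox; have Obx := OK_bar Ox; rewrite -ramified_alg ?normE; last exact: OL_norm.
split=> [Px|/(prime_mul hP Ox Obx)[//|/ramified_bar //]].
by rewrite mulrC; case: sP => _ _; apply.
Qed.

Lemma ramified_sub I n : submodule I -> I `<=` OK -> ideal_norm I n ->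
  I `<=` P <-> principal pi n.
Proof.
move=> sI IO hn; have On := ideal_norm_int sI IO hn.
split=> [IP|hpn x Ix].
  by apply/(ramified_alg On); apply: (IP); exact: ideal_norm_mem hn.
apply/ramified_norm; first exact: IO.
by rewrite -(divfK (proj1 hn) (norm x)); apply: primeM => //; apply: ideal_norm_norm_mem Ix.
Qed.

(** [P] has norm [pi], so multiplying [I] by the inverse of [P] lowers the exponent of [pi] in its
    norm by one; and [I] is contained in [P] exactly when this exponent is positive. *)
Lemma ramified_val I n k u : frac_ideal I -> I `<=` OK -> ideal_norm I n ->
  OL u -> ~ principal pi u -> n = pi ^+ k * u -> ideal_val P I = k.
Proof.
have dec i : ideal_exp P i.+1 `<=` ideal_exp P i.
  apply: ideal_mul_min; first exact: ideal_exp_submod.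
  by move=> x y /(prime_sub hP) Ox; case: (ideal_exp_submod P i) => _ _; apply.
have mono i j : (i <= j)%N -> ideal_exp P j `<=` ideal_exp P i.
  elim: j => [|j IH]; first by rewrite leqn0 => /eqP->.
  rewrite leq_eqVlt => /orP[/eqP-> //|/IH h] x /dec /h //.
move=> fI IO hn Ou nu en.
suff {I n fI IO hn en} h I n : frac_ideal I -> I `<=` OK -> ideal_norm I n ->
    n = pi ^+ k * u -> I `<=` ideal_exp P k /\ ~ (I `<=` ideal_exp P k.+1).
  have [h1 h2] := h I n fI IO hn en.
  (* The powers of [P] decrease, so at most one exponent meets both conditions of [ideal_val]. *)
  apply: xget_subset1 => [//|i j [i1 i2] [j1 j2]].
  by apply/eqP; rewrite eqn_leq; apply/andP; split; rewrite leqNgt; apply/negP => lt;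
    [apply: j2 | apply: i2] => x Ix; apply: (mono _ _ lt); auto.
elim: k I n => [|k IH] I n fI IO hn en; have sI := frac_submod fI.
  split=> //; rewrite /= ideal_mulr1 // => /(ramified_sub sI IO hn).
  by rewrite en mul1r.
have IP : I `<=` P.
  apply/(ramified_sub sI IO hn); rewrite en exprSr mulrAC.
  apply: primeM => //; last exact: principal_mem.
  by apply: ringintM => //; apply/ringintX/OL_uniformizer.
pose J := ideal_mul (ideal_inv P) I.
have fJ : frac_ideal J by apply: frac_mul => //; apply/frac_inv/ramified_frac.
have PJ : I = ideal_mul P J by rewrite ideal_mulVKl //; exact: ramified_frac.
have JO : J `<=` OK.
  rewrite -(ideal_mulVl ramified_frac); exact: ideal_mulS.
have hJ : ideal_norm J (pi ^+ k * u).
  have := ideal_normM (ideal_norm_inv ramified_frac ramified_ideal_norm) hn.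
  by rewrite en exprS -mulrA mulKf.
have [h1 h2] := IH J _ fJ JO hJ erefl.
split; first by rewrite PJ; apply: ideal_mulS.
move=> h; apply: h2; rewrite -(ideal_mulKl ramified_frac (ideal_exp_submod P k.+1)).
exact: ideal_mulS.
Qed.

Lemma odd_ideal_val I n : frac_ideal I -> I `<=` OK -> ideal_norm I n ->
  odd (ideal_val P I) = oddval pi n.
Proof.
move=> fI IO hn; have n0 := proj1 hn.
have On := ideal_norm_int (frac_submod fI) IO hn.
have [k [u [Ou nu en]]] := prime_power_decomp pid hpi On n0.
rewrite (ramified_val fI IO hn Ou nu en).
by rewrite (@oddvalE _ denL pid pi n 1 k u) ?oner_neq0 // expr1n mulr1.
Qed.

(** [x] is in [P], and [x s / pi] is an integer of norm [- (d / pi) (norm x / pi)], so it is in [P]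
    too. Multiplying once more by [s / pi] shows that [x (d / pi) / pi] is integral, and [d / pi] is
    prime to [pi]. *)
Lemma OK_div_uniformizer x : OK x -> OL (norm x / pi ^+ 2) -> OK (x / pi%:A).
Proof.
move=> Ox h; have pid' : OL (d / pi) by apply/(principal_div _ pi0).
have Px : P x.
  apply/ramified_norm => //; apply/(principal_div _ pi0).
  have := ringintM OL_uniformizer h; congr OL; field; exact: pi0.
have O1 := ramified_mul2 Px ramified_s.
have P1 : P (x * s / pi%:A).
  apply/ramified_norm => //; apply/(principal_div _ pi0).
  have := ringintM (ringintN pid') h; congr OL.
  apply: (@alg_inj _ K); rewrite !algE !normE !rmorphM fmorphV /= bar_alg bar_s -hs.
  by field.
have Od := squarefree_primeP hpi pid' d_squarefree.
have [u [v [Ou hv e]]] := prime_comax denL pid hpi pid' Od.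
have /(principal_div _ pi0) Ovp := hv.
have -> : x / pi%:A = u%:A * (x * s / pi%:A * s / pi%:A) + (v / pi)%:A * x.
  have e1 := congr1 (fun z => z%:A : K) e; rewrite !algE -hs in e1.
  rewrite -[LHS]mul1r; transitivity ((u%:A * (s ^+ 2 / pi%:A) + v%:A) * (x / pi%:A)).
    by rewrite e1 mul1r.
  by rewrite !algE; field.
apply: ringintD; apply: ringintM => //; try by apply/ringint_alg.
exact: ramified_mul2 P1 ramified_s.
Qed.

(* At a ramified prime [x / bar x] is [1] for units and [-1] for the
   uniformizer [s]. *)
Lemma ramified_ratio x : x != 0 ->
  exists y, [/\ OK y, ~ P y & x * bar y = (-1) ^+ oddval pi (norm x) * bar x * y].
Proof.
move=> x0; have pid' : OL (d / pi) by apply/(principal_div _ pi0).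
have Od := squarefree_primeP hpi pid' d_squarefree.
have H k z u : OK z -> OL u -> ~ principal pi u -> norm z = pi ^+ k * u -> exists y,
    [/\ OK y, ~ P y & z * bar y = (-1) ^+ odd k * bar z * y].
  elim: k z u => [|k IH] z u Oz Ou nu e.
    exists z; split=> //; last by rewrite /= expr0 mul1r mulrC.
    by move/(ramified_norm Oz); rewrite e mul1r.
  have Pz : P z.
    apply/(ramified_norm Oz)/(principal_div _ pi0); rewrite e exprS.
    have := ringintM (ringintX k OL_uniformizer) Ou; congr OL; field; exact: pi0.
  have Oz1 := ramified_mul2 Pz ramified_s.
  (* The factor [s / pi] lowers the exponent of [pi] in the norm by one, and divided by its
     conjugate it is [-1]: one sign per induction step. *)
  have [||||y [Oy nPy ey]] := IH (z * s / pi%:A) (- (u * (d / pi))) => //.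
  - by apply/ringintN/ringintM.
  - move=> h; apply: (not_principalM hpi Ou pid' nu Od).
    by rewrite -[X in principal _ X]opprK; apply: submodN => //; exact: principal_submod.
  - have -> : norm (z * s / pi%:A) = norm z * (- d) / pi ^+ 2.
      by rewrite -norm_s -norm_alg; apply: (@alg_inj _ K);
        rewrite !algE !normE !rmorphM fmorphV /= bar_alg; field.
    by rewrite e exprS; field; exact: pi0.
  exists y; split=> //; have s0 := s_neq0.
  apply: (@mulfI _ (s / pi%:A)); first by rewrite mulf_neq0 // invr_eq0.
  transitivity (z * s / pi%:A * bar y); first by ring.
  by rewrite ey !rmorphM fmorphV /= bar_alg bar_s signrN; ring.
have [m m0 [Om Omx]] := extension_denominators x.
have z0 : m%:A * x != 0 by rewrite mulf_neq0 // alg_eq0.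
have [k [u [Ou nu en]]] := prime_power_decomp pid hpi (OL_norm Omx) (norm_neq0 z0).
have [y [Oy nPy ey]] := H k _ u Omx Ou nu en; exists y; split=> //.
have -> : oddval pi (norm x) = odd k.
  apply: (@oddvalE _ denL pid pi _ m k u) => //; first exact: norm_neq0.
  by rewrite -en normM norm_alg mulrC.
apply: (@mulfI _ m%:A); first by rewrite alg_eq0.
by rewrite mulrA ey rmorphM /= bar_alg; ring.
Qed.

End RamifiedPrime.

(** * Divisibility by [s], ambiguous ideals and Hilbert 90 *)

Variables (tq : set L -> set K).
Hypothesis htq : forall q, prime_ideal q -> q d ->
  prime_ideal (tq q) /\ ideal_ext K q = ideal_mul (tq q) (tq q).

Lemma coprime_not_prime (q : set L) (x y : L) : prime_ideal q -> coprime_elts x y -> q y -> ~ q x.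
Proof.
move=> hq /coprime_eltsP[_ _ [u [v [Ou Ov e]]]] qy qx; apply: (prime_not1 hq).
by rewrite -e; have [_ qD qM] := prime_submod hq; apply: qD; apply: qM.
Qed.

Lemma ramified_gen q : prime_ideal q -> q d ->
  exists pi, q = principal pi /\ ramified pi (tq q).
Proof.
move=> hq qd; have [hP hPP] := htq hq qd; have [pi pi0 eq] := prime_gen pid hq.
by exists pi; split; rewrite // /ramified -eq.
Qed.

Lemma ramified_prime pi P : ramified pi P -> prime_ideal P.
Proof. by case. Qed.

(** Modulo [s], [x] is some [l] in [O_L], which then lies in every prime dividing [d]; as [d] is
    squarefree, it divides [l]. *)
Lemma mem_all_ramified x : OK x -> (forall q, prime_ideal q -> q d -> tq q x) -> OK (x / s).
Proof.
move=> Ox H; have [l Ol Oxl] := OK_mod_s Ox.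
suff Old : OL (l / d).
  have -> : x / s = (x - l%:A) / s + (l / d)%:A * s.
    by rewrite algM algV -hs; field; exact: s_neq0.
  by apply: ringintD => //; apply: ringintM; [apply/ringint_alg | exact: OK_s].
apply: (squarefree_mem denL pid OL_d d_neq0 d_squarefree Ol) => q hq qd.
have [pi [eq hr]] := ramified_gen hq qd; rewrite eq; apply/(ramified_alg hr Ol).
have -> : l%:A = x - (x - l%:A) / s * s by rewrite divfK ?s_neq0 //; ring.
have hP := ramified_prime hr.
apply: submodB (prime_submod hP) (H q hq qd) _.
by case: (prime_submod hP) => _ _; apply=> //; exact: ramified_s hr.
Qed.

(* A fractional ideal equal to its conjugate, with even valuation at the
   ramified primes, comes from [L]: normalised by [N :&: L = O_L], it lies
   between [O_K] and the inverse different, and [s N] has odd valuation. *)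
Lemma ambiguous_principal N n : frac_ideal N -> conj_ideal N = N -> ideal_norm N n ->
  (forall pi, prime_ideal (principal pi) -> principal pi d -> oddval pi n = false) ->
  exists2 l : L, l != 0 & N = principal l%:A.
Proof.
move=> fN cN hn ev.
have [_ _ NM] := frac_submod fN.
have [l l0 el] : exists2 l, l != 0 & [set u : L | N u%:A] = principal l.
  have [m [m0 Om Hm]] := frac_denominator fN.
  apply: pid; split=> /= [|x y hx hy|c x Oc||].
  - by rewrite alg0; case: fN.
  - by rewrite algD; case: fN => _ ND _ _ _; apply: ND.
  - by rewrite algM; apply: NM; apply/ringint_alg.
  - case: fN => _ _ _ [x Nx x0] _; have [k k0 [Ok Okx]] := extension_denominators (bar x).
    exists (k * norm x); last by rewrite mulf_neq0 ?norm_neq0.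
    have -> : (k * norm x)%:A = k%:A * bar x * x by rewrite algM normE; ring.
    exact: NM.
  - by exists m => // x /Hm; rewrite -algM ringint_alg.
exists l => //; have lK : l%:A != 0 :> K by rewrite alg_eq0.
have Nl : N l%:A by have : principal l l by [exact: principal_mem]; rewrite -el.
have fl : frac_ideal (principal (l^-1%:A : K)).
  by apply: frac_principal; rewrite // alg_eq0 invr_eq0.
pose X := ideal_mul (principal (s / l%:A)) N.
have sl0 : s / l%:A != 0 by rewrite mulf_neq0 ?invr_eq0 // s_neq0.
have fX : frac_ideal X by apply: frac_mul => //; apply: frac_principal.
have XE x : X x <-> N (x * l%:A / s).
  rewrite /X principal_mulE //; last exact: frac_submod.
  by rewrite invf_div mulrA.
have XO : X `<=` OK.
  move=> x /XE; set y := x * l%:A / s => Ny.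
  have ex : x = s * y / l%:A by rewrite /y; field; rewrite lK s_neq0.
  (* [N] is stable under conjugation, so the traces of its elements lie in its part in [L],
     generated by [l]. *)
  have tr z : N z -> OL (trace z / l).
    move=> Nz; apply/(principal_div _ l0); rewrite -el /= traceE.
    case: (fN) => _ ND _ _ _; apply: ND => //.
    by rewrite -(conj_idealE N) cN.
  have Ot : OK t by apply/OK_coord; exists 0, 1; rewrite alg0 alg1 mul1r add0r; split=> //;
    [exact: ringint0 | exact: ringint1].
  have h1 := tr _ Ny; have h2 := tr _ (NM _ _ Ot Ny).
  (* Two traces recover [y]: [trace (t y) - (bar t) (trace y) = (t - bar t) y]. *)
  have -> : x = s / (t - bar t) * ((trace (t * y) / l)%:A - bar t * (trace y / l)%:A).
    rewrite !algM !traceE algV rmorphM /= ex; field.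
    by rewrite lK bar_t_neq.
  have h : OK ((trace (t * y) / l)%:A - bar t * (trace y / l)%:A).
    apply: ringintB; first exact/ringint_alg.
    by apply: ringintM; [exact: OK_bar | apply/ringint_alg].
  by case: s_sign => ->; rewrite ?mulNr mulfV ?bar_t_neq // ?mulN1r ?mul1r //; apply: ringintN.
have hX : ideal_norm X (norm (s / l%:A) * n).
  by apply: ideal_normM hn; exact: ideal_norm_principal.
have OX := ideal_norm_int (frac_submod fX) XO hX.
(* The norm [- d n / l ^ 2] of [X] is integral and has odd valuation at every ramified prime, so [X]
   lies in all of them, hence in the ideal of [s]. *)
have Xs x : X x -> OK (x / s).
  move=> Xx; apply: mem_all_ramified; first exact: XO.
  move=> q hq qd; have [pi [eq hr]] := ramified_gen hq qd.
  suff: X `<=` tq q by apply.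
  apply/(ramified_sub hr (frac_submod fX) XO hX).
  have hpi : prime_ideal (principal pi) by rewrite -eq.
  have pid' : principal pi d by rewrite -eq.
  apply: (oddval_true_mem denL pid) => //.
  have /(principal_div _ (prime_elt_neq0 hpi)) Odp := pid'.
  have -> : norm (s / l%:A) * n = (pi * (- (d / pi))) * (n * l^-1 ^+ 2).
    rewrite normM -algV norm_alg norm_s; field; rewrite l0; exact: prime_elt_neq0 hpi.
  have n0 := proj1 hn; have pi0 := prime_elt_neq0 hpi.
  rewrite (oddvalM denL pid) ?mulf_neq0 ?oppr_eq0 ?mulf_neq0 ?expf_neq0 ?invr_eq0 ?d_neq0 //.
  rewrite (oddvalM denL pid hpi n0) ?expf_neq0 ?invr_eq0 // (oddval_sqr denL pid) ?invr_eq0 //.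
  rewrite ev // (oddval_uniformizer denL pid) //; first exact: ringintN.
  move=> h; apply: (squarefree_primeP hpi Odp d_squarefree).
  by rewrite -[X in principal _ X]opprK; apply: submodN => //; exact: principal_submod.
have e1 : N = ideal_mul (principal l%:A) (ideal_mul (principal l^-1%:A) N).
  by rewrite ideal_mulA principalM algV mulfV // principal1 ideal_mul1 //; exact: frac_submod.
rewrite e1.
suff -> : ideal_mul (principal l^-1%:A) N = OK.
  by rewrite ideal_mulr1; last exact: principal_submod.
have memE x : ideal_mul (principal l^-1%:A) N x <-> N (x * l%:A).
  rewrite principal_mulE; first by rewrite algV invrK.
    by rewrite alg_eq0 invr_eq0.
  exact: frac_submod.
apply: submod_eq1; first exact: ideal_mul_submod.
  move=> x /memE Nx; have /Xs : X (x * s) by apply/XE; congr N: Nx; field; exact: s_neq0.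
  by rewrite mulfK ?s_neq0.
by apply/memE; rewrite mul1r.
Qed.

(** For [J = O_K + bar N], both [bar J] and [N J] are [O_K + N], because [N (bar N) = O_K]. Scaling
    by [m] in [L] makes [J] integral and preserves the relation. *)
Lemma ideal_hilbert90 N : frac_ideal N -> ideal_mul N (conj_ideal N) = OK ->
  exists I, integral_ideal I /\ conj_ideal I = ideal_mul N I.
Proof.
move=> fN eN; have [N0 ND NM] := frac_submod fN.
pose J := [set z | exists x y, [/\ OK x, N (bar y) & z = x + y]].
have sJ : submodule J.
  split; first by exists 0, 0; rewrite rmorph0 addr0; split=> //; exact: ringint0.
  - move=> _ _ [x [y [Ox Ny ->]]] [x' [y' [Ox' Ny' ->]]]; exists (x + x'), (y + y').
    by rewrite rmorphD; split; [exact: ringintD | exact: ND | ring].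
  - move=> c _ Oc [x [y [Ox Ny ->]]]; exists (c * x), (c * y).
    by rewrite rmorphM mulrDr; split=> //; [exact: ringintM | apply: NM => //; exact: OK_bar].
have J1 : J 1 by exists 1, 0; rewrite rmorph0 addr0; split=> //; exact: ringint1.
have [m [m0 Om Hm]] := frac_denominator (conj_frac fN).
have mJ x : J x -> OK (m%:A * x).
  move=> [y [z [Oy Nz ->]]]; rewrite mulrDr; apply: ringintD.
    by apply: ringintM => //; apply/ringint_alg.
  by apply: Hm; apply/conj_idealE.
have mK : m%:A != 0 :> K by rewrite alg_eq0.
have fJ : frac_ideal J.
  case: sJ => J0 JD JM; split=> //; first by exists 1; rewrite ?oner_neq0.
  by exists m%:A.
have eJ : conj_ideal J = ideal_mul N J.
  apply/seteqP; split.
    move=> z /conj_idealE[x [y [Ox Ny ez]]]; have [_ D _] := ideal_mul_submod N J.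
    have {ez}-> : z = bar y + bar x by rewrite -[z]barK ez rmorphD addrC.
    apply: D; first by rewrite -[bar y]mulr1; apply: ideal_mul_in.
    have : ideal_mul N (conj_ideal N) (bar x) by rewrite eN; exact: OK_bar.
    apply: ideal_mulS => // w /conj_idealE Nw.
    by exists 0, w; rewrite add0r; split=> //; exact: ringint0.
  apply: ideal_mul_min; first exact: conj_submod.
  move=> n _ Nn [x [y [Ox Ny ->]]]; apply/conj_idealE; exists (bar n * bar y), (bar n * bar x).
  split; [|rewrite rmorphM /= !barK mulrC; exact: NM | by rewrite rmorphM rmorphD /=; ring].
  by rewrite -eN mulrC; apply: ideal_mul_in => //; apply/conj_idealE; rewrite barK.
exists (ideal_mul (principal m%:A) J); split; last first.
  by rewrite conj_mul eJ conj_principal bar_alg ideal_mulCA.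
split; first by apply: frac_mul => //; apply: frac_principal.
apply: ideal_mul_min => [|x y /principalE[k Ok ->] Jy]; first exact: submod_ringint.
by rewrite -mulrA; apply: ringintM => //; apply: mJ.
Qed.

(* The product of the ramified primes dividing [y]. *)
Lemma ramified_product y : OL y -> y != 0 -> OL (d / y) ->
  exists E, [/\ integral_ideal E, conj_ideal E = E & ideal_norm E y].
Proof.
move=> Oy y0 Ody; pose E : set K := ideal_span [set y%:A; s]; have yK : y%:A != 0 :> K by rewrite alg_eq0.
have sE : submodule E := span_submod _.
have Ey : E y%:A by apply: span_in; left.
have Es : E s by apply: span_in; right.
have EO : E `<=` OK.
  apply: span_min => [|_ [] ->]; [exact: submod_ringint | exact/ringint_alg | exact: OK_s].
have conjE : conj_ideal E = E.
  have h : conj_ideal E `<=` E.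
    move=> x /conj_idealE; rewrite -{2}[x]barK; move: (bar x) => z /span2P[c1 [c2 [O1 O2 ->]]].
    rewrite rmorphD !rmorphM /= bar_alg bar_s mulrN -mulNr; apply/span2P.
    by exists (bar c1), (- bar c2); split; rewrite //; try apply: ringintN; exact: OK_bar.
  by apply/seteqP; split=> //; rewrite -[X in X `<=` _]conj_idealK; apply: conj_ideal_sub.
exists E; split=> //.
  split=> //; have [h1 h2 h3] := sE; split=> //; first by exists s; rewrite ?s_neq0.
  by exists 1; rewrite ?oner_neq0 // => x /EO; rewrite mul1r.
split=> //; rewrite conjE; apply/seteqP; split.
  apply: ideal_mul_min; first exact: principal_submod.
  move=> _ _ /span2P[c1 [c2 [O1 O2 ->]]] /span2P[k1 [k2 [Ok1 Ok2 ->]]].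
  apply/(principal_div _ yK).
  have -> : (c1 * y%:A + c2 * s) * (k1 * y%:A + k2 * s) / y%:A
    = c1 * k1 * y%:A + (c1 * k2 + c2 * k1) * s + c2 * k2 * (d / y)%:A.
    by rewrite algM algV -hs; field.
  have OKy : OK y%:A by apply/ringint_alg.
  have OKdy : OK (d / y)%:A by apply/ringint_alg.
  have Os := OK_s.
  by do ![apply: ringintD]; apply: ringintM => //; try apply: ringintD; apply: ringintM.
apply: span_min => [|_ ->]; first exact: ideal_mul_submod.
(* [E ^ 2] contains [y ^ 2] and [s ^ 2 = d]; since [y] is prime to [d / y], it is a combination of
   the two. *)
have /coprime_eltsP[_ _ [u [v [Ou Ov e]]]] :=
  squarefree_coprime denL pid OL_d d_neq0 d_squarefree Oy Ody y0.
have -> : y%:A = u%:A * (y%:A * y%:A) + v%:A * (s * s).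
  rewrite -expr2 -[s * s]expr2 hs -!algX -!algM -algD; congr (_%:A).
  by rewrite -[LHS]mul1r -e; field.
have [_ D M] := ideal_mul_submod E E.
by apply: D; apply: M; try apply/ringint_alg => //; apply: ideal_mul_in.
Qed.

(** * Gluing maps *)

Variables (alpha0 c0 : L) (lamq : set L -> L).
Hypothesis hcop : coprime_elts alpha0 d.
Hypothesis hcop_c : coprime_elts c0 d.
Hypothesis alpha0_neq0 : alpha0 != 0.
Hypothesis hlamq : forall q, prime_ideal q -> q d -> OL (lamq q) /\ q (lamq q ^+ 2 - c0).

Let Oalpha0 : OL alpha0. Proof. by case/coprime_eltsP: hcop. Qed.

(** These will be the lattices of the [s beta], for [[alpha, beta]] in a superspecial order
    containing [O_K]. *)
Definition beta_lattice M := frac_ideal M /\ ideal_norm M alpha0^-1.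

(* No ramified prime [pi] divides the generator [lam0]: otherwise [lam0 * y] has
   norm divisible by [pi ^+ 2], hence is divisible by [pi], for all [y] in [M]. *)
Lemma lattice_multiplier M : beta_lattice M -> exists lam0,
  [/\ OL lam0, lam0 != 0, coprime_elts lam0 d,
      forall l, (forall y, M y -> OK (l%:A * y)) <-> OL (l / lam0)
    & M (lam0 / alpha0)%:A /\ forall y, M y -> exists x m,
        [/\ OK x, M m & y = x * (lam0 / alpha0)%:A + d%:A * m]].
Proof.
move=> [fM hM]; have sM := frac_submod fM; have [M0 MD MM] := sM.
have nM y : M y -> OL (norm y * alpha0).
  by move=> My; have := ideal_norm_norm_mem hM My; rewrite invrK.
(* [alpha0^-1] is in [M (bar M)], and [l] sends [bar M] into the integers. *)
have Minv (l : L) : (forall y, M y -> OK (l%:A * y)) -> M (l / alpha0)%:A.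
  move=> Hl; have : ideal_mul M (conj_ideal M) (alpha0^-1)%:A.
    by case: hM => _ ->; exact: principal_mem.
  rewrite algM; move: (alpha0^-1)%:A.
  apply: ideal_mul_min; first exact: submod_preim.
  move=> x y Mx /conj_idealE My /=; rewrite mulrCA mulrC; apply: MM => //.
  by have := OK_bar (Hl _ My); rewrite rmorphM /= bar_alg barK.
have Ol (l : L) : (forall y, M y -> OK (l%:A * y)) -> OL l.
  move=> Hl; apply: ringint_sqr; rewrite -(ringint_alg K).
  have -> : (l ^+ 2)%:A = alpha0%:A * (l%:A * (l / alpha0)%:A) :> K.
    by rewrite !algE; field; rewrite alg_eq0.
  by apply: ringintM; [apply/ringint_alg | apply/Hl/Minv].
have [lam0 lam00 elam] : exists2 x, x != 0 &
    [set l : L | forall y, M y -> OK (l%:A * y)] = principal x.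
  apply: pid; split=> /=.
  - by move=> y My; rewrite alg0 mul0r; exact: ringint0.
  - by move=> x y hx hy z Mz; rewrite algD mulrDl; apply: ringintD; auto.
  - by move=> c x Oc hx y My; rewrite algM -mulrA; apply: ringintM; [apply/ringint_alg | auto].
  - by have [m [m0 _ Hm]] := frac_denominator fM; exists m.
  - by exists 1; [exact: oner_neq0 | move=> x hx; rewrite mul1r; exact: Ol].
have Hlam l : (forall y, M y -> OK (l%:A * y)) <-> OL (l / lam0).
  rewrite -(principal_div _ lam00) -elam; split; apply.
have H0 : forall y, M y -> OK (lam0%:A * y).
  by apply/Hlam; rewrite mulfV //; exact: ringint1.
have Olam0 := Ol _ H0.
have clam : coprime_elts lam0 d.
  apply: coprime_elts_sym.
  apply: (coprime_unitP denL pid OL_d d_neq0 Olam0) => q hq qd.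
  have [pi [eq hr]] := ramified_gen hq qd; have hpi : prime_ideal (principal pi) by rewrite -eq.
  have pi0 := prime_elt_neq0 hpi.
  rewrite eq => /(principal_div _ pi0) Olp.
  have npa : ~ principal pi alpha0.
    by apply: (coprime_not_prime hpi hcop); rewrite -eq.
  suff : OL (lam0 / pi / lam0).
    rewrite mulrAC mulfV // mul1r.
    by apply: (prime_notunit hpi pi0); exact: principal_mem.
  apply/Hlam => y My; rewrite algM algV mulrAC.
  apply: (OK_div_uniformizer hr); first exact: H0.
  have ON := OL_norm (H0 _ My).
  have e : norm (lam0%:A * y) * alpha0 = (lam0 / pi) ^+ 2 * (norm y * alpha0) * pi ^+ 2.
    by rewrite normM norm_alg; field.
  have h0 : OL ((lam0 / pi) ^+ 2 * (norm y * alpha0)).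
    by apply: ringintM; [exact: ringintX | exact: nM].
  have Opi := OL_uniformizer hr.
  (* [alpha0] is prime to [d], so it can be cancelled modulo [pi]; this is done for the two factors
     [pi] in turn. *)
  have st x : OL x -> OL (x * alpha0 / pi) -> OL (x / pi).
    move=> Ox Oxa; have : principal pi (x * alpha0) by apply/(principal_div _ pi0).
    by case/(prime_mul hpi Ox Oalpha0) => // /(principal_div _ pi0).
  have h1 : OL (norm (lam0%:A * y) / pi).
    apply: st => //; rewrite e; have := ringintM h0 Opi; congr OL; field; exact: pi0.
  rewrite expr2 invfM mulrA; apply: st => //.
  have := h0; congr OL.
  by transitivity (norm (lam0%:A * y) * alpha0 / pi ^+ 2); [rewrite e; field | field].
exists lam0; split=> //; split; first exact: Minv.
(* The relation [f lam0 ^ 2 + g d = 1] splits [y]: its first part is [f alpha0 (lam0 y)] times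
   [lam0 / alpha0]. *)
have [f [g [Of Og efg]]] := coprime_elts_sqr clam.
move=> y My; exists ((f * alpha0)%:A * (lam0%:A * y)), (g%:A * y); split.
- by apply: ringintM; [apply/ringint_alg/ringintM | exact: H0].
- by apply: MM => //; apply/ringint_alg.
- have e1 := congr1 (fun z => z%:A : K) efg; rewrite !algE in e1.
  rewrite -[LHS]mul1r; transitivity ((f%:A * lam0%:A ^+ 2 + g%:A * d%:A) * y).
    by rewrite e1 mul1r.
  by rewrite !algE; field; rewrite alg_eq0.
Qed.

Lemma lamq_not_mem q : prime_ideal q -> q d -> ~ q (lamq q).
Proof.
move=> hq qd ql; have [Ol ql2] := hlamq hq qd.
apply: (coprime_not_prime hq hcop_c qd).
have := submodB (prime_submod hq) (primeM hq Ol ql) ql2; congr q; ring.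
Qed.

(** [e] is left arbitrary to cover both the valuations of an ideal and booleans recording the signs
    of a given square root of [c0]. *)
Definition sign_congruence (e : set L -> nat) lam :=
  forall q, prime_ideal q -> q d -> q (lam - (-1) ^+ e q * lamq q).

Lemma OL_sign n : OL ((-1) ^+ n).
Proof. by apply/ringintX/ringintN/ringint1. Qed.

Lemma sign_congruence_sqr e lam : OL lam -> sign_congruence e lam ->
  OL ((lam ^+ 2 - c0) / d).
Proof.
move=> Olam H; have Oc : OL c0 by case/coprime_eltsP: hcop_c.
apply: (squarefree_mem denL pid OL_d d_neq0 d_squarefree).
  by apply: ringintB => //; exact: ringintX.
move=> q hq qd; have [Ol ql2] := hlamq hq qd; have [_ qD qM] := prime_submod hq.
have -> : lam ^+ 2 - c0 =
    (lam + (-1) ^+ e q * lamq q) * (lam - (-1) ^+ e q * lamq q) + (lamq q ^+ 2 - c0).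
  have : ((-1) ^+ e q) ^+ 2 = 1 :> L by exact: sqrr_sign.
  move=> e1; transitivity
    (lam ^+ 2 - ((-1) ^+ e q) ^+ 2 * lamq q ^+ 2 + (lamq q ^+ 2 - c0)); last by ring.
  by rewrite e1; ring.
apply: qD => //; apply: qM (H q hq qd).
by apply: ringintD => //; apply: ringintM => //; exact: OL_sign.
Qed.

Lemma sign_congruence_coprime e lam : OL lam -> sign_congruence e lam -> coprime_elts lam d.
Proof.
move=> Olam H; apply: coprime_elts_sym.
apply: (coprime_unitP denL pid OL_d d_neq0 Olam) => q hq qd qlam.
apply: (lamq_not_mem hq qd).
have [Ol _] := hlamq hq qd; have [_ qD qM] := prime_submod hq.
have h := submodB (prime_submod hq) qlam (H q hq qd).
have := qM _ _ (OL_sign (e q)) h; congr q.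
by rewrite opprB addrC subrK mulrA -expr2 sqrr_sign mul1r.
Qed.

(** Multiples [lam0 mu] of the generator from [lattice_multiplier] keep [M] integral; as [lam0] is
    invertible modulo [d], the Chinese remainder theorem finds [mu]. *)
Lemma sign_congruence_exists M e : beta_lattice M ->
  exists lam, [/\ coprime_elts lam d, sign_congruence e lam
    & forall y, M y -> OK (lam%:A * y)].
Proof.
move=> hM; have [lam0 [O0 n0 c1 Hl _]] := lattice_multiplier hM.
have [r Hr] : exists r : set L -> L, forall q, prime_ideal q -> q d ->
    OL (r q) /\ q (lam0 * r q - (-1) ^+ e q * lamq q).
  suff /choice[r Hr] : forall q : set L, exists x, prime_ideal q -> q d ->
    OL x /\ q (lam0 * x - (-1) ^+ e q * lamq q) by exists r.
  move=> q; have [[hq qd]|nh] := pselect (prime_ideal q /\ q d); last first.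
    by exists 0 => hq qd; case: nh.
  have nl := coprime_not_prime hq c1 qd.
  have [u [v [Ou qv euv]]] := prime_comax denL pid hq O0 nl.
  have [Ol _] := hlamq hq qd.
  exists ((-1) ^+ e q * lamq q * u) => _ _; split.
    by apply: ringintM => //; apply: ringintM => //; exact: OL_sign.
  have -> : lam0 * ((-1) ^+ e q * lamq q * u) - (-1) ^+ e q * lamq q
    = - ((-1) ^+ e q * lamq q * v).
    have -> : v = 1 - u * lam0 by rewrite -euv; ring.
    by ring.
  apply: submodN; first exact: prime_submod.
  by apply: primeM => //; apply: ringintM => //; exact: OL_sign.
have [|mu Omu Hmu] := chinese_remainder denL pid (r := r) OL_d d_neq0.
  by move=> q hq qd; case: (Hr q hq qd).
have S : sign_congruence e (lam0 * mu).
  move=> q hq qd; have [_ qD qM] := prime_submod hq; have [_ h] := Hr q hq qd.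
  by have := qD _ _ (qM _ _ O0 (Hmu q hq qd)) h; congr q; ring.
exists (lam0 * mu); split=> //.
  by apply: sign_congruence_coprime S => //; exact: ringintM.
by apply/Hl; rewrite mulrAC mulfV // mul1r.
Qed.

(** The product [(lam - lamq q) (lam + lamq q)] is in the prime [q]; [bad q] records that its first
    factor is not. *)
Lemma sqr_sign_congruence lam : OL lam -> OL ((lam ^+ 2 - c0) / d) ->
  exists bad : set L -> bool, sign_congruence bad lam.
Proof.
move=> Olam h; exists (fun q => ~~ `[< q (lam - lamq q) >]) => q hq qd.
have [Ol qlc] := hlamq hq qd.
case: asboolP => [hh|nh] /=; first by rewrite expr0 mul1r.
rewrite expr1 mulN1r opprK.
have : q ((lam - lamq q) * (lam + lamq q)).
  have h1 : q (lam ^+ 2 - c0) by rewrite -(divfK d_neq0 (lam ^+ 2 - c0)); apply: primeM.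
  by have := submodB (prime_submod hq) h1 qlc; congr q; ring.
by case/(prime_mul hq (ringintB Olam Ol) (ringintD Olam Ol)).
Qed.

(** Distinct signs differ by [2] up to sign, and [2 lamq] is a unit modulo [pi] because [2] and [c0]
    are prime to [d]. *)
Lemma sign_lamq_mem pi (m n : nat) : prime_ideal (principal pi) -> principal pi d ->
  principal pi (((-1) ^+ m - (-1) ^+ n) * lamq (principal pi)) <-> odd m = odd n.
Proof.
move=> hpi pid'; have [Ol _] := hlamq hpi pid'.
rewrite -(signr_odd L m) -(signr_odd L n).
have n2 : ~ principal pi (2 : L).
  exact: (coprime_not_prime hpi (coprime_elts_sym hd2)).
have n2l : ~ principal pi (2 * lamq (principal pi)).
  apply: (not_principalM hpi) => //; first exact: ringint_nat.
  exact: lamq_not_mem.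
case: (odd m) (odd n) => [] []; rewrite ?expr0 ?expr1 ?subrr ?mul0r.
- by split=> // _; case: (principal_submod pi).
- split=> // h; case: n2l; have := submodN (principal_submod pi) h; congr principal.
  by ring.
- split=> // h; case: n2l; move: h; congr principal; ring.
- by split=> // _; case: (principal_submod pi).
Qed.

(* Modulo [d M] the lattice is generated by [lam0 / alpha0], and [mu / bar mu]
   reduces to a sign at each ramified prime. *)
Lemma gluing_sign M lam lam' e e' mu : beta_lattice M -> mu != 0 ->
  OL lam -> OL lam' ->
  sign_congruence e lam -> sign_congruence e' lam' ->
  (forall y, M y -> OK (lam%:A * y)) ->
  (forall y, M y -> OK (lam'%:A * (mu / bar mu * y))) ->
  (forall y, M y -> OK ((lam%:A - lam'%:A * (mu / bar mu)) * y / s)) <->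
  (forall pi, prime_ideal (principal pi) -> principal pi d ->
     odd (e (principal pi)) = odd (e' (principal pi)) (+) oddval pi (norm mu)).
Proof.
move=> hM mu0 Olam Olam' S S' h h'.
have [lam0 [O0 n0 c1 Hl [M0 Mgen]]] := lattice_multiplier hM.
set k := mu / bar mu in h' *; set y0 := (lam0 / alpha0)%:A in M0 Mgen.
pose z := (lam%:A - lam'%:A * k) * y0.
have Okap y : M y -> OK ((lam%:A - lam'%:A * k) * y).
  by move=> My; rewrite mulrBl -mulrA; apply: ringintB; [apply: h | apply: h'].
have Oz : OK z by exact: Okap.
(* [y0] generates [M] modulo [d M] and [d = s ^ 2], so divisibility by [s] has to be tested on [z]
   only. *)
transitivity (forall q, prime_ideal q -> q d -> tq q z).
  split=> [H q hq qd|H y My].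
    have [pi [eq hr]] := ramified_gen hq qd; have hP := ramified_prime hr.
    rewrite -(divfK s_neq0 z); apply: primeM => //; last exact: ramified_s hr.
    exact: H.
  have [x [m [Ox Mm ->]]] := Mgen y My.
  have -> : (lam%:A - lam'%:A * k) * (x * y0 + d%:A * m) / s
    = x * (z / s) + s * ((lam%:A - lam'%:A * k) * m).
    by rewrite -hs /z; field; exact: s_neq0.
  apply: ringintD; apply: ringintM => //; [exact: mem_all_ramified | exact: OK_s | exact: Okap].
have key pi : prime_ideal (principal pi) -> principal pi d ->
    tq (principal pi) z <->
    odd (e (principal pi)) = odd (e' (principal pi)) (+) oddval pi (norm mu).
  move=> hpi pid'.
  have hr : ramified pi (tq (principal pi)).
    by have [hP hPP] := htq hpi pid'; split.
  have hP := ramified_prime hr; have [_ PD PM] := prime_submod hP.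
  set P := tq _ in hr hP PD PM *.
  have [y [Oy nPy ey]] := ramified_ratio hr mu0.
  set o := oddval _ _ in ey *.
  have bmu0 : bar mu != 0 by rewrite fmorph_eq0.
  have y0' : bar y != 0.
    rewrite fmorph_eq0; apply/eqP => yz; apply: nPy; rewrite yz.
    by case: (prime_submod hP).
  have [sg esg] : exists sg : L, sg = (-1) ^+ o by exists ((-1) ^+ o).
  have ek : k * bar y = sg%:A * y.
    by rewrite /k mulrAC ey mulrAC mulfK // esg algX algN alg1.
  have nPby : ~ P (bar y) by move/(ramified_bar hr).
  have npa : ~ P alpha0%:A.
    by move/(ramified_alg hr Oalpha0); exact: (coprime_not_prime hpi hcop).
  have npl : ~ P lam0%:A.
    by move/(ramified_alg hr O0); exact: (coprime_not_prime hpi c1).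
  have OKl (l : L) : OL l -> OK l%:A by move=> ?; apply/ringint_alg.
  have Osig : OL sg by rewrite esg; exact: OL_sign.
  have Obig : OL (lam - sg * lam') by apply: ringintB => //; exact: ringintM.
  (* As [k (bar y) = sg y], and [bar y] is [y] modulo [P], this compares [z] with [lam - sg lam'] up
     to factors prime to [P]. *)
  have e1 : z * bar y * alpha0%:A =
     (lam - sg * lam')%:A * y * lam0%:A - lam%:A * lam0%:A * (y - bar y).
    rewrite /z /y0 !algE.
    transitivity (((lam%:A * bar y) - lam'%:A * (k * bar y)) * lam0%:A).
      by field; rewrite alg_eq0.
    by rewrite ek; ring.
  have Py := ramified_diff hr Oy.
  have nm x w : OK x -> OK w -> ~ P w -> P (x * w) <-> P x.
    move=> Ox Ow nw; split; first by case/(prime_mul hP Ox Ow).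
    by rewrite mulrC; apply: PM.
  have s1 : P z <-> P (z * bar y * alpha0%:A).
    have Oby := OK_bar Oy.
    by rewrite (nm _ _ (ringintM Oz Oby) (OKl _ Oalpha0) npa) (nm _ _ Oz Oby nPby).
  have s2 : P (z * bar y * alpha0%:A) <-> P ((lam - sg * lam')%:A * y * lam0%:A).
    rewrite e1; have hh : P (lam%:A * lam0%:A * (y - bar y)).
      by apply: PM => //; apply: ringintM; apply: OKl.
    split=> [h1|h1]; last exact: submodB (prime_submod hP) h1 hh.
    by have := PD _ _ h1 hh; rewrite subrK.
  have OA := OKl _ Obig.
  rewrite s1 s2 (nm _ _ (ringintM OA Oy) (OKl _ O0) npl) (nm _ _ OA Oy nPy).
  rewrite (ramified_alg hr Obig).
  have [qs0 qD qM] := principal_submod pi.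
  have hh : principal pi ((lam - (-1) ^+ e (principal pi) * lamq (principal pi))
      - sg * (lam' - (-1) ^+ e' (principal pi) * lamq (principal pi))).
    apply: submodB => //; first exact: S.
    by apply: qM => //; exact: S'.
  have -> : (odd (e (principal pi)) = odd (e' (principal pi)) (+) o) =
     (odd (e (principal pi)) = odd (o + e' (principal pi))%N).
    by rewrite oddD oddb addbC.
  rewrite -(sign_lamq_mem _ _ hpi pid') exprD -esg.
  have [s1' es1] : exists x : L, x = (-1) ^+ e (principal pi) by eexists.
  have [s2' es2] : exists x : L, x = (-1) ^+ e' (principal pi) by eexists.
  rewrite -es1 -es2 in hh *.
  split=> h1; [have := submodB (principal_submod pi) h1 hh | have := qD _ _ h1 hh];
    congr principal; ring.
split=> [H pi hpi pid'|H q hq qd].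
  by apply/(key pi hpi pid'); exact: H.
have [pi [eq hr]] := ramified_gen hq qd; have hpi : prime_ideal (principal pi) by rewrite -eq.
have pid' : principal pi d by rewrite -eq.
by rewrite eq; apply/(key pi hpi pid'); exact: H.
Qed.

(** * Orders containing the integers of the quadratic field *)

Variables (B : falgType L) (theta : {rmorphism B -> 'M[K]_2}).
Local Notation C := (c0%:A : K).
Hypothesis htheta : matrix_identification bar C theta.

Definition quat alpha beta : B := xget 0 [set x | theta x = qmx bar C alpha beta].

Lemma quatE alpha beta : theta (quat alpha beta) = qmx bar C alpha beta.
Proof.
apply: (@xgetPex _ 0 [set x | theta x = qmx bar C alpha beta]).
have [_ _ e] := htheta.
have : [set M | exists alpha beta, M = qmx bar C alpha beta] (qmx bar C alpha beta).
  by exists alpha, beta.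
by rewrite -e => -[x _ ex]; exists x.
Qed.

Lemma theta_inj : injective theta. Proof. by case: htheta. Qed.

Lemma qmx_inj alpha beta alpha' beta' :
  qmx bar C alpha beta = qmx bar C alpha' beta' -> alpha = alpha' /\ beta = beta'.
Proof. by move/matrixP => e; have := e 0 0; have := e 0 1; rewrite !mxE. Qed.

Lemma quat_inj alpha beta alpha' beta' :
  quat alpha beta = quat alpha' beta' -> alpha = alpha' /\ beta = beta'.
Proof. by move/(congr1 theta); rewrite !quatE => /qmx_inj. Qed.

Lemma quat_eq x alpha beta : theta x = qmx bar C alpha beta -> x = quat alpha beta.
Proof. by move=> e; apply: theta_inj; rewrite quatE. Qed.

Lemma quat_surj x : exists alpha beta, x = quat alpha beta.
Proof.
have [_ _ e] := htheta; have : range theta (theta x) by exists x.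
by rewrite e => -[alpha [beta ex]]; exists alpha, beta; apply: quat_eq.
Qed.

Lemma ord2_ind (P : 'I_2 -> Prop) : P 0 -> P 1 -> forall i, P i.
Proof.
move=> P0 P1 [[|[|//]] h]; [move: P0 | move: P1]; congr P; exact: val_inj.
Qed.

Lemma quatD alpha beta alpha' beta' :
  quat alpha beta + quat alpha' beta' = quat (alpha + alpha') (beta + beta').
Proof.
apply: quat_eq; rewrite rmorphD !quatE; apply/matrixP => i j; rewrite !mxE.
by elim/ord2_ind: i; elim/ord2_ind: j; rewrite /= ?rmorphD ?mulrDr.
Qed.

Lemma quatM alpha beta alpha' beta' :
  quat alpha beta * quat alpha' beta' =
  quat (alpha * alpha' + C * beta * bar beta') (alpha * beta' + beta * bar alpha').
Proof.
apply: quat_eq; rewrite rmorphM !quatE; apply/matrixP => i j.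
rewrite !mxE !big_ord_recl big_ord0 !mxE /=.
by elim/ord2_ind: i; elim/ord2_ind: j;
  rewrite /= ?rmorphD ?rmorphM /= ?bar_alg ?barK; ring.
Qed.

Lemma quatZ l alpha beta : l *: quat alpha beta = quat (l%:A * alpha) (l%:A * beta).
Proof.
apply: quat_eq; have [hZ _ _] := htheta; rewrite hZ !quatE.
apply/matrixP => i j; rewrite !mxE.
by elim/ord2_ind: i; elim/ord2_ind: j; rewrite /= ?rmorphM /= ?bar_alg //; ring.
Qed.

Lemma quat1 : quat 1 0 = 1.
Proof.
apply/esym/quat_eq; rewrite rmorph1; apply/matrixP => i j; rewrite !mxE.
by elim/ord2_ind: i; elim/ord2_ind: j; rewrite /= ?rmorph0 ?rmorph1 ?mulr0.
Qed.

Lemma quat0 : quat 0 0 = 0.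
Proof. by have := quatZ 0 1 0; rewrite scale0r alg0 !mul0r. Qed.

Lemma reduced_trace_quat alpha beta : reduced_trace theta (quat alpha beta) = alpha + bar alpha.
Proof. by rewrite /reduced_trace quatE /mxtrace !big_ord_recl big_ord0 !mxE /= addr0. Qed.

Lemma embedsE alpha x : embeds theta bar C alpha x <-> x = quat alpha 0.
Proof. by split=> [/quat_eq //|->]; rewrite /embeds quatE. Qed.

Lemma quatV mu : mu != 0 -> (quat mu 0)^-1 = quat mu^-1 0.
Proof.
move=> mu0; have e1 : quat mu 0 * quat mu^-1 0 = 1.
  by rewrite quatM rmorph0 !mulr0 !mul0r !addr0 mulfV // quat1.
have e2 : quat mu^-1 0 * quat mu 0 = 1.
  by rewrite quatM rmorph0 !mulr0 !mul0r !addr0 mulVf // quat1.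
have u : quat mu 0 \is a GRing.unit by apply/unitrP; exists (quat mu^-1 0).
by apply: (mulrI u); rewrite mulrV.
Qed.

Lemma quat_conjugate mu alpha beta : mu != 0 ->
  quat mu 0 * quat alpha beta * (quat mu 0)^-1 = quat alpha (mu / bar mu * beta).
Proof.
move=> mu0; rewrite quatV // !quatM rmorph0 !mulr0 !mul0r !addr0 add0r fmorphV.
by congr quat; [field | rewrite mulrAC].
Qed.

(* R(a, lam) is [glue M lam] for the lattice M = A^-1 a^-1 \bar a. *)
Definition glue M (lam : L) : set B :=
  [set x | exists alpha beta, [/\ x = quat alpha beta, M (s * beta) & OK (alpha - lam%:A * beta)]].

Lemma glueE M lam alpha beta :
  glue M lam (quat alpha beta) <-> M (s * beta) /\ OK (alpha - lam%:A * beta).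
Proof.
by split=> [[a' [b' [/quat_inj[-> ->]]]]|[h1 h2]] //; exists alpha, beta.
Qed.

(** Conjugation by [mu] fixes [alpha] and multiplies [beta] by [mu / bar mu]. The two conditions on
    the right compare the lattices, then the gluing maps modulo [O_K]. *)
Lemma K_conjugate_glue M M' lam lam' : submodule M ->
  K_conjugate theta bar C (glue M lam) (glue M' lam') <->
  exists mu, [/\ mu != 0, forall x, M' x <-> M (x * bar mu / mu)
    & forall y, M y -> OK ((lam%:A - lam'%:A * (mu / bar mu)) * y / s)].
Proof.
move=> sM; have s0 := s_neq0.
split=> [[mu [x [mu0 /embedsE-> e]]]|[mu [mu0 eM el]]].
  have bmu0 := bar_neq0 mu0.
  have h alpha beta : glue M' lam' (quat alpha (mu / bar mu * beta)) <-> glue M lam (quat alpha beta).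
    rewrite e; split=> [[y hy]|hy]; last by exists (quat alpha beta); rewrite ?quat_conjugate.
    have [a' [b' ey]] := quat_surj y; rewrite ey in hy *.
    rewrite quat_conjugate // => /quat_inj[e1 /mulfI e2]; rewrite -e1 -e2 //.
    by rewrite mulf_neq0 ?invr_eq0.
  have hk x' : M' x' <-> M (x' * bar mu / mu).
    (* Taking [alpha] equal to the gluing multiplier times [beta] satisfies the gluing condition
       trivially, so that only the lattice is tested. *)
    have h' := h (lam'%:A * (mu / bar mu * (x' * bar mu / mu / s))) (x' * bar mu / mu / s).
    have h'' := h (lam%:A * (x' * bar mu / mu / s)) (x' * bar mu / mu / s).
    have ex : s * (mu / bar mu * (x' * bar mu / mu / s)) = x' by field; rewrite bmu0 mu0 s0.
    have ex' : s * (x' * bar mu / mu / s) = x' * bar mu / mu by rewrite mulrC divfK.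
    rewrite !glueE ex ex' !subrr in h' h''; have O0 := ringint0 K.
    by split=> H; [case: (proj1 h' (conj H O0)) | case: (proj2 h'' (conj H O0))].
  exists mu; split=> // y My.
  have : glue M' lam' (quat (lam%:A * (y / s)) (mu / bar mu * (y / s))).
    by apply/h/glueE; rewrite subrr mulrC divfK //; split=> //; exact: ringint0.
  by case/glueE => _; congr OK; ring.
exists mu, (quat mu 0); split=> //; first by apply/embedsE.
have bmu0 := bar_neq0 mu0.
apply/seteqP; split=> [_ [alpha [beta [-> h1 h2]]]|_ [_ [alpha [beta [-> h1 h2]]] <-]].
  exists (quat alpha (bar mu / mu * beta)).
    apply/glueE; have Mb : M (s * (bar mu / mu * beta)).
      by move/eM: h1; congr M; ring.
    split=> //; have := ringintD h2 (ringintN (el _ Mb)); congr OK.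
    by field; rewrite s0 mu0 bmu0.
  by rewrite quat_conjugate //; congr quat; field; rewrite mu0 bmu0.
rewrite quat_conjugate //; apply/glueE; split.
  apply/eM; move: h1; congr M; field; by rewrite mu0 bmu0.
have := ringintD h2 (el _ h1); congr OK; field; by rewrite s0 bmu0.
Qed.

(** The trace form pairs [alpha] with [alpha'] and [C beta] with [bar beta'], so the Gram matrix is
    [V S V^T], a row of [V] listing the components of an element and their conjugates. [V] is block
    triangular, as the first two elements lie in [K]. *)
Lemma gram_det alpha2 alpha3 beta2 beta3 (w : 'I_4 -> B) :
  (forall i, w i = nth 0 [:: quat 1 0; quat t 0; quat alpha2 beta2; quat alpha3 beta3] i) ->
  \det (\matrix_(i < 4, j < 4) reduced_trace theta (w i * w j)) =
  - (C ^+ 2 * (t - bar t) ^+ 2 * (beta2 * bar beta3 - bar beta2 * beta3) ^+ 2).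
Proof.
move=> ew.
pose va := [:: 1; t; alpha2; alpha3]; pose vb := [:: 0; 0; beta2; beta3].
have ew' i : w i = quat va`_i vb`_i.
  by rewrite ew; case: i => [[|[|[|[|//]]]] h].
have det2 (A : 'M[K]_2) : \det A = A 0 0 * A 1 1 - A 0 1 * A 1 0.
  rewrite (expand_det_row _ 0) !big_ord_recl big_ord0 addr0 /cofactor !det_mx11 !mxE /=.
  rewrite expr0 expr1 mul1r mulN1r mulrN.
  by congr (A _ _ * A _ _ - A _ _ * A _ _); exact: val_inj.
have detlb (M : 'M[K]_(2 + 2)) : ursubmx M = 0 ->
    \det M = \det (ulsubmx M) * \det (drsubmx M).
  by move=> e; rewrite -{1}[M]submxK e det_lblock.
pose V : 'M[K]_(2 + 2) :=
  \matrix_(i, j) nth 0 [:: va`_i; bar va`_i; vb`_i; bar vb`_i] j.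
pose S : 'M[K]_(2 + 2) :=
  \matrix_(i, j) nth 0 (nth [::] [:: [:: 1; 0; 0; 0]; [:: 0; 1; 0; 0];
    [:: 0; 0; 0; C]; [:: 0; 0; C; 0]] i) j.
have -> : \matrix_(i < 4, j < 4) reduced_trace theta (w i * w j) = V *m S *m V^T.
  apply/matrixP => i j; rewrite !mxE !ew' quatM reduced_trace_quat.
  rewrite !big_ord_recl big_ord0 !mxE !big_ord_recl !big_ord0 !mxE /=.
  by rewrite rmorphD !rmorphM /= bar_alg barK; ring.
rewrite !det_mulmx det_tr.
have -> : \det V = (bar t - t) * (beta2 * bar beta3 - bar beta2 * beta3).
  rewrite detlb ?det2 ?mxE /=; last first.
    apply/matrixP => i j; rewrite !mxE.
    by elim/ord2_ind: i; elim/ord2_ind: j; rewrite /= ?rmorph0.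
  by rewrite rmorph1; ring.
have -> : \det S = - C ^+ 2.
  rewrite detlb ?det2 ?mxE /=; last first.
    by apply/matrixP => i j; rewrite !mxE; elim/ord2_ind: i; elim/ord2_ind: j.
  by ring.
by ring.
Qed.

Definition OL_span (n : nat) (w : 'I_n -> B) : set B :=
  [set y | exists2 x : 'I_n -> L, forall i, OL (x i) & y = \sum_i x i *: w i].

(** Writing four elements of [R] in terms of [w] by an integral matrix [A] multiplies the Gram
    determinant by [(det A) ^ 2]. *)
Lemma discriminant_span (R : set B) (w : 'I_4 -> B) (g : L) : R = OL_span w ->
  \det (\matrix_(i < 4, j < 4) reduced_trace theta (w i * w j)) = g%:A ->
  discriminant theta R = principal g.
Proof.
move=> eR eg; apply/seteqP; split; last first.
  apply: span_min => [|_ ->]; first exact: span_submod.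
  apply: span_in; exists w => // i; rewrite eR.
  exists (fun j => (i == j)%:R); first by move=> j; exact: ringint_nat.
  rewrite (bigD1 i) //= eqxx scale1r big1 ?addr0 // => j ne.
  by rewrite eq_sym (negbTE ne) scale0r.
apply: span_min => [|l [x Rx el]]; first exact: principal_submod.
have /choice[c Hc] : forall i, exists c : 'I_4 -> L,
    (forall j, OL (c j)) /\ x i = \sum_j c j *: w j.
  by move=> i; have := Rx i; rewrite eR => -[c Oc e]; exists c.
pose A : 'M[L]_4 := \matrix_(i, j) c i j; pose AK := map_mx (in_alg K) A.
have tr_sum (F : 'I_4 -> B) : reduced_trace theta (\sum_i F i) = \sum_i reduced_trace theta (F i).
  by rewrite /reduced_trace raddf_sum /= raddf_sum.
have [hZ _ _] := htheta.
have trZ (k : L) y : reduced_trace theta (k *: y) = k%:A * reduced_trace theta y.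
  by rewrite /reduced_trace hZ mxtraceZ.
have eG : \matrix_(i < 4, j < 4) reduced_trace theta (x i * x j) =
    AK *m \matrix_(i < 4, j < 4) reduced_trace theta (w i * w j) *m AK^T.
  apply/matrixP => i j; rewrite !mxE (proj2 (Hc i)) (proj2 (Hc j)).
  rewrite mulr_sumr tr_sum; apply: eq_bigr => k _.
  rewrite -scalerAr trZ !mxE mulrC; congr (_ * _).
  rewrite mulr_suml tr_sum; apply: eq_bigr => m _.
  by rewrite -scalerAl trZ !mxE.
have eD : l = \det A ^+ 2 * g.
  by apply: (@alg_inj _ K); rewrite el eG !det_mulmx det_tr eg det_map_mx !algE /=; ring.
rewrite eD; apply/principalE; exists (\det A ^+ 2) => //.
by apply/ringintX/ringint_det => i j; rewrite mxE; case: (Hc i).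
Qed.

Variable p : nat.
Hypothesis hp : prime p.
Hypothesis hc0 : c0 = alpha0 * p%:R.

Let pL : p%:R != 0 :> L.
Proof.
rewrite -(rmorph_nat (in_alg L)) fmorph_eq0 pnatr_eq0 -lt0n; exact: prime_gt0.
Qed.

Definition quat_basis alpha2 alpha3 m2 m3 : seq B :=
  [:: quat 1 0; quat t 0; quat alpha2 (m2 / s); quat alpha3 (m3 / s)].

Lemma quat_basis_span alpha2 alpha3 m2 m3 y :
  OL_span (fun i : 'I_4 => (quat_basis alpha2 alpha3 m2 m3)`_i) y <->
  exists x0 x1 x2 x3, [/\ OL x0, OL x1, OL x2 /\ OL x3 &
    y = quat (x0%:A + x1%:A * t + x2%:A * alpha2 + x3%:A * alpha3)
             (x2%:A * (m2 / s) + x3%:A * (m3 / s))].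
Proof.
have e (x : 'I_4 -> L) : \sum_i x i *: (quat_basis alpha2 alpha3 m2 m3)`_i =
    quat ((x 0)%:A + (x 1)%:A * t + (x 2)%:A * alpha2 + (x 3)%:A * alpha3)
             ((x 2)%:A * (m2 / s) + (x 3)%:A * (m3 / s)).
  rewrite !big_ord_recl big_ord0 /= addr0 !quatZ !quatD.
  have -> : lift ord0 ord0 = 1 :> 'I_4 by exact: val_inj.
  have -> : lift ord0 (lift ord0 ord0) = 2 :> 'I_4 by exact: val_inj.
  have -> : lift ord0 (lift ord0 (lift ord0 ord0)) = 3 :> 'I_4 by exact: val_inj.
  by congr quat; ring.
split=> [[x Ox ->]|[x0 [x1 [x2 [x3 [O0 O1 [O2 O3] ->]]]]]].
  by exists (x 0), (x 1), (x 2), (x 3); split=> //; exact: e.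
exists (fun i : 'I_4 => nth 0 [:: x0; x1; x2; x3] i); last by rewrite e.
by case=> [[|[|[|[|//]]]] h].
Qed.

(** In [gram_det] the pair [1, t] contributes [d] and the lattice basis [n ^ 2 d]; dividing that
    basis by [s] contributes [1 / d ^ 2]. *)
Lemma quat_basis_discriminant (R : set B) alpha2 alpha3 m2 m3 n :
  (m2 * bar m3 - bar m2 * m3) ^+ 2 = (n ^+ 2 * d)%:A ->
  R = OL_span (fun i : 'I_4 => (quat_basis alpha2 alpha3 m2 m3)`_i) ->
  discriminant theta R = principal (- (c0 * n) ^+ 2).
Proof.
move=> em eR; have s0 := s_neq0; apply: (discriminant_span eR).
rewrite (@gram_det alpha2 alpha3 (m2 / s) (m3 / s)) //.
have -> : (t - bar t) ^+ 2 = d%:A by rewrite -hs; case: s_sign => ->; rewrite ?sqrrN.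
have -> : m2 / s * bar (m3 / s) - bar (m2 / s) * (m3 / s)
    = - (m2 * bar m3 - bar m2 * m3) / d%:A.
  by rewrite !rmorphM /= !fmorphV /= bar_s invrN -hs; field; exact: s0.
have d0 : d%:A != 0 :> K by rewrite alg_eq0 d_neq0.
have -> : (- (m2 * bar m3 - bar m2 * m3) / d%:A) ^+ 2 = (n ^+ 2 * d)%:A / d%:A ^+ 2.
  by rewrite -em; field.
by rewrite !algE; field.
Qed.

(** With [c0 = alpha0 p], the quotients of the generators are, up to sign, the squares of [alpha0 n]
    and of its inverse; an element with integral square is integral. *)
Lemma principal_sqr_eq n : n != 0 ->
  principal (- (c0 * n) ^+ 2) = ideal_mul (principal p%:R) (principal (p%:R : L)) <->
  OL (n / alpha0^-1) /\ OL (alpha0^-1 / n).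
Proof.
move=> n0; have c00 : c0 != 0 by rewrite hc0 mulf_neq0.
rewrite principalM principal_eq ?oppr_eq0 ?expf_neq0 ?mulf_neq0 //.
have -> : - (c0 * n) ^+ 2 / (p%:R * p%:R) = - (n / alpha0^-1) ^+ 2.
  by rewrite hc0; field; rewrite pL alpha0_neq0 oner_neq0.
have -> : p%:R * p%:R / - (c0 * n) ^+ 2 = - (alpha0^-1 / n) ^+ 2.
  by rewrite hc0; field; rewrite n0 alpha0_neq0 oppr_eq0 expf_neq0 // !mulf_neq0.
split=> [[/ringintN h1 /ringintN h2]|[h1 h2]].
  by rewrite !opprK in h1 h2; split; apply: ringint_sqr.
by split; apply/ringintN/ringintX.
Qed.

Lemma lattice_mul M y z : beta_lattice M -> M y -> M z -> OK (y * bar z * alpha0%:A).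
Proof. by move=> [_ hM] My Mz; have := ideal_norm_mul_mem hM My Mz; rewrite algV invrK. Qed.

(** The main point is closure under product. Apart from terms made integral by the gluing
    conditions, the gluing condition of a product involves [(c0 - lam ^ 2) beta (bar beta')], and
    [beta (bar beta')] has denominator [d alpha0]. *)
Lemma glue_superspecial M lam : beta_lattice M -> OL lam ->
  (forall y, M y -> OK (lam%:A * y)) -> OL ((lam ^+ 2 - c0) / d) ->
  superspecial_over_OK theta bar C p (glue M lam).
Proof.
move=> hM Olam H Od; have [fM nM] := hM; have [M0 MD MM] := frac_submod fM.
have s0 := s_neq0; have Os := OK_s.
have d0 : d%:A != 0 :> K by rewrite alg_eq0 d_neq0.
have a0K : alpha0%:A != 0 :> K by rewrite alg_eq0.
(* Divisibility by [alpha0]: [lam] is a multiple of [lam0], and [lam0 ^ 2 / alpha0] is integral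
   because [lam0 / alpha0] is in [M]. It combines with divisibility by [d], as [alpha0] is prime to
   [d]. *)
have Oda : OL ((c0 - lam ^+ 2) / (d * alpha0)).
  have Oa : OL ((c0 - lam ^+ 2) / alpha0).
    have [lam0 [O0 n0 _ Hl [h0 _]]] := lattice_multiplier hM.
    have /Hl Oll := H.
    have h1 : OL (lam0 ^+ 2 / alpha0).
      rewrite -(ringint_alg K).
      have -> : (lam0 ^+ 2 / alpha0)%:A = lam0%:A * (lam0 / alpha0)%:A :> K.
        by rewrite !algE; ring.
      suff : forall y, M y -> OK (lam0%:A * y) by apply.
      by apply/Hl; rewrite mulfV //; exact: ringint1.
    have -> : (c0 - lam ^+ 2) / alpha0 = p%:R - (lam / lam0) ^+ 2 * (lam0 ^+ 2 / alpha0).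
      by rewrite hc0; field; rewrite n0 alpha0_neq0.
    by apply: ringintB; [exact: ringint_nat | apply: ringintM => //; exact: ringintX].
  have [_ _ [u [v [Ou Ov e]]]] := (coprime_eltsP _ _).1 hcop.
  have -> : (c0 - lam ^+ 2) / (d * alpha0) =
     u * - ((lam ^+ 2 - c0) / d) + v * ((c0 - lam ^+ 2) / alpha0).
    transitivity ((u * alpha0 + v * d) * ((c0 - lam ^+ 2) / (d * alpha0))).
      by rewrite e mul1r.
    by field; rewrite d_neq0 alpha0_neq0.
  by apply: ringintD; apply: ringintM => //; exact: ringintN.
have R1 : glue M lam (quat 1 0).
  by apply/glueE; rewrite mulr0 mulr0 subr0; split=> //; exact: ringint1.
have ROK alpha : OK alpha -> glue M lam (quat alpha 0).
  by move=> Oal; apply/glueE; rewrite mulr0 mulr0 subr0.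
have RM x y : glue M lam x -> glue M lam y -> glue M lam (x * y).
  move=> [al [be [-> h1 h2]]] [al' [be' [-> h1' h2']]]; rewrite quatM; apply/glueE.
  have Hbe : OK (lam%:A * (s * be)) by exact: H.
  have Hbe' : OK (lam%:A * (s * be')) by exact: H.
  have [v Ov ev] := OK_diff Hbe'.
  have [v' Ov' ev'] := OK_diff h2'.
  have ev2 : lam%:A * (be' + bar be') = v%:A.
    apply: (mulfI s0); rewrite [RHS]mulrC -ev !rmorphM /= bar_alg bar_s; ring.
  split.
    have -> : s * (al * be' + be * bar al') = (al - lam%:A * be) * (s * be') +
        bar (al' - lam%:A * be') * (s * be) + v%:A * (s * be).
      by rewrite -ev2 rmorphB rmorphM /= bar_alg; ring.
    apply: (MD); first apply: (MD); apply: (MM) => //; first exact: OK_bar.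
    exact/ringint_alg.
  have -> : al * al' + C * be * bar be' - lam%:A * (al * be' + be * bar al') =
     (al - lam%:A * be) * (al' - lam%:A * be') +
     lam%:A * be * ((al' - lam%:A * be') - bar (al' - lam%:A * be')) +
     (C - lam%:A ^+ 2) * (be * bar be').
    by rewrite rmorphB rmorphM /= bar_alg; ring.
  rewrite ev'; apply: ringintD; [apply: ringintD; first exact: ringintM|].
    have -> : lam%:A * be * (v'%:A * s) = v'%:A * (lam%:A * (s * be)) by ring.
    by apply: ringintM => //; apply/ringint_alg.
  have -> : (C - lam%:A ^+ 2) * (be * bar be') =
    - (((c0 - lam ^+ 2) / (d * alpha0))%:A * ((s * be) * bar (s * be') * alpha0%:A)).
    by rewrite !algE -hs rmorphM /= bar_s; field; rewrite s0 a0K.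
  by apply: ringintN; apply: ringintM; [apply/ringint_alg | exact: lattice_mul hM h1 h1'].
have [m2 [m3 [n [hn Mspan Kspan en]]]] := ideal_basis fM.
pose w := quat_basis (lam%:A * (m2 / s)) (lam%:A * (m3 / s)) m2 m3.
have eR : glue M lam = OL_span (fun i : 'I_4 => w`_i).
  apply/seteqP; split=> [_ [al [be [-> h1 h2]]]|y].
    have /Mspan[l2 [l3 [O2 O3 e]]] := h1.
    have /OK_coord[x0 [x1 [O0 O1 e']]] := h2.
    have eb : be = l2%:A * (m2 / s) + l3%:A * (m3 / s).
      by apply: (mulfI s0); rewrite e; field.
    apply/quat_basis_span; exists x0, x1, l2, l3; split=> //.
    rewrite -eb; congr quat; rewrite -e' eb; ring.
  case/quat_basis_span=> x0 [x1 [x2 [x3 [O0 O1 [O2 O3] ->]]]]; apply/glueE; split.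
    by apply/Mspan; exists x2, x3; split=> //; field.
  apply/OK_coord; exists x0, x1; split=> //; ring.
have hun := ideal_norm_uniq hn nM.
have disc := quat_basis_discriminant en eR.
split; last by move=> alpha x Oal /embedsE->; exact: ROK.
split; last first.
  split; last first.
    rewrite disc; apply/principal_sqr_eq; first by case: hn.
    by case: hun.
  split; first by apply: frac_principal.
  by apply: span_min => [|_ ->]; [exact: submod_ringint | exact: ringint_nat].
split=> //; first by rewrite -quat1.
exists w; split; last exact: eR.
apply/vspaceP => y; rewrite memvf; have [al [be ->]] := quat_surj y.
have [l2 [l3 e]] := Kspan (s * be); have [x0 [x1 e']] := K_coord (al - lam%:A * be).
have eb : be = l2%:A * (m2 / s) + l3%:A * (m3 / s).
  by apply: (mulfI s0); rewrite e; field.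
have -> : quat al be = x0 *: w`_0 + x1 *: w`_1 + l2 *: w`_2 + l3 *: w`_3.
  rewrite /= !quatZ !quatD; congr quat; last by rewrite {1}eb; ring.
  by rewrite -[LHS](subrK (lam%:A * be)) e' eb; ring.
by rewrite !memvD // memvZ // memv_span // mem_nth.
Qed.

Lemma OL_span_addr n (w : 'I_n -> B) x y :
  OL_span w x -> OL_span w y -> OL_span w (x + y).
Proof.
move=> [c Oc ->] [c' Oc' ->]; exists (fun i => c i + c' i).
  by move=> i; apply: ringintD.
by rewrite -big_split; apply: eq_bigr => i _; rewrite scalerDl.
Qed.

(* [R :&: K] is a multiplicatively closed fractional ideal, hence is [O_K];
   commutators with [t] bound the [K]-component by the inverse different; the
   discriminant gives the norm of the lattice [M] of second components, and
   [lam] is the gluing map [M / s M -> s^-1 O_K / O_K]. *)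
Lemma superspecial_glue (R : set B) : superspecial_over_OK theta bar C p R ->
  exists M lam, [/\ beta_lattice M, OL lam, forall y, M y -> OK (lam%:A * y),
    OL ((lam ^+ 2 - c0) / d) & R = glue M lam].
Proof.
case=> [[[R1 RM [sq [full eRs]]] [_ disc]] RK].
have s0 := s_neq0; have Os := OK_s.
have d0 : d%:A != 0 :> K by rewrite alg_eq0 d_neq0.
have a0K : alpha0%:A != 0 :> K by rewrite alg_eq0.
have ROK alpha : OK alpha -> R (quat alpha 0).
  by move=> Oal; apply: (RK alpha) => //; apply/embedsE.
have RD x y : R x -> R y -> R (x + y).
  have eR' : R = OL_span (fun i : 'I_(size sq) => sq`_i) by [].
  by rewrite eR'; exact: OL_span_addr.
have RK1 x al be : OK x -> R (quat al be) -> R (quat (x * al) (x * be)).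
  by move=> Ox h; have := RM _ _ (ROK _ Ox) h; rewrite quatM !mulr0 !mul0r !addr0.
have RB al be al' be' : R (quat al be) -> R (quat al' be') -> R (quat (al - al') (be - be')).
  move=> h h'; have := RD _ _ h (RK1 (-1) _ _ (ringintN (ringint1 _)) h').
  by rewrite quatD !mulN1r.
have [m m0 Hm] : exists2 m : K, m != 0 &
    forall al be, R (quat al be) -> OK (m * al) /\ OK (m * be).
  pose f i j (x : B) := theta x i j : K.
  have [m m0 [Om Hm]] := common_denominator
    ([seq f 0 0 x | x <- sq] ++ [seq f 0 1 x | x <- sq]) denK.
  exists m => // al be; rewrite eRs => -[x Ox e].
  have h j : OK (m * f 0 j (quat al be)).
    rewrite /f e rmorph_sum summxE mulr_sumr; apply: ringint_sum => i.
    have [hZ _ _] := htheta; rewrite hZ mxE mulrCA; apply: ringintM.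
      exact/ringint_alg.
    apply: Hm; rewrite mem_cat; elim/ord2_ind: j; apply/orP; [left | right].
      by apply: map_f; apply: mem_nth.
    by apply: map_f; apply: mem_nth.
  by have := h 0; have := h 1; rewrite /f quatE !mxE.
have RKE alpha : R (quat alpha 0) <-> OK alpha.
  split; last exact: ROK.
  pose S := [set x | R (quat x 0)] => Ra.
  have fS : frac_ideal S.
    split=> /= [|x y|c x Oc||].
    - by apply: ROK; exact: ringint0.
    - by move=> hx hy; have := RD _ _ hx hy; rewrite quatD addr0.
    - by move=> hx; have := RK1 _ _ _ Oc hx; rewrite mulr0.
    - by exists 1; [apply: ROK; exact: ringint1 | exact: oner_neq0].
    - by exists m => // x /Hm[].
  (* [alpha] maps [S] into itself, hence maps the product of [S] and its inverse, which contains
     [1], into the integers. *)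
  have : ideal_mul S (ideal_inv S) 1 by rewrite ideal_mulV //; exact: ringint1.
  rewrite -[alpha]mulr1; move: 1; apply: ideal_mul_min.
    exact: submod_preim (submod_ringint _).
  move=> x y Sx Sy /=; rewrite mulrA mulrC; apply: Sy => /=.
  by have := RM _ _ Ra Sx; rewrite quatM rmorph0 !mulr0 !mul0r !addr0.
have Ot : OK t by apply/OK_coord; exists 0, 1; rewrite alg0 alg1 mul1r add0r; split=> //;
    [exact: ringint0 | exact: ringint1].
have Ral al be : R (quat al be) -> OK (s * al).
  move=> h; have h1 := RM _ _ h (ROK _ Ot); have h2 := RK1 _ _ _ (OK_bar Ot) h.
  rewrite quatM rmorph0 !mulr0 !addr0 add0r in h1.
  (* [[al, be] t - (bar t) [al, be]] is [(t - bar t) al], an element of [R] in [K]. *)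
  have := RB _ _ _ _ h1 h2; rewrite (mulrC be) subrr => /RKE.
  have -> : al * t - bar t * al = (t - bar t) * al by ring.
  by case: s_sign => -> // h'; rewrite mulNr; apply: ringintN.
pose M := [set x | exists al, R (quat al (x / s))].
have fM : frac_ideal M.
  split=> /= [|x y [al h] [al' h']|c x Oc [al h]||].
  - by exists 0; rewrite mul0r quat0 -quat0; apply: ROK; exact: ringint0.
  - by exists (al + al'); have := RD _ _ h h'; rewrite quatD mulrDl.
  - by exists (c * al); have := RK1 _ _ _ Oc h; rewrite mulrA.
  (* If [M] were zero, the generators of [R] would all lie in [K] and could not span [[0, 1]]. *)
  - apply: contrapT => hM.
    have z i : (i < size sq)%N -> theta sq`_i 0 1 = 0.
      move=> lt; have [al [be e]] := quat_surj sq`_i.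
      rewrite e quatE mxE /=; apply/eqP; apply: contrapT => /negP be0; apply: hM.
      exists (s * be); last by rewrite mulf_neq0.
      exists al; rewrite mulrC mulKf // -e eRs.
      exists (fun j => (j == Ordinal lt)%:R); first by move=> j; exact: ringint_nat.
      rewrite (bigD1 (Ordinal lt)) //= eqxx scale1r big1 ?addr0 // => j ne.
      by rewrite (negbTE ne) scale0r.
    have : quat 0 1 \in <<sq>>%VS by rewrite full memvf.
    move/(coord_span (X := in_tuple sq))/(congr1 (fun x => theta x 0 1)).
    rewrite quatE mxE /= rmorph_sum summxE big1 => [/eqP|i _]; first by rewrite oner_eq0.
    by have [hZ _ _] := htheta; rewrite hZ mxE z ?mulr0.
  - exists m => // x [al /Hm[_ h]].
    by have := ringintM h Os; congr OK; field.
have [m2 [m3 [n [hn Mspan Kspan en]]]] := ideal_basis fM.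
have [al2 R2] : M m2.
  apply/Mspan; exists 1, 0; rewrite alg0 alg1 mul1r mul0r addr0.
  by split=> //; [exact: ringint1 | exact: ringint0].
have [al3 R3] : M m3.
  apply/Mspan; exists 0, 1; rewrite alg0 alg1 mul1r mul0r add0r.
  by split=> //; [exact: ringint0 | exact: ringint1].
have eR : R = OL_span (fun i : 'I_4 => (quat_basis al2 al3 m2 m3)`_i).
  apply/seteqP; split=> [y|y /quat_basis_span[x0 [x1 [x2 [x3 [O0 O1 [O2 O3] ->]]]]]].
    have [al [be ->]] := quat_surj y => h.
    have : M (s * be) by exists al; rewrite mulrC mulKf.
    case/Mspan=> l2 [l3 [O2 O3 e]].
    have eb : be = l2%:A * (m2 / s) + l3%:A * (m3 / s).
      by apply: (mulfI s0); rewrite e; field.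
    have OK2 : OK l2%:A by apply/ringint_alg.
    have OK3 : OK l3%:A by apply/ringint_alg.
    have := RB _ _ _ _ (RB _ _ _ _ h (RK1 _ _ _ OK2 R2)) (RK1 _ _ _ OK3 R3).
    have -> : be - l2%:A * (m2 / s) - l3%:A * (m3 / s) = 0 by rewrite eb; ring.
    move/RKE/OK_coord=> [x0 [x1 [O0 O1 e']]].
    apply/quat_basis_span; exists x0, x1, l2, l3; split=> //.
    by rewrite -eb -e'; congr quat; ring.
  have O01 : OK (x0%:A + x1%:A * t) by apply/OK_coord; exists x0, x1.
  have OK2 : OK x2%:A by apply/ringint_alg.
  have OK3 : OK x3%:A by apply/ringint_alg.
  have := RD _ _ (RD _ _ (ROK _ O01) (RK1 _ _ _ OK2 R2)) (RK1 _ _ _ OK3 R3).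
  by rewrite !quatD add0r.
have hM : beta_lattice M.
  split=> //; have [n0 _] := hn.
  have [h1 h2] : OL (n / alpha0^-1) /\ OL (alpha0^-1 / n).
    by apply/principal_sqr_eq => //; rewrite -(quat_basis_discriminant en eR) disc.
  by apply: (ideal_norm_eq hn) => //; rewrite invr_eq0.
have [lam0 [O0 n0 clam Hl [My0 Mgen]]] := lattice_multiplier hM.
have [aly Ry] := My0.
have [kl Okl hkl] := OK_mod_s (Ral _ _ Ry).
have [f [g [Of Og efg]]] := coprime_elts_sqr clam.
(* A multiple of [lam0], so that [lam M] is integral; and [lam (lam0 / alpha0) = f lam0 ^ 2 kl] is
   [kl] modulo [d], the value read off from [R]. *)
pose lam := f * alpha0 * kl * lam0.
have OK0 : OL (f * alpha0 * kl) by apply: ringintM => //; apply: ringintM.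
have Olam : OL lam by apply: ringintM.
have HM : forall y, M y -> OK (lam%:A * y).
  by apply/Hl; rewrite /lam mulfK.
have hy : OK (aly - lam%:A * ((lam0 / alpha0)%:A / s)).
  have e1 := congr1 (fun z => z%:A : K) efg; rewrite !algE in e1.
  have -> : aly - lam%:A * ((lam0 / alpha0)%:A / s) =
      (s * aly - kl%:A) / s + g%:A * kl%:A * s.
    transitivity (aly - (f%:A * lam0%:A ^+ 2) * kl%:A / s).
      by rewrite /lam !algE; field; rewrite s0 a0K.
    have -> : f%:A * lam0%:A ^+ 2 = 1 - g%:A * d%:A :> K.
      by rewrite -[LHS](addrK (g%:A * d%:A)) e1.
    by rewrite -hs; field.
  apply: ringintD => //; apply: ringintM => //.
  by apply: ringintM; apply/ringint_alg.
have glueR al be : R (quat al be) -> OK (al - lam%:A * be).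
  move=> h; have : M (s * be) by exists al; rewrite mulrC mulKf.
  case/Mgen=> x [m' [Ox [al' h'] e1]].
  have h1 := RB _ _ _ _ h (RK1 _ _ _ Ox Ry).
  have h2 := RK1 _ _ _ Os (RK1 _ _ _ Os h').
  have := RB _ _ _ _ h1 h2.
  have eb : be = x * ((lam0 / alpha0)%:A / s) + s * m'.
    by apply: (mulfI s0); rewrite e1 -hs; field.
  have -> : be - x * ((lam0 / alpha0)%:A / s) - s * (s * (m' / s)) = 0.
    by rewrite eb; field.
  move/RKE => h3.
  have -> : al - lam%:A * be = (al - x * aly - s * (s * al')) + s * (s * al')
    + x * (aly - lam%:A * ((lam0 / alpha0)%:A / s)) - s * (lam%:A * m').
    rewrite eb; move: ((lam0 / alpha0)%:A / s) => Y; ring.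
  have Mm' : M m' by exists al'.
  apply: ringintB; last by apply: ringintM => //; exact: HM.
  apply: ringintD; last exact: ringintM.
  by apply: ringintD => //; apply: ringintM => //; exact: Ral h'.
have eRg : R = glue M lam.
  apply/seteqP; split=> [y|_ [al [be [-> [al' h] h2]]]].
    have [al [be ->]] := quat_surj y => h; apply/glueE; split; last exact: glueR.
    by exists al; rewrite mulrC mulKf.
  rewrite mulrC mulKf // in h; have h3 := ringintB h2 (glueR _ _ h).
  have := RD _ _ h (ROK _ h3); rewrite quatD addr0; congr (R (quat _ _)); ring.
exists M, lam; split=> //.
suff : OL ((c0 - lam ^+ 2) / d / alpha0).
  move=> h; have := ringintN (ringintM h Oalpha0); congr OL; field.
  by rewrite alpha0_neq0 d_neq0.
rewrite -(ringint_alg K) algM; have : ideal_mul M (conj_ideal M) (alpha0^-1)%:A.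
  by case: hM => _ [_ ->]; exact: principal_mem.
(* For [x] and [bar y] in [M], lift both to [R] by [lam] and multiply: the gluing condition of the
   product says that [(c0 - lam ^ 2) / d] times [x y] is integral. This extends to [alpha0^-1], an
   element of [M (bar M)]. *)
move: (alpha0^-1)%:A; apply: ideal_mul_min; first exact: submod_preim (submod_ringint _).
move=> x y Mx /conj_idealE My /=.
have Rx z : M z -> R (quat (lam%:A * (z / s)) (z / s)).
  move=> Mz; rewrite eRg; apply/glueE; rewrite subrr mulrC divfK //.
  by split=> //; exact: ringint0.
have := RM _ _ (Rx _ Mx) (Rx _ My); rewrite quatM => /glueR/ringintN; congr OK.
rewrite !rmorphM /= !fmorphV /= bar_alg barK bar_s invrN !algE -hs.
by field.
Qed.

(** * Conjugacy by [K] and automorphisms over [K] *)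

Lemma K_conjugate_refl R : K_conjugate theta bar C R R.
Proof.
exists 1, (quat 1 0); split; rewrite ?oner_neq0 ?embedsE //.
apply/seteqP; split=> [x Rx|_ [x Rx <-]]; rewrite quat1 invr1.
  by exists x; rewrite // mul1r mulr1.
by rewrite mul1r mulr1.
Qed.

Lemma K_conjugate_sym R R' : K_conjugate theta bar C R R' -> K_conjugate theta bar C R' R.
Proof.
case=> mu [x [mu0 /embedsE-> ->]]; have u : quat mu 0 \is a GRing.unit.
  apply/unitrP; exists (quat mu^-1 0).
  by rewrite !quatM rmorph0 !mulr0 !mul0r !addr0 mulVf // mulfV // quat1.
exists mu^-1, (quat mu^-1 0); split; rewrite ?invr_eq0 ?embedsE // -quatV // invrK.
apply/seteqP; split=> [y Ry|_ [_ [y Ry <-] <-]].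
  exists (quat mu 0 * y * (quat mu 0)^-1); first by exists y.
  by rewrite !mulrA mulVr // mul1r -mulrA mulVr // mulr1.
by rewrite !mulrA mulVr // mul1r -mulrA mulVr // mulr1.
Qed.

Lemma K_conjugate_trans R R' R'' : K_conjugate theta bar C R R' ->
  K_conjugate theta bar C R' R'' -> K_conjugate theta bar C R R''.
Proof.
case=> mu [x [mu0 /embedsE-> ->]] [nu [x' [nu0 /embedsE-> ->]]].
have e al be : quat nu 0 * (quat mu 0 * quat al be * (quat mu 0)^-1) * (quat nu 0)^-1 =
    quat (nu * mu) 0 * quat al be * (quat (nu * mu) 0)^-1.
  rewrite !quat_conjugate ?mulf_neq0 //; congr quat; rewrite rmorphM /=.
  by field; rewrite !bar_neq0.
exists (nu * mu), (quat (nu * mu) 0); split; rewrite ?mulf_neq0 ?embedsE //.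
apply/seteqP; split=> [_ [_ [y Ry <-] <-]|_ [y Ry <-]].
  by have [al [be ey]] := quat_surj y; exists y; rewrite // ey e.
exists (quat mu 0 * y * (quat mu 0)^-1); first by exists y.
by have [al [be ey]] := quat_surj y; rewrite ey e.
Qed.

(* Skolem-Noether: an automorphism over [K] sends [0, 1] to [0, k] with
   [k (bar k) = 1], and [k = mu / bar mu] by Hilbert 90. *)
Lemma K_conjugate_automorphic R R' :
  K_conjugate theta bar C R R' <-> K_automorphic theta bar C R R'.
Proof.
split.
  case=> mu [x [mu0 /embedsE-> ->]]; have u : quat mu 0 \is a GRing.unit.
    apply/unitrP; exists (quat mu^-1 0).
    by rewrite !quatM rmorph0 !mulr0 !mul0r !addr0 mulVf // mulfV // quat1.
  pose f y := quat mu 0 * y * (quat mu 0)^-1.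
  have fB : zmod_morphism f by move=> y z; rewrite /f mulrBr mulrBl.
  have fM : monoid_morphism f.
    split; first by rewrite /f mulr1 mulrV.
    by move=> y z; rewrite /f !mulrA (divrK u).
  have fZ : scalable f by move=> k y; rewrite /f -scalerAr -scalerAl.
  pose sigma : {lrmorphism B -> B} := HB.pack f
    (GRing.isZmodMorphism.Build B B f fB) (GRing.isMonoidMorphism.Build B B f fM)
    (GRing.isScalable.Build L B B *:%R f fZ).
  exists sigma; split=> //.
    exists (fun y => (quat mu 0)^-1 * y * quat mu 0) => y /=; rewrite /f.
      by rewrite !mulrA mulVr // mul1r -mulrA mulVr // mulr1.
    by rewrite !mulrA mulrV // mul1r -mulrA mulrV // mulr1.
  by move=> alpha y /embedsE-> /=; rewrite /f quat_conjugate // mulr0.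
case=> sigma [_ hfix ->].
have fixK al : sigma (quat al 0) = quat al 0 by apply: (hfix al); apply/embedsE.
have c00 : C != 0 by rewrite alg_eq0 hc0 (mulf_neq0 alpha0_neq0 pL).
have [al [k ek]] := quat_surj (sigma (quat 0 1)).
have com x : quat 0 1 * quat x 0 = quat (bar x) 0 * quat 0 1.
  by rewrite !quatM rmorph0; congr quat; ring.
(* Applying [sigma] to [[0, 1] t = (bar t) [0, 1]] and comparing first components gives
   [(t - bar t) al = 0]. *)
have al0 : al = 0.
  have := congr1 sigma (com t); rewrite !rmorphM /= !fixK ek !quatM rmorph0.
  case/quat_inj; rewrite !mulr0 !mul0r !addr0 => e _.
  have : (t - bar t) * al = 0 by rewrite mulrBl -e mulrC subrr.
  by move/eqP; rewrite mulf_eq0 (negbTE bar_t_neq) => /eqP.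
rewrite al0 in ek.
have kk : k * bar k = 1.
  have : quat 0 1 * quat 0 1 = quat C 0 by rewrite quatM rmorph0 rmorph1; congr quat; ring.
  move/(congr1 sigma); rewrite rmorphM /= ek fixK quatM rmorph0 => /quat_inj[e _].
  by apply: (mulfI c00); rewrite mulr1 -{2}e; ring.
(* From [k (bar k) = 1], [1 + k = k (1 + bar k)]. When [k = -1] this element vanishes, and [s] is
   taken instead. *)
have [mu mu0 emu] : exists2 mu, mu != 0 & mu / bar mu = k.
  have [ek1|nk] := eqVneq k (-1).
    by exists s; rewrite ?s_neq0 // bar_s ek1 invrN mulrN mulfV ?s_neq0.
  have n1 : 1 + k != 0 by rewrite addrC -[1]opprK subr_eq0.
  exists (1 + k) => //; have n2 := bar_neq0 n1.
  apply: (mulIf n2); rewrite divfK // rmorphD rmorph1 mulrDr kk mulr1; exact: addrC.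
exists mu, (quat mu 0); split=> //; first by apply/embedsE.
apply: eq_imagel => y _; have [a' [b' ->]] := quat_surj y.
rewrite quat_conjugate // emu.
have -> : quat a' b' = quat a' 0 + quat b' 0 * quat 0 1.
  by rewrite quatM quatD rmorph0 rmorph1; congr quat; ring.
rewrite rmorphD rmorphM /= !fixK ek quatM quatD rmorph0; congr quat; ring.
Qed.

(** * Orders attached to ideals *)

Variable calA : set K.
Hypothesis hA : integral_ideal calA.
Hypothesis hAA : ideal_ext K (principal alpha0) = ideal_mul calA [set bar x | x in calA].

Let fA : frac_ideal calA. Proof. by case: hA. Qed.

Lemma ideal_norm_calA : ideal_norm calA alpha0.
Proof. by split=> //; rewrite /conj_ideal -hAA ext_principal. Qed.

(** The inverse of [calA] has norm [alpha0^-1], while the norms of [I^-1] and [bar I] cancel. *)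
Lemma twist_lattice I : frac_ideal I -> beta_lattice (twist bar calA I).
Proof.
move=> fI; have [n hn] := ideal_norm_exists fI; split.
  apply: frac_mul; first exact: frac_inv.
  by apply: frac_mul; [exact: frac_inv | exact: conj_frac].
have := ideal_normM (ideal_norm_inv fA ideal_norm_calA)
  (ideal_normM (ideal_norm_inv fI hn) (ideal_norm_conj hn)).
by rewrite mulVf ?mulr1; case: hn.
Qed.

(** The identity [s alpha = s (alpha - lam beta) + lam (s beta)] puts [alpha] in the inverse
    different. *)
Lemma dorman_order_glue I lam : (forall y, twist bar calA I y -> OK (lam%:A * y)) ->
  dorman_order bar calA theta C s I lam = glue (twist bar calA I) lam.
Proof.
move=> H; have s0 := s_neq0; have s0' : s^-1 != 0 by rewrite invr_eq0.
have sT : submodule (twist bar calA I) by exact: ideal_mul_submod.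
rewrite /dorman_order inv_principal //.
apply/seteqP; split=> [x [al [be [/quat_eq-> _ hb' h]]]|_ [al [be [-> h1 h2]]]].
  by apply/glueE; split=> //; move/(principal_mulE _ s0' sT): hb'; rewrite invrK mulrC.
exists al, be; split=> //; first exact: quatE.
  apply/(principal_div _ s0'); rewrite invrK.
  have := ringintD (ringintM OK_s h2) (H _ h1); congr OK; ring.
by apply/(principal_mulE _ s0' sT); rewrite invrK mulrC.
Qed.

Local Notation adm := (admissible bar calA d lamq tq).
Local Notation R := (dorman_order bar calA theta C s).

Lemma adm_glue I lam : adm I lam -> [/\ R I lam = glue (twist bar calA I) lam, OL lam,
  sign_congruence (fun q => ideal_val (tq q) I) lam
  & forall y, twist bar calA I y -> OK (lam%:A * y)].
Proof.
by case=> /coprime_eltsP[Olam _ _] S H; split=> //; exact: dorman_order_glue.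
Qed.

Lemma dorman_order_superspecial I lam : integral_ideal I -> adm I lam ->
  superspecial_over_OK theta bar C p (R I lam).
Proof.
move=> [fI IO] /adm_glue[-> Olam S H]; apply: glue_superspecial => //.
  exact: twist_lattice.
exact: sign_congruence_sqr S.
Qed.

Lemma odd_val_tq I n pi : integral_ideal I -> ideal_norm I n ->
  prime_ideal (principal pi) -> principal pi d ->
  odd (ideal_val (tq (principal pi)) I) = oddval pi n.
Proof.
move=> [fI IO] hn hpi pid'; have [hP hPP] := htq hpi pid'.
by apply: odd_ideal_val => //; split.
Qed.

Lemma dorman_order_conjugate I I' lam lam' : integral_ideal I -> integral_ideal I' ->
  adm I lam -> adm I' lam' ->
  K_conjugate theta bar C (R I lam) (R I' lam') <-> ideal_equiv I I'.
Proof.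
move=> iI iI' /adm_glue[-> Olam S H] /adm_glue[-> Olam' S' H'].
have [fI IO] := iI; have [fI' IO'] := iI'.
have [n hn] := ideal_norm_exists fI; have [n' hn'] := ideal_norm_exists fI'.
have hM := twist_lattice fI; have [fM _] := hM; have sM := frac_submod fM.
have [fM' _] := twist_lattice fI'; have sM' := frac_submod fM'.
have sI := frac_submod fI; have sI' := frac_submod fI'.
have [n0 _] := hn; have [n'0 _] := hn'.
rewrite K_conjugate_glue //.
have mem mu x : mu != 0 -> ideal_mul (principal (mu / bar mu)) (twist bar calA I) x <->
    twist bar calA I (x * bar mu / mu).
  move=> mu0; rewrite principal_mulE ?invf_div ?mulrA //.
  by rewrite mulf_neq0 ?invr_eq0 ?bar_neq0.
have h' mu : mu != 0 -> (forall x, twist bar calA I' x <-> twist bar calA I (x * bar mu / mu)) ->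
    forall y, twist bar calA I y -> OK (lam'%:A * (mu / bar mu * y)).
  move=> mu0 eM y My; apply: H'; apply/eM; move: My; congr (twist _ _ _ _).
  by field; rewrite mu0 bar_neq0.
split.
  case=> mu [mu0 eM /(gluing_sign hM mu0 Olam Olam' S S' H (h' mu mu0 eM)) hodd].
  have bmu0 := bar_neq0 mu0.
  have fmu : frac_ideal (principal mu) by exact: frac_principal.
  (* The relation between the two twists amounts to [bar N = N], and [hodd] to even valuations of
     its norm at the ramified primes. Then [N] is generated by some [l] in [L], and
     [I' = (l / mu) I]. *)
  pose N := ideal_mul (principal mu) (ideal_mul I' (ideal_inv I)).
  have fN : frac_ideal N.
    by apply: frac_mul => //; apply: frac_mul => //; exact: frac_inv.
  have hN : ideal_norm N (norm mu * (n' * n^-1)).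
    apply: ideal_normM; first exact: ideal_norm_principal.
    by apply: ideal_normM => //; exact: ideal_norm_inv.
  have eM' : twist bar calA I' = ideal_mul (principal (mu / bar mu)) (twist bar calA I).
    by apply/seteqP; split=> x; rewrite mem // eM.
  have eI : conj_ideal I' =
      ideal_mul (principal (mu / bar mu)) (ideal_mul I' (ideal_mul (ideal_inv I) (conj_ideal I))).
    move: eM'; rewrite /twist -/(conj_ideal I) -/(conj_ideal I') [RHS]ideal_mulCA.
    move/(ideal_mul_inj (frac_inv fA) (ideal_mul_submod _ _) (ideal_mul_submod _ _)) => e.
    by rewrite ideal_mulCA -e ideal_mulVKl //; exact: conj_submod.
  have cN : conj_ideal N = N.
    rewrite /N !conj_mul conj_principal conj_inv // eI.
    rewrite -!ideal_mulA ideal_mulV ?ideal_mulr1; last exact: conj_frac.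
      by rewrite ideal_mulA principalM mulrCA mulfV // mulr1.
    exact: ideal_inv_submod.
  have [|l l0 eN] := ambiguous_principal fN cN hN.
    move=> pi hpi pid'; have nn0 : norm mu != 0 by exact: norm_neq0.
    rewrite (oddvalM denL pid hpi nn0) ?mulf_neq0 ?invr_eq0 //.
    rewrite (oddvalM denL pid hpi n'0) ?invr_eq0 // (oddvalV denL pid hpi n0).
    have := hodd pi hpi pid'; rewrite (odd_val_tq iI hn) // (odd_val_tq iI' hn') // => ->.
    by case: (oddval pi n') (oddval pi (norm mu)) => [] [].
  have lK : l%:A != 0 :> K by rewrite alg_eq0.
  exists (l%:A / mu); first by rewrite mulf_neq0 ?invr_eq0.
  rewrite scale_ideal // mulrC -principalM -eN /N.
  rewrite (ideal_mulA (principal mu^-1)) principalM mulVf // principal1.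
  rewrite ideal_mul1; last exact: ideal_mul_submod.
  by rewrite -ideal_mulA ideal_mulVl // ideal_mulr1.
case=> x x0 eI'; have bx0 := bar_neq0 x0; have fx : frac_ideal (principal x).
  exact: frac_principal.
have {}eI' : I' = ideal_mul (principal x) I by rewrite eI' scale_ideal.
have eM' : twist bar calA I' = ideal_mul (principal (bar x / x)) (twist bar calA I).
  rewrite /twist -/(conj_ideal I) -/(conj_ideal I') eI' conj_mul conj_principal.
  have -> : ideal_inv (ideal_mul (principal x) I) = ideal_mul (principal x^-1) (ideal_inv I).
    apply: ideal_inv_eq; try exact: ideal_mul_submod.
    by rewrite ideal_mulACA principalM mulfV // principal1 ideal_mulV // ideal_mulr1 //;
      exact: submod_ringint.
  by rewrite ideal_mulACA principalM ideal_mulCA mulrC.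
have eMx y : twist bar calA I' y <-> twist bar calA I (y * bar (bar x) / bar x).
  by rewrite eM' -mem // barK.
(* Replacing [I] by [x I] multiplies the twist by [bar x / x], which is [mu / bar mu] for
   [mu = bar x]. *)
exists (bar x); split=> //.
apply/(gluing_sign hM bx0 Olam Olam' S S' H (h' (bar x) bx0 eMx)) => pi hpi pid'.
rewrite (odd_val_tq iI hn) // (odd_val_tq iI' (n := norm x * n)) //; last first.
  by rewrite eI'; apply: ideal_normM hn; exact: ideal_norm_principal.
have nx0 := norm_neq0 x0.
rewrite (oddvalM denL pid hpi nx0 n0).
have -> : norm (bar x) = norm x by apply: (@alg_inj _ K); rewrite !normE barK mulrC.
by case: (oddval pi n) (oddval pi (norm x)) => [] [].
Qed.

(** [N = A M] has norm [1], and an ideal [I0] with [bar I0 = N I0] has twist [M]. Multiplying [I0]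
    by an ideal equal to its conjugate keeps the twist and adjusts the signs. *)
Lemma dorman_order_surj Ord : superspecial_over_OK theta bar C p Ord ->
  exists I lam, [/\ integral_ideal I, adm I lam & Ord = R I lam].
Proof.
move=> /superspecial_glue[M [lam [hM Olam HM Od ->]]]; have [fM nM] := hM.
have [bad Hbad] := sqr_sign_congruence Olam Od.
pose N := ideal_mul calA M.
have fN : frac_ideal N by exact: frac_mul.
have eN : ideal_mul N (conj_ideal N) = OK.
  have [_ ->] := ideal_normM ideal_norm_calA nM.
  by rewrite mulfV // alg1 principal1.
have [I0 [iI0 eI0]] := ideal_hilbert90 fN eN.
have [fI0 I0O] := iI0; have [n0 hn0] := ideal_norm_exists fI0.
(* [y] collects the ramified primes where the sign of [lam] disagrees with the parity of the
   valuation of [I0]. *)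
have [y [Oy y0 Ody Hy]] := divisor_with_primes denL pid
  (fun q => bad q != odd (ideal_val (tq q) I0)) OL_d d_neq0.
have [E [iE cE hE]] := ramified_product Oy y0 Ody; have [fE EO] := iE.
pose I := ideal_mul E I0.
have iI : integral_ideal I.
  split; first exact: frac_mul.
  apply: ideal_mul_min => [|u v Eu Iv]; first exact: submod_ringint.
  by apply: ringintM; [apply: EO | apply: I0O].
have [fI _] := iI; have hI : ideal_norm I (y * n0) by exact: ideal_normM.
have cI : conj_ideal I = ideal_mul N I by rewrite /I conj_mul cE eI0 ideal_mulCA.
have tI : twist bar calA I = M.
  rewrite /twist -/(conj_ideal I) cI (ideal_mulC N) (ideal_mulKl fI (frac_submod fN)).
  exact: ideal_mulKl fA (frac_submod fM).
have S : sign_congruence (fun q => ideal_val (tq q) I) lam.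
  move=> q hq qd; have [pi [eq hr]] := ramified_gen hq qd.
  have hpi : prime_ideal (principal pi) by rewrite -eq.
  have pid' : principal pi d by rewrite -eq.
  have pi0 := prime_elt_neq0 hpi.
  have ov : odd (ideal_val (tq q) I) = oddval pi y (+) odd (ideal_val (tq q) I0).
    rewrite eq (odd_val_tq iI hI) // (odd_val_tq iI0 hn0) // (oddvalM denL pid hpi y0) //.
    by case: hn0.
  rewrite -signr_odd ov.
  suff -> : oddval pi y = (bad q != odd (ideal_val (tq q) I0)).
    have := Hbad q hq qd.
    by case: (bad q) (odd _) => [] [].
  (* [y] divides the squarefree [d], so its valuation at [pi] is odd as soon as [pi] divides it. *)
  apply/idP/idP => h; first by apply/(Hy q hq qd); rewrite eq; exact: (oddval_true_mem denL pid).
  have : q y by apply/(Hy q hq qd).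
  rewrite eq => /(principal_div _ pi0) Oyp.
  rewrite -(divfK pi0 y) mulrC (oddval_uniformizer denL pid) // => /(principal_div _ pi0) h2.
  apply: (d_squarefree hpi); have := ringintM Ody h2; congr OL; field.
  by rewrite y0 pi0.
have A : adm I lam by split; [exact: sign_congruence_coprime S | | rewrite tI].
by exists I, lam; split=> //; rewrite (dorman_order_glue (I := I)) tI.
Qed.

Lemma adm_exists I : integral_ideal I -> exists lam, adm I lam.
Proof.
case=> fI _; have [lam [h1 h2 h3]] := sign_congruence_exists
  (fun q => ideal_val (tq q) I) (twist_lattice fI).
by exists lam.
Qed.

(** * Ideal classes and classes of orders *)

Lemma ideal_equiv_sym I J : ideal_equiv I J -> ideal_equiv J I.
Proof.
case=> x x0 ->; exists x^-1; first by rewrite invr_eq0.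
apply/seteqP; split=> [y Iy|_ [_ [y Iy <-] <-]]; last by rewrite mulKf.
by exists (x * y); [exists y | rewrite mulKf].
Qed.

Lemma ideal_equiv_trans I J M : ideal_equiv I J -> ideal_equiv J M -> ideal_equiv I M.
Proof.
case=> x x0 -> [y y0 ->]; exists (y * x); first exact: mulf_neq0.
apply/seteqP; split=> [_ [_ [z Iz <-] <-]|_ [z Iz <-]]; first by exists z; rewrite // mulrA.
by exists (x * z); [exists z | rewrite mulrA].
Qed.

Lemma ideal_class_eq I J : frac_ideal J -> ideal_class I = ideal_class J <-> ideal_equiv I J.
Proof.
move=> fJ; split=> [e|e].
  have : ideal_class J J.
    split=> //; exists 1; first exact: oner_neq0.
    by apply/seteqP; split=> [x Jx|_ [x Jx <-]]; [exists x; rewrite ?mul1r | rewrite mul1r].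
  by rewrite -e => -[].
apply/seteqP; split=> M [fM h]; split=> //; last exact: ideal_equiv_trans e h.
exact: ideal_equiv_trans (ideal_equiv_sym e) h.
Qed.

Lemma integral_representative I : frac_ideal I -> exists2 J, integral_ideal J & ideal_equiv I J.
Proof.
move=> fI; have [m [m0 Om Hm]] := frac_denominator fI.
have mK : m%:A != 0 :> K by rewrite alg_eq0.
exists (ideal_mul (principal m%:A) I).
  split; first by apply: frac_mul => //; apply: frac_principal.
  by move=> x; rewrite -scale_ideal; [case=> y Iy <-; exact: Hm | exact: frac_submod].
by exists m%:A; rewrite // scale_ideal //; exact: frac_submod.
Qed.

Lemma order_class_eq Ord Ord' : superspecial_over_OK theta bar C p Ord' ->
  order_class theta bar C p Ord = order_class theta bar C p Ord' <->
  K_conjugate theta bar C Ord Ord'.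
Proof.
move=> hO; split=> [e|e].
  have : order_class theta bar C p Ord' Ord' by split=> //; exact: K_conjugate_refl.
  by rewrite -e => -[].
apply/seteqP; split=> X [hX h]; split=> //; last exact: K_conjugate_trans e h.
exact: K_conjugate_trans (K_conjugate_sym e) h.
Qed.

(** One direction of [dorman_order_conjugate] makes the class of [R I lam] independent of both the
    integral representative and [lam]; the other direction is injectivity. *)
Lemma dorman_bijection : exists f : set (set K) -> set (set B),
  set_bij (class_group K) (order_classes theta bar C p) f /\
  forall I lam, integral_ideal I -> adm I lam ->
    superspecial_over_OK theta bar C p (R I lam) /\
    f (ideal_class I) = order_class theta bar C p (R I lam).
Proof.
have /choice[f Hf] : forall X : set (set K), exists Y : set (set B),
    forall I lam, integral_ideal I -> adm I lam -> X = ideal_class I ->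
      Y = order_class theta bar C p (R I lam).
  move=> X; have [[I [lam [iI aI ->]]]|h] :=
      pselect (exists I lam, [/\ integral_ideal I, adm I lam & X = ideal_class I]).
    exists (order_class theta bar C p (R I lam)) => J mu iJ aJ e.
    apply/order_class_eq; first exact: dorman_order_superspecial.
    by apply/dorman_order_conjugate => //; apply/ideal_class_eq => //; case: iJ.
  by exists set0 => I lam iI aI e; case: h; exists I, lam.
have rep X : class_group K X ->
    exists I lam, [/\ integral_ideal I, adm I lam & X = ideal_class I].
  case=> I fI <-; have [J iJ e] := integral_representative fI.
  have [lam aJ] := adm_exists iJ; exists J, lam; split=> //.
  by apply/ideal_class_eq => //; case: iJ.
exists f; split; last first.
  by move=> I lam iI aI; split; [exact: dorman_order_superspecial | exact: Hf].
split.
- move=> X /rep[I [lam [iI aI eX]]]; rewrite /= (Hf X I lam iI aI eX).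
  by exists (R I lam) => //; exact: dorman_order_superspecial.
- move=> X Y /set_mem/rep[I [lam [iI aI eX]]] /set_mem/rep[J [mu [iJ aJ eY]]].
  rewrite (Hf X I lam iI aI eX) (Hf Y J mu iJ aJ eY) eX eY.
  move/order_class_eq => /(_ (dorman_order_superspecial iJ aJ)).
  move/(dorman_order_conjugate iI iJ aI aJ) => e.
  by apply/ideal_class_eq => //; case: iJ.
- move=> _ [Ord hO <-]; have [I [lam [iI aI eO]]] := dorman_order_surj hO.
  exists (ideal_class I); first by exists I => //; case: iI.
  by rewrite (Hf _ I lam iI aI erefl) eO.
Qed.

End QuadraticExtension.

Unset Implicit Arguments.

Theorem theorem5p8
  (* L totally real of degree g, strict class number one *)
  (g : nat) (L : fieldExtType rat)
  (hg : \dim {:L} = g)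
  (hLreal : totally_real L)
  (hLclass : strict_class_number_one L)
  (* K a primitive CM field with K^+ = L *)
  (K : fieldExtType L)
  (hK2 : \dim {:K} = 2%N)
  (hKim : totally_imaginary K)
  (hKprim : primitive_CM_field (baseFieldType K))
  (bar : {lrmorphism K -> K})
  (hbar : exists x, bar x <> x)
  (* O_K = O_L[t], relative different (sqrt d) *)
  (a b : L) (t : K)
  (ha : ring_int L a) (hb : ring_int L b)
  (ht : t ^+ 2 + a%:A * t + b%:A = 0)
  (hOK : ring_int K = adjoin_int t)
  (d : L) (hd : d = a ^+ 2 - 4 * b)
  (hdneg : totally_negative d)
  (sqrtd : K) (hsqrtd : sqrtd ^+ 2 = d%:A)
  (hdiff : different bar = principal sqrtd)
  (hd2 : coprime_elts d 2)
  (* the prime p *)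
  (p : nat) (hp : prime p) (hpodd : odd p)
  (hpunr : unramified K p)
  (hdp : coprime_elts d p%:R)
  (hpeven : forall (q : set L) (f : nat), prime_ideal q -> q p%:R ->
     residue_degree p q f -> ~~ odd f -> splits K q)
  (hpoddf : forall (q : set L) (f : nat), prime_ideal q -> q p%:R ->
     residue_degree p q f -> odd f -> inert K q)
  (* B_{p,L} = B_{p,oo} (x) L *)
  (Bp : falgType rat) (hBp : ramified_exactly_p_infinity Bp p)
  (BL : falgType L) (iota : {rmorphism Bp -> BL})
  (hBL : base_change (in_alg L) iota)
  (* alpha_0 and the ideal A *)
  (alpha0 : L)
  (hneg0 : totally_negative alpha0)
  (hprime0 : prime_ideal (principal alpha0))
  (hcop0 : coprime_elts alpha0 (2 * p%:R * d))
  (hmodd0 : forall q : set L, prime_ideal q -> q d -> q (alpha0 - p%:R))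
  (hmodp0 : principal (p%:R : L) (alpha0 - 1))
  (hsymb0 : quaternion_symbol d (alpha0 * p%:R) BL)
  (calA : set K) (hA : integral_ideal calA)
  (hAA : ideal_ext K (principal alpha0) =
     ideal_mul calA [set bar x | x in calA])
  (* B_{p,L} identified with the algebra of all [alpha, beta] *)
  (theta : {rmorphism BL -> 'M[K]_2})
  (htheta : matrix_identification bar (alpha0 * p%:R)%:A theta)
  (* lambda_q and the prime of K above q, for q | d *)
  (lamq : set L -> L) (tq : set L -> set K)
  (hlamq : forall q, prime_ideal q -> q d ->
     ring_int L (lamq q) /\ q (lamq q ^+ 2 - alpha0 * p%:R))
  (htq : forall q, prime_ideal q -> q d ->
     prime_ideal (tq q) /\ ideal_ext K q = ideal_mul (tq q) (tq q)) :
  let c := (alpha0 * p%:R)%:A : K in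
  let R := dorman_order bar calA theta c sqrtd in
  let adm := admissible bar calA d lamq tq in
  let Orders := superspecial_over_OK theta bar c p in
  [/\ (* conjugacy under K^* and automorphisms fixing K agree *)
      forall R1 R2, Orders R1 -> Orders R2 ->
        (K_conjugate theta bar c R1 R2 <-> K_automorphic theta bar c R1 R2),
      (* every integral ideal has a lambda_a *)
      forall I, integral_ideal I -> exists lambda, adm I lambda
    & (* [a] |-> R(a, lambda_a) is a bijection onto the isomorphism classes *)
      exists f : set (set K) -> set (set BL),
        set_bij (class_group K) (order_classes theta bar c p) f /\
        forall I lambda, integral_ideal I -> adm I lambda ->
          Orders (R I lambda) /\
          f (ideal_class I) = order_class theta bar c p (R I lambda)].
Proof.
have pid (I : set L) : frac_ideal I -> exists2 x, x != 0 & I = principal x.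
  move=> fI; have [x _ eI] := hLclass I fI; exists x => //.
  case: fI => _ _ _ [y]; rewrite eI => /principalE[c _ ->] h _.
  by move: h; rewrite mulf_eq0 negb_or => /andP[].
have alpha0_neq0 : alpha0 != 0 := prime_elt_neq0 hprime0.
have [Od _ _] := (coprime_eltsP _ _).1 hd2.
have hcop : coprime_elts alpha0 d.
  have /coprime_eltsP[Oa _ [u [v [Ou Ov e]]]] := hcop0.
  apply/coprime_eltsP; split=> //; exists u, (v * (2 * p%:R)).
  split=> //; last by rewrite -mulrA.
  by apply: ringintM => //; apply: ringintM; exact: ringint_nat.
have hcop_c : coprime_elts (alpha0 * p%:R) d.
  have /coprime_eltsP[Oa _ [u [v [Ou Ov e]]]] := hcop.
  have /coprime_eltsP[_ Op [u' [v' [Ou' Ov' e']]]] := hdp.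
  apply/coprime_eltsP; split=> //; first exact: ringintM.
  (* Obtained by multiplying the term [u alpha0] of [u alpha0 + v d = 1] by [u' d + v' p = 1]. *)
  exists (u * v'), (v + u * alpha0 * u'); split; first exact: ringintM.
    by apply: ringintD => //; apply: ringintM => //; exact: ringintM.
  transitivity (u * alpha0 * (u' * d + v' * p%:R) + v * d); first by ring.
  by rewrite e' mulr1.
split.
- move=> R1 R2 _ _.
  exact: (K_conjugate_automorphic hbar ha hb ht hOK hd hsqrtd alpha0_neq0 htheta hp).
- move=> I.
  exact: (adm_exists pid hbar ha hb ht hOK hd hsqrtd hd2 htq hcop hcop_c
    alpha0_neq0 hlamq hA hAA).
- exact: (dorman_bijection pid hbar ha hb ht hOK hd hsqrtd hd2 htq hcop hcop_c
    alpha0_neq0 hlamq htheta hp erefl hA hAA).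
Qed.
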